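(* Let $\Omega \subset \mathbb{R}^n$ be open, let $\mathcal{M} \subset \mathbb{R}^m$ be an embedded Riemannian submanifold, and let $f : \Omega \to \mathcal{M}$ be a map. Consider an $R$-MTSM $\mathscr{M}f$ with anchor points $p_j^* \in \mathcal{M}$, vector-valued maps $\widehat{g}_j$ on $\Omega_j \subset \Omega$, and weight functions $\varphi_j : \mathcal{M} \to \mathbb{R}$, $j=1,\dots,R$. Let $L := \kappa_\ell^-(\mathcal{M}) \le 0 \le \kappa_u^+(\mathcal{M}) =: K$ be the clipped curvature bounds. Suppose that, for all $j = 1,\dots,R$, there exist $0 < \sigma_j \le \tau_j \le \mathrm{inj}(p_j^* )$ with $\tau_j \sqrt{|L|} \le \pi$ such that: (A1) the balls $\mathcal{B}_{\sigma_j}(p_j^* )$ cover $f(\Omega) \subset \mathcal{M}$; (A2) the maps $\widehat{g}_j$ are maps $\widehat{g}_j : \Omega_j \to B_{\tau_j}(p_j^* )$, where $\Omega_j := f^{-1}(\mathcal{B}_{\sigma_j}(p_j^* ))$ is the preimage; (A3) for all $x \in \Omega_j$ the error bound \[ \bigl\| \widehat{g}_j(x) - (\mathrm{Log}_{p_j^*} \circ f)(x) \bigr\|_{p_j^*} \le \epsilon < \frac{1}{10} \min\Bigl\{ \mathrm{inj}(\mathcal{M}), \frac{\pi}{2\sqrt{K}} \Bigr\} \] holds; and (A4) the weights $\varphi_j$ form a partition of unity subordinate to the cover of $f(\Omega)$ by the larger geodesic balls $\mathcal{B}_{\tau_j}(p_j^* )$. Then, for all $x \in \Omega$, \[ \operatorname{dist}_{\mathcal{M}}\bigl(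 f(x), (\mathscr{M} f)(x) \bigr) \le 5 \epsilon . \]
   Context: For a Riemannian manifold $\mathcal{M}$ with metric $\mathbf{g}$, $\|\cdot\|_p$ is the norm on $T_p\mathcal{M}$ induced by $\mathbf{g}_p$; $\operatorname{dist}_{\mathcal{M}}(p,q)$ is the geodesic distance (infimum of lengths of piecewise smooth curves from $p$ to $q$; $\infty$ if there are none); $\mathrm{Exp}_p$ is the exponential map at $p$. Put $B_\sigma(p) := \{ v \in T_p\mathcal{M} \mid \|v\|_p < \sigma \}$ and $\mathcal{B}_\sigma(p) := \mathrm{Exp}_p(B_\sigma(p))$. The injectivity radius $\operatorname{inj}(p) > 0$ is the supremum of the $\sigma$ such that $\mathrm{Exp}_p : B_\sigma(p) \to \mathcal{B}_\sigma(p)$ is a diffeomorphism, and $\operatorname{inj}(\mathcal{M}) := \inf_{p\in\mathcal{M}} \operatorname{inj}(p)$. For $\sigma \le \operatorname{inj}(p)$ these balls are called geodesic balls, and $\mathrm{Log}_p := (\mathrm{Exp}_p|_{B_\sigma(p)})^{-1}$. Clipped curvature bounds: $\kappa_\ell^-(\mathcal{M}) := \min\{0, \inf_{p,\Sigma_p} \mathrm{sec}(\Sigma_p)\}$ and $\kappa_u^+(\mathcal{M}) := \max\{0, \sup_{p,\Sigma_p} \mathrm{sec}(\Sigma_p)\}$, where $p$ ranges over $\mathcal{M}$, $\Sigma_p$ over the $2$-dimensional linear subspaces of $T_p\mathcal{M}$, and $\mathrm{sec}$ is sectional curvature. When $K=0$, $\pi/(2\sqrt{K})$ is read as $\infty$.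 Multiple tangent space model ($R$-MTSM): given anchor points $p_j^* \in \mathcal{M}$, maps $\widehat{g}_j : \Omega_j \to T_{p_j^*}\mathcal{M}$ with $\Omega_j \subset \Omega$, and weight functions $\varphi_j : \mathcal{M} \to \mathbb{R}$ ($j=1,\dots,R$), it is \[ (\mathscr{M} f)(x) := \operatorname*{arg\,min}_{p \in \mathcal{M}} \sum_{j=1}^{R} \varphi_j\bigl(\widehat{f}_j(x)\bigr) \cdot \operatorname{dist}_{\mathcal{M}}\bigl(p, \widehat{f}_j(x)\bigr)^2, \qquad \widehat{f}_j := \mathrm{Exp}_{p_j^*} \circ \widehat{g}_j, \] with the convention $\varphi_j(\widehat{f}_j(x)) := 0$ if $x \notin \Omega_j$; summands with zero weight are omitted. Partition of unity subordinate to the cover of $f(\Omega)$ by the $\mathcal{B}_{\tau_j}(p_j^* )$: $0 \le \varphi_j \le 1$, the support of $\varphi_j$ is contained in $\mathcal{B}_{\tau_j}(p_j^* )$, and $\sum_{j=1}^R \varphi_j = 1$ on the covered set $f(\Omega)$.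
   Formalization: If all weights vanish at x, every point minimizes the empty sum and (Mf)(x) is undefined. The theorem proves that a unique minimizer exists when some weight at x is nonzero, and the bound 5ε whenever (Mf)(x) is a well-defined single point. *)

(* Defs.v *)
From HB Require Import structures.
From mathcomp Require Import all_boot all_order all_algebra.
From mathcomp Require Import all_classical all_reals all_analysis.

Set Implicit Arguments.
Unset Strict Implicit.
Unset Printing Implicit Defensive.

Import Order.TTheory GRing.Theory Num.Theory.
Import numFieldNormedType.Exports.

Local Open Scope classical_set_scope.
Local Open Scope ring_scope.

(* The library norm on ['rV[R]_m] is the sup norm; it is used below only
   through the topology and the derivatives it induces.  Lengths and angles
   are measured with the Euclidean inner product. *)
Definition dotv (R : realType) (m : nat) (u v : 'rV[R]_m) : R :=
  \sum_(i < m) u 0 i * v 0 i.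

Definition enorm (R : realType) (m : nat) (v : 'rV[R]_m) : R :=
  Num.sqrt (dotv v v).

(** Smooth maps *)

(* [Ck k U f] means that [f] is of class C^k on the open set [U], for [V] and
   [W] of finite dimension.  It does not depend on the values of [f] off [U]. *)
Fixpoint Ck (R : realType) (V W : normedModType R) (k : nat)
    (U : set V) (f : V -> W) : Prop :=
  (forall x, U x -> {for x, continuous f}) /\
  (if k is k'.+1 then
     forall v : V, (forall x, U x -> derivable f x v) /\ Ck k' U ('D_v f)
   else True).

(* Smoothness on an arbitrary subset: local extendability to a smooth map on
   an open set. *)
Definition smooth_on (R : realType) (V W : normedModType R)
    (A : set V) (h : V -> W) : Prop :=
  forall x, A x -> exists (U : set V) (F : V -> W),
    [/\ open U, U x, forall k, Ck k U F & forall y, A y -> U y -> F y = h y].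

Definition inverse_diffeos (R : realType) (V W : normedModType R)
    (A : set V) (B : set W) (h : V -> W) (k : W -> V) : Prop :=
  [/\ smooth_on A h, smooth_on B k,
      forall x, A x -> B (h x) /\ k (h x) = x &
      forall y, B y -> A (k y) /\ h (k y) = y].

Definition diffeomorphism (R : realType) (V W : normedModType R)
    (A : set V) (B : set W) (h : V -> W) : Prop :=
  exists k, inverse_diffeos A B h k.

(** Embedded submanifolds of R^m, with the metric induced by R^m *)

Definition local_param (R : realType) (m d : nat) (M : set 'rV[R]_m)
    (V : set 'rV[R]_d) (U : set 'rV[R]_m)
    (phi : 'rV[R]_d -> 'rV[R]_m) (psi : 'rV[R]_m -> 'rV[R]_d) : Prop :=
  [/\ open V, open U & inverse_diffeos V (M `&` U) phi psi].

Definition embedded_submanifold (R : realType) (m d : nat)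
    (M : set 'rV[R]_m) : Prop :=
  forall p, M p -> exists V U (phi : 'rV[R]_d -> 'rV[R]_m) psi,
    U p /\ local_param M V U phi psi.

Definition tangent (R : realType) (m : nat) (M : set 'rV[R]_m)
    (p : 'rV[R]_m) : set 'rV[R]_m :=
  [set v | exists (e : R) (c : R -> 'rV[R]_m),
     [/\ 0 < e, smooth_on `]- e, e[%classic c, forall t, t \in `]- e, e[ -> M (c t),
         c 0 = p & derive1 c 0 = v]].

(* Continuity of [c] on [0, 1] follows, since consecutive closed pieces share
   their endpoints. *)
Definition piecewise_smooth (R : realType) (m : nat)
    (c : R -> 'rV[R]_m) : Prop :=
  exists2 s : seq R, itv_partition 0 1 s &
    forall i, (i < size s)%N ->
      smooth_on `[nth 0 (0 :: s) i, nth 0 (0 :: s) i.+1]%classic c.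

(* The derivative is meaningful except at the finitely many breakpoints. *)
Definition curve_length (R : realType) (m : nat) (c : R -> 'rV[R]_m) : \bar R :=
  (\int[lebesgue_measure]_(t in `[0%R, 1%R]) (enorm (derive1 c t))%:E)%E.

Definition geodist (R : realType) (m : nat) (M : set 'rV[R]_m)
    (p q : 'rV[R]_m) : \bar R :=
  ereal_inf [set curve_length c | c in
    [set c : R -> 'rV[R]_m |
      [/\ piecewise_smooth c, forall t, t \in `[0, 1] -> M (c t),
          c 0 = p & c 1 = q]]].

(** Levi-Civita connection and curvature in a local parametrization [phi] *)

Definition partial (R : realType) (d : nat) (W : normedModType R) (i : 'I_d)
    (h : 'rV[R]_d -> W) : 'rV[R]_d -> W :=
  'D_(delta_mx 0 i) h.

Definition metric_mx (R : realType) (m d : nat) (phi : 'rV[R]_d -> 'rV[R]_m)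
    (x : 'rV[R]_d) : 'M[R]_d :=
  \matrix_(i, j) dotv (partial i phi x) (partial j phi x).

(* Gamma^k_ij =
     1/2 sum_l g^{kl} (d_i g_{jl} + d_j g_{il} - d_l g_{ij}) *)
Definition christoffel (R : realType) (m d : nat) (phi : 'rV[R]_d -> 'rV[R]_m)
    (k i j : 'I_d) (x : 'rV[R]_d) : R :=
  2^-1 * \sum_(l < d) invmx (metric_mx phi x) k l *
    (partial i (fun y => metric_mx phi y j l) x
     + partial j (fun y => metric_mx phi y i l) x
     - partial l (fun y => metric_mx phi y i j) x).

(* The component along d_l of R(d_i, d_j) d_k, with the sign convention
   R(X, Y) Z = nabla_X nabla_Y Z - nabla_Y nabla_X Z - nabla_[X, Y] Z. *)
Definition riemann (R : realType) (m d : nat) (phi : 'rV[R]_d -> 'rV[R]_m)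
    (l i j k : 'I_d) (x : 'rV[R]_d) : R :=
  partial i (christoffel phi l j k) x - partial j (christoffel phi l i k) x
  + \sum_(s < d) (christoffel phi s j k x * christoffel phi l i s x
                  - christoffel phi s i k x * christoffel phi l j s x).

Definition metric (R : realType) (m d : nat) (phi : 'rV[R]_d -> 'rV[R]_m)
    (x a b : 'rV[R]_d) : R :=
  \sum_(i < d) \sum_(j < d) metric_mx phi x i j * a 0 i * b 0 j.

Definition curvature_op (R : realType) (m d : nat)
    (phi : 'rV[R]_d -> 'rV[R]_m) (x a b c : 'rV[R]_d) : 'rV[R]_d :=
  \row_(l < d) \sum_(i < d) \sum_(j < d) \sum_(k < d)
    riemann phi l i j k x * a 0 i * b 0 j * c 0 k.

Definition sec_coord (R : realType) (m d : nat) (phi : 'rV[R]_d -> 'rV[R]_m)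
    (x a b : 'rV[R]_d) : R :=
  metric phi x (curvature_op phi x a b b) a /
  (metric phi x a a * metric phi x b b - metric phi x a b ^+ 2).

(* [is_sec d M p S s]: the sectional curvature of the plane [S] of T_p M,
   computed in some local parametrization around [p] and from some basis of
   [S], is [s]. *)
Definition is_sec (R : realType) (m d : nat) (M : set 'rV[R]_m)
    (p : 'rV[R]_m) (S : {vspace 'rV[R]_m}) (s : R) : Prop :=
  exists V U (phi : 'rV[R]_d -> 'rV[R]_m) psi (a b : 'rV[R]_d),
    [/\ local_param M V U phi psi, U p,
        basis_of S ([:: 'D_a phi (psi p); 'D_b phi (psi p)] : seq 'rV[R]_m) &
        s = sec_coord phi (psi p) a b].

Definition sec_values (R : realType) (m d : nat) (M : set 'rV[R]_m) :
    set (\bar R) :=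
  [set s%:E | s in [set s : R | exists (p : 'rV[R]_m) (S : {vspace 'rV[R]_m}),
     [/\ M p, \dim S = 2%N, forall v, v \in S -> tangent M p v &
         is_sec d M p S s]]].

Definition kappa_l (R : realType) (m d : nat) (M : set 'rV[R]_m) : \bar R :=
  Order.min 0%E (ereal_inf (sec_values d M)).

Definition kappa_u (R : realType) (m d : nat) (M : set 'rV[R]_m) : \bar R :=
  Order.max 0%E (ereal_sup (sec_values d M)).

(** Geodesics and the exponential map *)

Definition geodesic_on (R : realType) (m d : nat) (M : set 'rV[R]_m)
    (a b : R) (c : R -> 'rV[R]_m) : Prop :=
  [/\ smooth_on `]a, b[%classic c, forall t, t \in `]a, b[ -> M (c t) &
      forall V U (phi : 'rV[R]_d -> 'rV[R]_m) psi,
      local_param M V U phi psi ->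
      forall t, t \in `]a, b[ -> U (c t) -> forall k : 'I_d,
        let u : R -> 'rV[R]_d := psi \o c in
        derive1n 2 u t 0 k + \sum_(i < d) \sum_(j < d)
          christoffel phi k i j (u t) * derive1 u t 0 i * derive1 u t 0 j = 0].

Definition is_Exp (R : realType) (m d : nat) (M : set 'rV[R]_m)
    (p v q : 'rV[R]_m) : Prop :=
  exists (e : R) (c : R -> 'rV[R]_m),
    [/\ 0 < e, geodesic_on d M (- e) (1 + e) c,
        c 0 = p, derive1 c 0 = v & c 1 = q].

(* The exponential map need not be defined on the whole of T_p M; it takes the
   junk value [p] off its domain [Exp_dom]. *)
Definition Exp (R : realType) (m d : nat) (M : set 'rV[R]_m)
    (p v : 'rV[R]_m) : 'rV[R]_m :=
  xget p [set q | is_Exp d M p v q].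

Definition Exp_dom (R : realType) (m d : nat) (M : set 'rV[R]_m)
    (p : 'rV[R]_m) : set 'rV[R]_m :=
  [set v | exists q, is_Exp d M p v q].

Definition tball (R : realType) (m : nat) (M : set 'rV[R]_m)
    (p : 'rV[R]_m) (sigma : R) : set 'rV[R]_m :=
  [set v | tangent M p v /\ enorm v < sigma].

Definition geoball (R : realType) (m d : nat) (M : set 'rV[R]_m)
    (p : 'rV[R]_m) (sigma : R) : set 'rV[R]_m :=
  Exp d M p @` tball M p sigma.

Definition inj_at (R : realType) (m d : nat) (M : set 'rV[R]_m)
    (p : 'rV[R]_m) : \bar R :=
  ereal_sup [set sigma%:E | sigma in
    [set sigma : R | [/\ 0 < sigma, tball M p sigma `<=` Exp_dom d M p &
       diffeomorphism (tball M p sigma) (geoball d M p sigma) (Exp d M p)]]].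

Definition inj_radius (R : realType) (m d : nat) (M : set 'rV[R]_m) : \bar R :=
  ereal_inf [set inj_at d M p | p in M].

Definition Log (R : realType) (m d : nat) (M : set 'rV[R]_m)
    (p : 'rV[R]_m) (sigma : R) : 'rV[R]_m -> 'rV[R]_m :=
  'pinv_(fun=> 0) (tball M p sigma) (Exp d M p).

(** Multiple tangent space models *)

Definition fhat (R : realType) (n m d r : nat) (M : set 'rV[R]_m)
    (anchor : 'I_r -> 'rV[R]_m) (ghat : 'I_r -> 'rV[R]_n -> 'rV[R]_m)
    (j : 'I_r) (x : 'rV[R]_n) : 'rV[R]_m :=
  Exp d M (anchor j) (ghat j x).

Definition mtsm_weight (R : realType) (n m d r : nat) (M : set 'rV[R]_m)
    (anchor : 'I_r -> 'rV[R]_m) (Omegaj : 'I_r -> set 'rV[R]_n)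
    (ghat : 'I_r -> 'rV[R]_n -> 'rV[R]_m) (phi : 'I_r -> 'rV[R]_m -> R)
    (x : 'rV[R]_n) (j : 'I_r) : R :=
  if x \in Omegaj j then phi j (fhat d M anchor ghat j x) else 0.

Definition mtsm_objective (R : realType) (n m d r : nat) (M : set 'rV[R]_m)
    (anchor : 'I_r -> 'rV[R]_m) (Omegaj : 'I_r -> set 'rV[R]_n)
    (ghat : 'I_r -> 'rV[R]_n -> 'rV[R]_m) (phi : 'I_r -> 'rV[R]_m -> R)
    (x : 'rV[R]_n) (p : 'rV[R]_m) : \bar R :=
  (\sum_(j < r | mtsm_weight d M anchor Omegaj ghat phi x j != 0%R)
     (mtsm_weight d M anchor Omegaj ghat phi x j)%:E *
     geodist M p (fhat d M anchor ghat j x) ^+ 2)%E.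

(* [is_MTSM ... x y] says that the arg min defining the model at [x] is
   well-defined, i.e. attained at a single point, and that this point is [y].
   When all the weights vanish at [x], every point of [M] is a minimizer and
   the model has no value at [x] (unless [M] is a singleton). *)
Definition is_MTSM (R : realType) (n m d r : nat) (M : set 'rV[R]_m)
    (anchor : 'I_r -> 'rV[R]_m) (Omegaj : 'I_r -> set 'rV[R]_n)
    (ghat : 'I_r -> 'rV[R]_n -> 'rV[R]_m) (phi : 'I_r -> 'rV[R]_m -> R)
    (x : 'rV[R]_n) (y : 'rV[R]_m) : Prop :=
  [set p | M p /\ forall q, M q ->
     (mtsm_objective d M anchor Omegaj ghat phi x p <=
      mtsm_objective d M anchor Omegaj ghat phi x q)%E] = [set y].

(* The support is the closure in [M] of the set of points of [M] where the
   function does not vanish; [D] is the covered set. *)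
Definition subordinate_partition_of_unity (R : realType) (m r : nat)
    (M D : set 'rV[R]_m) (B : 'I_r -> set 'rV[R]_m)
    (phi : 'I_r -> 'rV[R]_m -> R) : Prop :=
  [/\ forall j p, M p -> 0 <= phi j p <= 1,
      forall j, M `&` closure [set p | M p /\ phi j p != 0] `<=` B j &
      forall p, D p -> \sum_(j < r) phi j p = 1].

(* Main.v *)
(* Fix x and put p = f x. Any two points of the tangent ball at an anchor p_j
   are mapped by Exp to points whose distance is at most sinh(pi)/pi <= 4 times
   the distance of their preimages (Rauch comparison with sec >= L and
   tau_j sqrt|L| <= pi), so that each data point q_j entering the average with a
   nonzero weight is within 4 eps of p. The radius 10 eps is smaller than the
   injectivity radius and than pi/(2 sqrt K), so that along a geodesic staying
   within distance 10 eps of q the function d(q, .)^2 is uniformly convex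
   (Hessian comparison with sec <= K). If 5 eps < d(p, y) <= 8 eps, this convexity along
   the geodesic from p to y shows that its point at distance 4 eps from p is
   strictly closer than y to every q_j; if d(p, y) > 8 eps then p itself is.
   Hence the weighted sum of squared distances has all its minimizers in the
   compact ball of radius 5 eps about p, where one exists; it is unique because
   two of them would be joined by a geodesic in the ball whose midpoint does
   better.

   The Riemannian geometry is done in the charts v |-> Exp_p(v B), the rows of B
   being a basis of T_p M. There the Christoffel symbols satisfy G_x(x, x) = 0,
   whence the Gauss lemma, the Jacobi equation along rays, and both comparison
   estimates as Riccati inequalities between quadratic forms. *)

Require Import Defs.
From HB Require Import structures.
From mathcomp Require Import all_boot all_order all_algebra.
From mathcomp Require Import all_classical all_reals all_analysis.
From mathcomp Require Import measurable_realfun.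
From mathcomp Require Import ring lra.
Set Implicit Arguments.
Unset Strict Implicit.
Unset Printing Implicit Defensive.
Import Order.TTheory GRing.Theory Num.Theory.
Import numFieldNormedType.Exports.
Local Open Scope classical_set_scope.
Local Open Scope ring_scope.

(** * Calculus of C^k maps *)

(** [M] is not assumed complete and [Exp] may be undefined far out, so no Hopf-Rinow theorem is at
    hand: a single radius [b] with [10 eps < b < inj(M)] is fixed, every point of [M] has a normal
    chart of that radius, and distances are only compared below [b]. There the distance from the
    centre is the Euclidean norm of the tangent vector, because a curve of length less than [b]
    starting at the centre cannot leave the chart. The triangle inequality and symmetry are read off
    this description, without concatenating or reversing curves. No Jacobi field has to be
    constructed: in a normal chart the fields are [t w], and only their Riccati form is propagated.
    Origin of the constants: beyond [8 = 4 + 4] the triangle inequality alone makes [p] better than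
    [y]; a segment of length at most [8 eps] whose ends are within [4 eps] and [8 eps] of [q] stays
    within half of [4 + 8 + 8], that is [10 eps], of [q]; within [4 eps] of [q] the convexity
    constant is at least [cos (pi / 5) >= 3/4], and the balance [16 - 1 - 3 * 5 = 0] fixes the
    [5]. *)

Section CkTheory.
Context {R : realType}.
Implicit Types V W : normedModType R.

Lemma Ck_cont V W k U (f : V -> W) x : Ck k U f -> U x -> {for x, continuous f}.
Proof. by case: k => [|k] [h _]; exact: h. Qed.

Lemma Ck_derivable V W k U (f : V -> W) v x :
  Ck k.+1 U f -> U x -> derivable f x v.
Proof. by move=> [_ /(_ v)[h _]]; exact: h. Qed.

Lemma Ck_D V W k U (f : V -> W) v : Ck k.+1 U f -> Ck k U ('D_v f).
Proof. by move=> [_ /(_ v)[]]. Qed.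

Lemma CkW V W k U (f : V -> W) : Ck k.+1 U f -> Ck k U f.
Proof.
elim: k f => [|k IH] f [c h]; first by split.
by split=> // v; have [h1 h2] := h v; split=> //; exact: IH.
Qed.

Lemma Ck_sub V W k (U U' : set V) (f : V -> W) :
  U' `<=` U -> Ck k U f -> Ck k U' f.
Proof.
move=> sU; elim: k f => [|k IH] f [c h]; first by split=> // x /sU; exact: c.
split=> [x /sU|v]; first exact: c.
by have [h1 h2] := h v; split=> [x /sU|]; [exact: h1|exact: IH].
Qed.

Lemma Ck_eq V W k (U : set V) (f g : V -> W) : open U ->
  (forall x, U x -> f x = g x) -> Ck k U f -> Ck k U g.
Proof.
move=> oU; elim: k f g => [|k IH] f g fg [c h].
  split=> // x Ux; rewrite /prop_for /continuous_at -(fg _ Ux).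
  apply: cvg_trans (c _ Ux); apply: near_eq_cvg.
  by near=> y; apply: fg; near: y; exact: open_nbhs_nbhs.
have nfg x : U x -> \near x, f x = g x.
  by move=> Ux; near=> y; apply: fg; near: y; exact: open_nbhs_nbhs.
split=> [x Ux|v].
  rewrite /prop_for /continuous_at -(fg _ Ux).
  by apply: cvg_trans (c _ Ux); apply: near_eq_cvg; exact: nfg.
have [h1 h2] := h v; split=> [x Ux|].
  by apply: near_eq_derivable (h1 _ Ux); exact: nfg.
apply: IH h2 => x Ux; exact/near_eq_derive/nfg.
Unshelve. all: by end_near. Qed.

Lemma Ck_cst V W k (U : set V) (a : W) : Ck k U (fun=> a).
Proof.
elim: k a => [|k IH] a; split=> //; do ?[by move=> x _; exact: cst_continuous].
move=> v; split=> [x _|]; first exact: derivable_cst.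
rewrite (_ : 'D_v (fun=> a) = fun=> 0) //.
by apply/funext => x; exact: derive_cst.
Qed.

Lemma CkD V W k (U : set V) (f g : V -> W) : open U ->
  Ck k U f -> Ck k U g -> Ck k U (fun x => f x + g x).
Proof.
move=> oU; elim: k f g => [|k IH] f g [cf hf] [cg hg].
  by split=> // x Ux; apply: cvgD; [exact: cf|exact: cg].
split=> [x Ux|v]; first by apply: cvgD; [exact: cf|exact: cg].
have [hf1 hf2] := hf v; have [hg1 hg2] := hg v; split=> [x Ux|].
  by apply: derivableD; [exact: hf1|exact: hg1].
apply: Ck_eq (IH _ _ hf2 hg2) => // x Ux.
by rewrite deriveD //; [exact: hf1|exact: hg1].
Qed.

Lemma CkM V k (U : set V) (f g : V -> R) : open U ->
  Ck k U f -> Ck k U g -> Ck k U (fun x => f x * g x).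
Proof.
move=> oU; elim: k f g => [|k IH] f g Cf Cg.
  by split=> // x Ux; apply: cvgM; [exact: (Ck_cont Cf)|exact: (Ck_cont Cg)].
split=> [x Ux|v]; first by apply: cvgM; [exact: (Ck_cont Cf)|exact: (Ck_cont Cg)].
split=> [x Ux|].
  by apply: derivableM; [exact: Ck_derivable Cf Ux|exact: Ck_derivable Cg Ux].
apply: (@Ck_eq _ _ _ _ (fun x => f x * 'D_v g x + g x * 'D_v f x)) => // [x Ux|].
  by rewrite deriveM //; [exact: Ck_derivable Cf Ux|exact: Ck_derivable Cg Ux].
by apply: CkD => //; apply: IH; do ?[exact: Ck_D|exact: CkW].
Qed.

Lemma Ck_sum V W k (U : set V) (I : Type) (s : seq I) (P : pred I)
  (f : I -> V -> W) : open U -> (forall i, P i -> Ck k U (f i)) ->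
  Ck k U (fun x => \sum_(i <- s | P i) f i x).
Proof.
move=> oU h; elim: s => [|i s IH].
  by rewrite (_ : (fun x => _) = fun=> 0); [exact: Ck_cst|apply/funext=> x; rewrite big_nil].
case Pi: (P i).
  rewrite (_ : (fun x => _) = fun x => f i x + \sum_(i <- s | P i) f i x); last first.
    by apply/funext => x; rewrite big_cons Pi.
  by apply: CkD => //; exact: h.
by rewrite (_ : (fun x => _) = fun x => \sum_(i <- s | P i) f i x) //;
  apply/funext => x; rewrite big_cons Pi.
Qed.

Lemma Ck_prod V k (U : set V) (I : Type) (s : seq I) (P : pred I)
  (f : I -> V -> R) : open U -> (forall i, P i -> Ck k U (f i)) ->
  Ck k U (fun x => \prod_(i <- s | P i) f i x).
Proof.
move=> oU h; elim: s => [|i s IH].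
  by rewrite (_ : (fun x => _) = fun=> 1); [exact: Ck_cst|apply/funext=> x; rewrite big_nil].
case Pi: (P i).
  rewrite (_ : (fun x => _) = fun x => f i x * \prod_(i <- s | P i) f i x); last first.
    by apply/funext => x; rewrite big_cons Pi.
  by apply: CkM => //; exact: h.
by rewrite (_ : (fun x => _) = fun x => \prod_(i <- s | P i) f i x) //;
  apply/funext => x; rewrite big_cons Pi.
Qed.

Lemma CkN V k (U : set V) (f : V -> R) : open U ->
  Ck k U f -> Ck k U (fun x => - f x).
Proof.
move=> oU Cf; rewrite (_ : (fun x => _) = fun x => -1 * f x).
  by apply: CkM => //; exact: Ck_cst.
by apply/funext=> x; rewrite mulN1r.
Qed.

Lemma CkV V k (U : set V) (f : V -> R) : open U ->
  (forall x, U x -> f x != 0) -> Ck k U f -> Ck k U (fun x => (f x)^-1).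
Proof.
move=> oU f0; elim: k => [|k IH] Cf.
  by split=> // x Ux; apply: cvgV; [exact: f0|exact: (Ck_cont Cf)].
split=> [x Ux|v]; first by apply: cvgV; [exact: f0|exact: (Ck_cont Cf)].
split=> [x Ux|].
  by apply: derivableV; [exact: f0|exact: Ck_derivable Cf Ux].
apply: (@Ck_eq _ _ _ _ (fun x => - ((f x)^-1 * (f x)^-1 * 'D_v f x))) => // [x Ux|].
  rewrite deriveV; [|exact: f0|exact: Ck_derivable Cf Ux].
  by rewrite /GRing.scale /= mulNr -exprVn expr2.
have := IH (CkW Cf) => {}IH.
by apply: CkN => //; apply: CkM; [|apply: CkM|exact: Ck_D].
Qed.

Lemma cvg_mx_coord (T : Type) (F : set_system T) (FF : Filter F) m n
    (f : T -> 'M[R]_(m, n)) (l : 'M[R]_(m, n)) :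
  (forall i j, f x i j @[x --> F] --> l i j) -> f @ F --> l.
Proof.
move=> h; apply/cvgrPdist_le => /= e e0; near=> x.
rewrite /Num.Def.normr/= mx_normrE (bigmax_le _ (ltW e0))//= => i _.
rewrite !mxE/=; move: i; near: x; apply: filter_forall => /= i.
by have /cvgrPdist_le := h i.1 i.2; exact.
Unshelve. all: by end_near. Qed.

Lemma cvg_coord_mx (T : Type) (F : set_system T) (FF : Filter F) m n
    (f : T -> 'M[R]_(m, n)) (l : 'M[R]_(m, n)) i j :
  f @ F --> l -> f x i j @[x --> F] --> l i j.
Proof.
move=> h; apply: (@cvg_comp _ _ _ f (fun M : 'M[R]_(m, n) => M i j) _ _ _ h).
exact: coord_continuous.
Qed.

Lemma Ck_coordP V m n k (U : set V) (f : V -> 'M[R]_(m, n)) : open U ->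
  Ck k U f <-> forall i j, Ck k U (fun x => f x i j).
Proof.
move=> oU; split.
  elim: k f => [|k IH] f Cf i j.
    by split=> // x Ux; apply: cvg_coord_mx; exact: (Ck_cont Cf).
  split=> [x Ux|v]; first by apply: cvg_coord_mx; exact: (Ck_cont Cf).
  have df x : U x -> derivable f x v by exact: Ck_derivable Cf.
  split=> [x /df /derivable_mxP|]; first exact.
  apply: Ck_eq (IH _ (Ck_D v Cf) i j) => // x Ux.
  by rewrite derive_mx ?mxE//; exact: df.
elim: k f => [|k IH] f Cf.
  by split=> // x Ux; apply: cvg_mx_coord => i j; exact: (Ck_cont (Cf i j)).
split=> [x Ux|v].
  by apply: cvg_mx_coord => i j; exact: (Ck_cont (Cf i j)).
have df x : U x -> derivable f x v.
  by move=> Ux; apply/derivable_mxP => i j; exact: Ck_derivable (Cf i j) Ux.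
split=> //; apply: IH => i j; apply: Ck_eq (Ck_D v (Cf i j)) => // x Ux.
by rewrite derive_mx ?mxE//; exact: df.
Qed.

(** Both difference quotients are the same function of [h], so derivability in a direction is a
    statement about one real variable; the rules below are reduced to lines in this way. *)
Lemma is_derive_lineP V W (f : V -> W) y v (s : R) D :
  is_derive s 1 (fun t => f (y + t *: v)) D <-> is_derive (y + s *: v) v f D.
Proof.
have E : (fun h : R => h^-1 *: (((fun t => f (y + t *: v)) \o shift s) (h *: 1)
     - f (y + s *: v))) =
   (fun h => h^-1 *: ((f \o shift (y + s *: v)) (h *: v) - f (y + s *: v))).
  apply/funext => h /=; rewrite [h%:A]mulr1 scalerDl.
  by rewrite addrCA.
by split=> -[]; rewrite /derivable /derive => h1 h2; split; move: h1 h2;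
  rewrite /derivable /derive E.
Qed.

Lemma is_derive_line V W (f : V -> W) y v (s : R) :
  derivable f (y + s *: v) v ->
  is_derive s 1 (fun t => f (y + t *: v)) ('D_v f (y + s *: v)).
Proof. by move=> h; apply/is_derive_lineP. Qed.

Lemma is_derive_compR W (f : R -> R) (g : R -> W) (s df : R) (dg : W) :
  is_derive s 1 f df -> is_derive (f s) 1 g dg ->
  is_derive s 1 (g \o f) (df *: dg).
Proof.
move=> [/derivable1_diffP hf <-] [/derivable1_diffP hg <-].
have hgf : differentiable (g \o f) s by exact: differentiable_comp.
split; first exact/derivable1_diffP.
have E : 'D_1 f s = 'D_1 f s *: (1 : R) by rewrite [RHS]mulr1.
rewrite (deriveE _ hgf) diff_comp //= -(deriveE _ hf) E linearZ /=.
by rewrite -E (deriveE _ hg).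
Qed.

(** Only derivability in the direction [v] is assumed, so no linear differential is available;
    rescaling the parameter of the line gives homogeneity. *)
Lemma is_derive_scalev V W (f : V -> W) x v (a : R) :
  derivable f x v -> is_derive x (a *: v) f (a *: 'D_v f x).
Proof.
move=> df; have E : x = x + 0 *: (a *: v) by rewrite scale0r addr0.
rewrite {1}E; apply/is_derive_lineP.
rewrite (_ : (fun t : R => _) = (fun t => f (x + t *: v)) \o (fun s => s * a)).
  apply: is_derive_compR.
    by apply: is_derive_eq; rewrite ?scaler0 ?add0r ?[LHS]mulr1.
  by rewrite mul0r; apply/is_derive_lineP; rewrite scale0r addr0; exact: derivableP.
by apply/funext => t /=; rewrite scalerA.
Qed.

Lemma mvt01 (c dc : R -> R) : (forall s : R, 0 <= s <= 1 -> is_derive s 1 c (dc s)) ->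
  exists2 xi : R, 0 <= xi <= 1 & c 1 - c 0 = dc xi.
Proof.
move=> h; have [xi xi01 E] : exists2 xi : R, xi \in `[0, 1] & c 1 - c 0 = dc xi * (1 - 0).
  apply: MVT_segment => //.
    by move=> s /itvP s01; apply: h; rewrite !s01.
  apply: derivable_within_continuous => s /itvP s01.
  by have [] := h s; rewrite ?s01.
by exists xi; [rewrite !(itvP xi01)|rewrite E subr0 mulr1].
Qed.

Lemma mvt_line V (f : V -> R) y v :
  (forall s : R, 0 <= s <= 1 -> derivable f (y + s *: v) v) ->
  exists2 xi : R, 0 <= xi <= 1 & f (y + v) - f y = 'D_v f (y + xi *: v).
Proof.
move=> h; have [s s01|xi xi01] := @mvt01 (fun t => f (y + t *: v))
    (fun s => 'D_v f (y + s *: v)).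
  by apply: is_derive_line; exact: h.
by rewrite scale1r scale0r addr0 => E; exists xi.
Qed.

Lemma differentiable_eps V W (f : V -> W) (L : {linear V -> W}) (x : V) :
  continuous L ->
  (forall e, 0 < e -> \forall h \near 0,
     `|f (h + x) - f x - L h| <= e * `|h|) ->
  differentiable f x.
Proof.
move=> Lc h.
suff hL : f \o shift x = cst (f x) + L +o_ 0 id.
  have dL : 'd f x = L :> (_ -> _) by exact: diff_unique.
  by apply/diff_locallyP; rewrite dL.
apply/eqaddoP => e e0; apply: filterS (h _ e0) => y.
by rewrite [X in _ -> `|X| <= _](_ : _ = f (y + x) - f x - L y) // -addrA -opprD.
Qed.

(** [Ck] speaks of directional derivatives only; the differential comes from changing the
    coordinates of the increment one at a time, with the mean value theorem on each axis-parallel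
    step and continuity of the partial derivatives. *)
Lemma C1_differentiable n (U : set 'rV[R]_n) (f : 'rV[R]_n -> R) x :
  open U -> Ck 1 U f -> U x -> differentiable f x.
Proof.
move=> oU Cf Ux.
pose L (h : 'rV[R]_n) : R := \sum_(i < n) h 0 i * 'D_(delta_mx 0 i) f x.
have Ll : linear L.
  move=> a u v; rewrite /L scaler_sumr -big_split /=; apply: eq_bigr => i _.
  by rewrite !mxE mulrDl scalerAl.
pose LM := GRing.isLinear.Build _ _ _ _ _ Ll.
pose LL : {linear _ -> _} := HB.pack L LM.
have Lc : continuous LL.
  move=> h /=; apply: (@Ck_cont _ _ 0 setT) => //.
  apply: Ck_sum => [|i _]; first exact: openT.
  apply: CkM; [exact: openT| |exact: Ck_cst].
  by split=> // y _; exact: coord_continuous.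
apply: (@differentiable_eps _ _ f LL) => // _/posnumP[e].
pose e' := e%:num / n.+1%:R.
have e'0 : 0 < e' by rewrite /e' divr_gt0 // ltr0Sn.
have hnear : \forall y \near x, U y /\ forall i,
    `|'D_(delta_mx 0 i) f y - 'D_(delta_mx 0 i) f x| <= e'.
  near=> y; split; first by near: y; exact: open_nbhs_nbhs.
  near: y; apply: filter_forall => i.
  have /cvgrPdist_le := Ck_cont (Ck_D (delta_mx 0 i) Cf) Ux.
  by move=> /(_ _ e'0); apply: filterS => y; rewrite distrC.
have /nbhs_ballP[d /= d0 hd] := hnear.
near=> h.
have hh : `|h| < d.
  near: h; apply/nbhs_ballP; exists d => //= h.
  by rewrite -ball_normE /= sub0r normrN.
pose P (k : nat) : 'rV[R]_n := \row_(i < n) if (i < k)%N then h 0 i else 0.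
have hP k (kn : (k < n)%N) (s : R) : `|s| <= 1 ->
    `|P k + (s * h 0 (Ordinal kn)) *: delta_mx 0 (Ordinal kn)| <= `|h|.
  move=> s1; rewrite [leLHS]/Num.Def.normr/= mx_normrE.
  apply: bigmax_le => // -[i j] _ /=; rewrite !mxE !ord1 eqxx /=.
  have hj : `|h 0 j| <= `|h|.
    by rewrite [leRHS]/Num.Def.normr/= mx_normrE; apply: (le_bigmax _ _ (ord0, j)).
  have [jk|kj] := ltnP j k.
    rewrite (_ : j == _ = false) ?mulr0 ?addr0 //.
    by apply/negbTE/eqP => jE; rewrite jE /= ltnn in jk.
  rewrite add0r; case: (j == _); last by rewrite mulr0 normr0.
  have hj' : `|h 0 (Ordinal kn)| <= `|h|.
    by rewrite [leRHS]/Num.Def.normr/= mx_normrE; apply: (le_bigmax _ _ (ord0, Ordinal kn)).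
  by rewrite mulr1 normrM (le_trans _ hj') // ler_piMl.
have PS k (kn : (k < n)%N) : P k.+1 = P k + h 0 (Ordinal kn) *: delta_mx 0 (Ordinal kn).
  apply/rowP => j; rewrite !mxE eqxx /= ltnS leq_eqVlt.
  case: (ltngtP j k) => [jk|jk|jk] /=.
  - by rewrite (_ : j == _ = false) ?mulr0 ?addr0 //; apply/negbTE/eqP => jE; rewrite jE /= ltnn in jk.
  - by rewrite (_ : j == _ = false) ?mulr0 ?addr0 //; apply/negbTE/eqP => jE; rewrite jE /= ltnn in jk.
  - by rewrite add0r (_ : j = Ordinal kn) ?eqxx ?mulr1 //; exact: val_inj.
have step k (kn : (k < n)%N) : `|f (P k.+1 + x) - f (P k + x)
    - h 0 (Ordinal kn) * 'D_(delta_mx 0 (Ordinal kn)) f x| <= e' * `|h|.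
  set ei := delta_mx 0 (Ordinal kn); pose a : R := h 0 (Ordinal kn).
  rewrite -/a.
  have cU (s : R) : 0 <= s <= 1 -> U (P k + x + s *: (a *: ei)) /\
      `|'D_ei f (P k + x + s *: (a *: ei)) - 'D_ei f x| <= e'.
    move=> /andP[s0 s1]; have [|] := hd (P k + x + s *: (a *: ei)).
      rewrite -ball_normE /= opprD [P k + x]addrC opprD addrA addrA subrr add0r.
      rewrite -opprD normrN scalerA; apply: le_lt_trans hh; apply: hP.
      by rewrite ger0_norm.
    by move=> hU /(_ (Ordinal kn)).
  have [|xi xi01] := @mvt_line _ f (P k + x) (a *: ei).
    move=> s /cU [hU _]; exact: Ck_derivable Cf hU.
  have [hU hxi] := cU _ xi01.
  have [_ ->] := is_derive_scalev a (Ck_derivable Cf hU : derivable f _ ei).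
  rewrite addrAC -PS => ->.
  by rewrite -scalerBr normrZ mulrC ler_pM //;
    rewrite [leRHS]/Num.Def.normr/= mx_normrE; apply: (le_bigmax _ _ (ord0, Ordinal kn)).
have tele : f (h + x) - f x = \sum_(0 <= k < n) (f (P k.+1 + x) - f (P k + x)).
  rewrite (telescope_sumr (fun k => f (P k + x))) //; congr (f _ - f _).
    by congr (_ + _); apply/rowP => j; rewrite mxE ltn_ord.
  by rewrite (_ : P 0 = 0) ?add0r //; apply/rowP => j; rewrite !mxE.
rewrite /= tele big_mkord /L -sumrB.
apply: le_trans (ler_norm_sum _ _ _) _.
apply: (@le_trans _ _ (\sum_(i < n) e' * `|h|)).
  apply: ler_sum => i _; have := step i (ltn_ord i).
  by rewrite (_ : Ordinal (ltn_ord i) = i) //; exact: val_inj.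
rewrite sumr_const card_ord -mulr_natl mulrA ler_wpM2r //.
rewrite /e' mulrA ler_pdivrMr // mulrC ler_wpM2l // ler_nat //.
Unshelve. all: by end_near. Qed.

Lemma C1_differentiable_mx n p q (U : set 'rV[R]_n) (f : 'rV[R]_n -> 'M[R]_(p, q)) x :
  open U -> Ck 1 U f -> U x -> differentiable f x.
Proof.
move=> oU /(Ck_coordP _ _ oU) Cf Ux.
have -> : f = \sum_i \sum_j (fun y => f y i j *: delta_mx i j).
  apply/funext => y; rewrite {1}[f y]matrix_sum_delta !fct_sumE.
  by apply: eq_bigr => i _; rewrite fct_sumE.
apply: differentiable_sum => i; apply: differentiable_sum => j.
by apply: differentiableZl; exact: C1_differentiable (Cf i j) Ux.
Qed.

Lemma derive_sum_coord n W (f : 'rV[R]_n -> W) x w : differentiable f x ->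
  'D_w f x = \sum_(i < n) w 0 i *: 'D_(delta_mx 0 i) f x.
Proof.
move=> df; rewrite deriveE // [in LHS](row_sum_delta w) linear_sum /=.
by apply: eq_bigr => i _; rewrite linearZ /= deriveE.
Qed.

Lemma is_derive_comp V n W (f : V -> 'rV[R]_n) (g : 'rV[R]_n -> W) x v :
  derivable f x v -> differentiable g (f x) ->
  is_derive x v (g \o f) ('D_('D_v f x) g (f x)).
Proof.
move=> df dg; have E : x = x + 0 *: v by rewrite scale0r addr0.
have hc : is_derive (0 : R) 1 (fun t : R => f (x + t *: v)) ('D_v f x).
  by apply/is_derive_lineP; rewrite -E; exact: derivableP.
rewrite {1}E; apply/is_derive_lineP.
rewrite (_ : (fun t : R => _) = g \o (fun t => f (x + t *: v))) //.
have [hc1 hc2] := hc.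
have dc : differentiable (fun t : R => f (x + t *: v)) 0 by exact/derivable1_diffP.
have dg' : differentiable g ((fun t : R => f (x + t *: v)) 0) by rewrite -E.
have dgc : differentiable (g \o (fun t : R => f (x + t *: v))) 0.
  exact: differentiable_comp.
split; first exact/derivable1_diffP.
rewrite (deriveE _ dgc) diff_comp //= -(deriveE _ dc) hc2 -E.
by rewrite (deriveE _ dg).
Qed.

(** By [derive_sum_coord] the derivative of the composite is a finite sum of products of functions
    one degree less smooth, so the induction on [k] closes. *)
Lemma Ck_comp V n k (U : set V) (U' : set 'rV[R]_n) (f : V -> 'rV[R]_n)
    (g : 'rV[R]_n -> R) : open U -> open U' -> (forall x, U x -> U' (f x)) ->
  Ck k U f -> Ck k U' g -> Ck k U (g \o f).
Proof.
move=> oU oU' fU; elim: k g => [|k IH] g Cf Cg.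
  split=> // x Ux; apply: continuous_comp; first exact: (Ck_cont Cf).
  by apply: (Ck_cont Cg); exact: fU.
have Cg1 : Ck 1 U' g by elim: k {IH Cf} Cg => // k IHk /CkW.
have dgf x v : U x -> is_derive x v (g \o f) ('D_('D_v f x) g (f x)).
  move=> Ux; apply: is_derive_comp; first exact: Ck_derivable Cf Ux.
  by apply: C1_differentiable Cg1 _; [|exact: fU].
split=> [x Ux|v].
  apply: continuous_comp; first exact: (Ck_cont Cf).
  by apply: (Ck_cont Cg); exact: fU.
split=> [x Ux|]; first by have [] := dgf x v Ux.
apply: (@Ck_eq _ _ _ _ (fun x => \sum_(i < n)
   'D_v f x 0 i * ('D_(delta_mx 0 i) g \o f) x)) => // [x Ux|].
  have [_ ->] := dgf x v Ux; rewrite derive_sum_coord //.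
  by apply: C1_differentiable Cg1 _; [|exact: fU].
apply: Ck_sum => // i _; apply: CkM => //.
  by have /(Ck_coordP _ _ oU) := Ck_D v Cf; apply.
by apply: IH; [exact: CkW|exact: Ck_D].
Qed.

Lemma Ck_comp_mx V n p q k (U : set V) (U' : set 'rV[R]_n) (f : V -> 'rV[R]_n)
    (g : 'rV[R]_n -> 'M[R]_(p, q)) : open U -> open U' ->
    (forall x, U x -> U' (f x)) ->
  Ck k U f -> Ck k U' g -> Ck k U (g \o f).
Proof.
move=> oU oU' fU Cf /(Ck_coordP _ _ oU') Cg; apply/(Ck_coordP _ _ oU) => i j.
exact: (@Ck_comp _ _ _ _ U' f (fun x => g x i j)).
Qed.

End CkTheory.

(** * One-variable analysis and quadratic forms *)

Section RealAnalysis.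
Context {R : realType}.

Lemma mvt_ab (f df : R -> R) (a b : R) : a <= b ->
  (forall t : R, a <= t <= b -> is_derive t 1 f (df t)) ->
  exists2 c : R, a <= c <= b & f b - f a = df c * (b - a).
Proof.
move=> ab h; have [c cab E] : exists2 c : R, c \in `[a, b] & f b - f a = df c * (b - a).
  apply: MVT_segment => //.
    by move=> s /itvP s01; apply: h; rewrite !s01.
  apply: derivable_within_continuous => s /itvP s01.
  by have [] := h s; rewrite ?s01.
by exists c => //; rewrite !(itvP cab).
Qed.

Lemma derive_ge0_le (f df : R -> R) (a b : R) : a <= b ->
  (forall t : R, a <= t <= b -> is_derive t 1 f (df t)) ->
  (forall t : R, a <= t <= b -> 0 <= df t) -> f a <= f b.
Proof.
move=> ab h h0; have [c cab E] := mvt_ab ab h.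
by rewrite -subr_ge0 E mulr_ge0 ?subr_ge0 //; exact: h0.
Qed.

Lemma derive_le0_ge (f df : R -> R) (a b : R) : a <= b ->
  (forall t : R, a <= t <= b -> is_derive t 1 f (df t)) ->
  (forall t : R, a <= t <= b -> df t <= 0) -> f b <= f a.
Proof.
move=> ab h h0; have [c cab E] := mvt_ab ab h.
by rewrite -subr_le0 E mulr_le0_ge0 ?subr_ge0 //; exact: h0.
Qed.

(** At the supremum of the points up to which [P] holds, the limit hypothesis gives [P], and the
    step hypothesis goes further unless that point is [b]. The continuation arguments below all rest
    on this. *)
Lemma real_induction (a b : R) (P : R -> Prop) : P a ->
  (forall t, a <= t < b -> (forall s, a <= s <= t -> P s) ->
     exists2 e, 0 < e & forall s, t < s < t + e -> s <= b -> P s) ->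
  (forall t, a < t <= b -> (forall s, a <= s < t -> P s) -> P t) ->
  forall t, a <= t <= b -> P t.
Proof.
move=> Pa hstep hlim t /andP[at_ tb].
have ab : a <= b by exact: le_trans tb.
pose S := [set u : R | a <= u <= b /\ forall s, a <= s <= u -> P s].
have Sa : S a.
  split; first by rewrite lexx ab.
  by move=> s /andP[as_ sa]; rewrite (_ : s = a) //; apply/eqP; rewrite eq_le sa as_.
have hS : has_sup S.
  by split; [exists a|exists b => u [/andP[]]].
pose u := sup S.
have au : a <= u by exact: sup_upper_bound.
have ub : u <= b by apply: ge_sup; [exists a|move=> v [/andP[]]].
have ltu s : a <= s < u -> P s.
  move=> /andP[as_ su]; have e0 : 0 < u - s by rewrite subr_gt0.
  have [v [_ hv] sv] := sup_adherent e0 hS.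
  by apply: hv; rewrite as_ /=; apply: ltW; move: sv; rewrite opprB addrCA subrr addr0.
have leu s : a <= s <= u -> P s.
  move=> /andP[as_]; rewrite le_eqVlt => /orP[/eqP ->|su]; last by apply: ltu; rewrite as_.
  have [<- //|nau] := eqVneq a u; apply: hlim => //.
  by rewrite lt_neqAle nau au ub.
have [ub'|] := ltP u b; last by move=> bu; apply: leu; rewrite at_ (le_trans tb).
have [|e e0 he] := hstep u _ leu; first by rewrite au.
pose v := Num.min (u + e / 2) b.
have uv : u < v by rewrite /v lt_min ub' ltrDl divr_gt0.
suff Sv : S v by have := sup_upper_bound hS Sv; rewrite leNgt uv.
split; first by rewrite (le_trans au (ltW uv)) /= /v ge_min lexx orbT.
move=> s /andP[as_ sv]; have [su|us] := leP s u; first by apply: leu; rewrite as_.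
move: sv; rewrite /v le_min => /andP[s1 s2]; apply: he => //.
by rewrite us (le_lt_trans s1) // ltrD2l gtr_pMr // invf_lt1 // ltr1n.
Qed.

Definition qform d (q : 'M[R]_d) (w : 'rV[R]_d) : R :=
  \sum_(i < d) \sum_(j < d) q i j * w 0 i * w 0 j.

Lemma qformZ d (q : 'M[R]_d) a w : qform q (a *: w) = a ^+ 2 * qform q w.
Proof.
rewrite /qform mulr_sumr; apply: eq_bigr => i _; rewrite mulr_sumr.
by apply: eq_bigr => j _; rewrite !mxE; ring.
Qed.

Lemma qform0 d (q : 'M[R]_d) : qform q 0 = 0.
Proof. by rewrite -(scale0r 0) qformZ expr0n mul0r. Qed.

Lemma le_coord_norm d (w : 'rV[R]_d) i : `|w 0 i| <= `|w|.
Proof.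
by rewrite [leRHS]/Num.Def.normr/= mx_normrE; apply: (le_bigmax _ _ (ord0, i)).
Qed.

Lemma qform_bound d (q : 'M[R]_d) e w : (forall i j, `|q i j| <= e) ->
  `|qform q w| <= (d * d)%:R * e * `|w| ^+ 2.
Proof.
move=> qe; apply: le_trans (ler_norm_sum _ _ _) _.
rewrite natrM -2!mulrA mulr_natl -[X in _ *+ X](card_ord d) -sumr_const.
apply: ler_sum => i _; apply: le_trans (ler_norm_sum _ _ _) _.
rewrite mulr_natl -[X in _ *+ X](card_ord d) -sumr_const.
apply: ler_sum => j _; rewrite !normrM expr2 mulrA.
by apply: ler_pM; rewrite ?mulr_ge0 ?le_coord_norm // ler_pM // le_coord_norm.
Qed.

Lemma qform_continuous d (q : 'M[R]_d) : continuous (qform q).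
Proof.
move=> w; apply: (@Ck_cont _ _ _ 0 setT) => //.
apply: Ck_sum => [|i _]; first exact: openT.
apply: Ck_sum => [|j _]; first exact: openT.
apply: CkM; [exact: openT| |by split => // y _; exact: coord_continuous].
apply: CkM; [exact: openT|exact: Ck_cst|].
by split=> // y _; exact: coord_continuous.
Qed.

(** The minimum over the unit sphere of the sup norm, extended by homogeneity. In dimension [0] the
    sphere is empty, hence the initial case distinction. *)
Lemma qform_min d (q : 'M[R]_d) : (forall w, w != 0 -> 0 < qform q w) ->
  exists2 m : R, 0 < m & forall w, m * `|w| ^+ 2 <= qform q w.
Proof.
move=> qpos; have [[w0 w00]|nw] := pselect (exists w : 'rV[R]_d, w != 0); last first.
  exists 1 => // w; have [->|w0] := eqVneq w 0; last by case: nw; exists w.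
  by rewrite normr0 expr0n mulr0 qform0.
pose S : set 'rV[R]_d := [set w | `|w| = 1].
have unitS w : w != 0 -> S (`|w|^-1 *: w).
  by move=> w1; rewrite /S /= normrZ normfV normr_id mulVf // normr_eq0.
have cS : compact S.
  apply: bounded_closed_compact.
    by exists 1; split => // x x1 y /= ->; exact: ltW.
  by apply: (@closed_comp _ _ _ [set (1 : R)]); [move=> w _; exact: norm_continuous|exact: closed_eq].
have [||c cS' hc] := @EVT_min_rV _ _ (qform q) S _ cS _.
  by exists (`|w0|^-1 *: w0); exact: unitS.
  by apply: continuous_subspaceT; exact: qform_continuous.
exists (qform q c).
  apply: qpos; apply/eqP => c0; move: cS'; rewrite inE /S /= c0 normr0.
  by move/eqP; rewrite eq_sym oner_eq0.
move=> w; have [->|w1] := eqVneq w 0.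
  by rewrite normr0 expr0n mulr0 qform0.
have /hc : `|w|^-1 *: w \in S by rewrite inE; exact: unitS.
by rewrite qformZ exprVn mulrC ler_pdivlMr // exprn_gt0 // normr_gt0.
Qed.

(* First-touch argument: at the first time where positivity is lost there is a
   null vector, along which the form is increasing. *)
Lemma posdef_propagate d (q : R -> 'M[R]_d) (a b : R) :
  (forall t, a <= t <= b -> forall i j, {for t, continuous (fun t => q t i j)}) ->
  (forall w, w != 0 -> 0 < qform (q a) w) ->
  (forall t, a < t <= b -> (forall w, 0 <= qform (q t) w) ->
    forall w, w != 0 -> qform (q t) w = 0 ->
    exists2 D : R, 0 < D & is_derive t 1 (fun s => qform (q s) w) D) ->
  forall t, a <= t <= b -> forall w, w != 0 -> 0 < qform (q t) w.
Proof.
move=> cq qa hq; apply: real_induction => //.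
  move=> t /andP[at_ tb] ht; have [|m m0 hm] := @qform_min _ (q t).
    by apply: ht; rewrite at_ lexx.
  (* A perturbation of the [d * d] entries by this amount changes the form by less than [m |w|^2],
     uniformly in [w]. *)
  have e0 : 0 < m / (d * d).+1%:R by rewrite divr_gt0 // ltr0Sn.
  have : \forall s \near t, forall ij : 'I_d * 'I_d,
      `|q s ij.1 ij.2 - q t ij.1 ij.2| <= m / (d * d).+1%:R.
    apply: (@filter_forall _ _ (fun (ij : 'I_d * 'I_d) s =>
      `|q s ij.1 ij.2 - q t ij.1 ij.2| <= m / (d * d).+1%:R) (nbhs t)) => -[i j] /=.
    have tab : a <= t <= b by rewrite at_ ltW.
    have /cvgrPdist_le/(_ _ e0) := cq t tab i j.
    by apply: filterS => s; rewrite distrC.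
  move=> /nbhs_ballP[e /= e1 he]; exists e => // s /andP[ts se] _ w w0.
  have hs : ball t e s.
    rewrite /ball /= ltr_distlC; apply/andP; split; last by [].
    by rewrite ltrBlDr (lt_trans ts) // ltrDl.
  have /(@qform_bound _ _ _ w) hb : forall i j, `|(q s - q t) i j| <= m / (d * d).+1%:R.
    by move=> i j; have := he s hs (i, j); rewrite !mxE.
  have E : qform (q s) w = qform (q t) w + qform (q s - q t) w.
    rewrite /qform -big_split; apply: eq_bigr => i _; rewrite -big_split.
    by apply: eq_bigr => j _; rewrite !mxE /=; ring.
  have w2 : 0 < `|w| ^+ 2 by rewrite exprn_gt0 // normr_gt0.
  have hb2 : (d * d)%:R * (m / (d * d).+1%:R) * `|w| ^+ 2 < m * `|w| ^+ 2.
    rewrite ltr_pM2r // mulrCA gtr_pMr // ltr_pdivrMr ?ltr0Sn // mul1r.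
    by rewrite ltr_nat.
  rewrite E -[qform (q s - q t) w]opprK subr_gt0; apply: lt_le_trans (hm w).
  by apply: le_lt_trans hb2; apply: le_trans hb; rewrite -normrN ler_norm.
move=> t /andP[at_ tb] ht.
have tab : a <= t <= b by rewrite ltW.
have ge0 w : 0 <= qform (q t) w.
  have cw : {for t, continuous (fun s => qform (q s) w)}.
    rewrite /qform; apply: cvg_big => //; first exact: add_continuous.
    move=> i _; apply: cvg_big => //; first exact: add_continuous.
    move=> j _; apply: cvgM; last exact: cvg_cst.
    by apply: cvgM; [exact: cq|exact: cvg_cst].
  have [->|w0] := eqVneq w 0; first by rewrite qform0.
  rewrite leNgt; apply/negP => lt0.
  have /cvgrPdist_lt/(_ (- qform (q t) w)) := cw.
  rewrite oppr_gt0 => /(_ lt0) /nbhs_ballP[e /= e0 he].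
  pose s := Num.max a (t - e / 2).
  have st : s < t by rewrite /s gt_max at_ ltrBlDr ltrDl divr_gt0.
  have as_ : a <= s by rewrite /s le_max lexx.
  have /he : ball t e s.
    rewrite /ball /= ltr_distlC; apply/andP; split; last by rewrite (lt_trans st) // ltrDl.
    by rewrite /s lt_max ltrD2l ltrN2 gtr_pMr // invf_lt1 // ltr1n /= orbC.
  have hs : 0 < qform (q s) w by apply: ht => //; rewrite as_.
  by rewrite ltr_norml => /andP[h1 _]; lra.
move=> w w0; rewrite lt_neqAle ge0 andbT eq_sym; apply/eqP => q0.
have [|D D0 dD] := hq t _ ge0 w w0 q0; first by rewrite at_.
have [dq dE] := dD.
(* The form vanishes at [t] with derivative [D > 0], so its first-order expansion makes it negative
   just before [t], against positivity there. *)
have := @derivable_nbhs _ _ _ (fun s => qform (q s) w) t 1 dq.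
rewrite dE => /eqaddoP; have D2 : 0 < D / 2 by rewrite divr_gt0.
move=> /(_ _ D2) /nbhs_ballP[e /= e0 he].
pose h := Num.min (e / 2) ((t - a) / 2).
have h0 : 0 < h by rewrite /h lt_min !divr_gt0 // subr_gt0.
have /he : ball (0 : R) e (- h).
  rewrite /ball /= sub0r opprK gtr0_norm // /h gt_min gtr_pMr //.
  by rewrite invf_lt1 // ltr1n.
rewrite -![(_ - _ : _ -> _) _]/(_ - _) /= /shift /= q0 add0r [_%:A]mulr1.
rewrite -[- h *: D]/(- h * D) normrN (gtr0_norm h0) addrC.
have : 0 < qform (q (t - h)) w.
  apply: ht => //; rewrite ltrBlDr ltrDl h0 andbT.
  have : h <= (t - a) / 2 by rewrite /h ge_min lexx orbT.
  lra.
rewrite [- h + t]addrC ler_norml => hp /andP[_]; nra.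
Qed.

(** * Hyperbolic functions and numerical bounds *)

Definition sinhR (x : R) : R := (expR x - expR (- x)) / 2.
Definition coshR (x : R) : R := (expR x + expR (- x)) / 2.

Lemma is_derive_expRN (x : R) : is_derive x 1 (fun t => expR (- t)) (- expR (- x)).
Proof.
apply: (is_derive_eq (@is_derive_compR _ _ (fun t => - t) expR x (-1) _ _ _)).
by rewrite -[LHS]/(-1 * _) mulN1r.
Qed.

Lemma is_derive_sinhR (x : R) : is_derive x 1 sinhR (coshR x).
Proof.
have h := is_derive_expRN x.
rewrite (_ : sinhR = 2^-1 \*: (expR - (fun t => expR (- t)))); last first.
  by apply/funext => t; rewrite /sinhR mulrC.
by apply: is_derive_eq; rewrite opprK -[LHS]/(_ * _) mulrC.
Qed.

Lemma is_derive_coshR (x : R) : is_derive x 1 coshR (sinhR x).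
Proof.
have h := is_derive_expRN x.
rewrite (_ : coshR = 2^-1 \*: (expR + (fun t => expR (- t)))); last first.
  by apply/funext => t; rewrite /coshR mulrC.
by apply: is_derive_eq; rewrite -[LHS]/(_ * _) mulrC.
Qed.

Lemma cosh2_sinh2 (x : R) : coshR x ^+ 2 - sinhR x ^+ 2 = 1.
Proof.
have h : expR x * expR (- x) = 1 by rewrite expRN mulfV // gt_eqF // expR_gt0.
have -> : coshR x ^+ 2 - sinhR x ^+ 2 = expR x * expR (- x).
  by rewrite /coshR /sinhR; field.
exact: h.
Qed.

Lemma coshR_ge1 (x : R) : 1 <= coshR x.
Proof.
have h0 : 0 < coshR x by rewrite /coshR divr_gt0 // addr_gt0 // expR_gt0.
have := cosh2_sinh2 x; have := sqr_ge0 (sinhR x) => h1 h2.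
rewrite leNgt; apply/negP => h3; nra.
Qed.

Lemma sinhR0 : sinhR 0 = 0.
Proof. by rewrite /sinhR oppr0 subrr mul0r. Qed.

Lemma sinhR_ge (x : R) : 0 <= x -> x <= sinhR x.
Proof.
move=> x0; have [c _] := mvt_ab x0 (fun t _ => is_derive_sinhR t).
rewrite sinhR0 !subr0 => ->; rewrite ler_peMl //; exact: coshR_ge1.
Qed.

Lemma sin_le (x : R) : 0 <= x -> sin x <= x.
Proof.
move=> x0; have [c _] := mvt_ab x0 (fun t _ => is_derive_sin t).
by rewrite sin0 !subr0 => ->; rewrite ler_piMl // cos_le1.
Qed.

Lemma sin_lt (x : R) : 0 < x < pi -> sin x < x.
Proof.
move=> /andP[x0 xpi]; have [c cx] : exists2 c, c \in `]0, x[ & sin x - sin 0 = cos c * (x - 0).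
  apply: (@MVT R sin cos) => //.
  by apply: derivable_within_continuous => t _; exact: derivable_sin.
rewrite sin0 !subr0 => ->; rewrite gtr_pMl // -[ltRHS]cos0 ltr_cos ?(itvP cx) //.
  by rewrite in_itv /= lexx pi_ge0.
by rewrite in_itv /= !(itvP cx) /= (le_trans _ (ltW xpi)) // (itvP cx).
Qed.

Lemma cos_ge (x : R) : 0 <= x -> 1 - x ^+ 2 / 2 <= cos x.
Proof.
move=> x0; rewrite -subr_ge0.
have := @derive_ge0_le (fun t => cos t - (1 - t ^+ 2 / 2)) (fun t => - sin t + t) 0 x x0.
rewrite /= cos0 expr0n mul0r subr0 subrr; apply=> t /andP[t0 _].
  rewrite (_ : (fun t => _) = cos - (cst 1 - 2^-1 \*: (fun t => t ^+ 2))); last first.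
    by apply/funext => y; rewrite mulrC.
  apply: is_derive_eq; rewrite sub0r opprK; congr (_ + _).
  by rewrite /GRing.scale /=; field.
by rewrite addrC subr_ge0 sin_le.
Qed.

Lemma sin_ge (x : R) : 0 <= x -> x - x ^+ 3 / 6 <= sin x.
Proof.
move=> x0; rewrite -subr_ge0.
have := @derive_ge0_le (fun t => sin t - (t - t ^+ 3 / 6)) (fun t => cos t - (1 - t ^+ 2 / 2)) 0 x x0.
rewrite /= sin0 expr0n mul0r !subr0; apply=> t /andP[t0 _].
  rewrite (_ : (fun t => _) = sin - (id - 6^-1 \*: (fun t => t ^+ 3))); last first.
    by apply/funext => y; rewrite mulrC.
  apply: is_derive_eq; congr (_ - (_ - _)).
  by rewrite /GRing.scale /=; field.
by rewrite subr_ge0 cos_ge.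
Qed.

Lemma cos_le (x : R) : 0 <= x -> cos x <= 1 - x ^+ 2 / 2 + x ^+ 4 / 24.
Proof.
move=> x0; rewrite -subr_ge0.
have := @derive_ge0_le (fun t => (1 - t ^+ 2 / 2 + t ^+ 4 / 24) - cos t)
  (fun t => sin t - (t - t ^+ 3 / 6)) 0 x x0.
rewrite /= cos0 !expr0n !mul0r subr0 addr0 subrr; apply=> t /andP[t0 _].
  rewrite (_ : (fun t => _) = (cst 1 - 2^-1 \*: (fun t => t ^+ 2)
      + 24^-1 \*: (fun t => t ^+ 4)) - cos); last first.
    by apply/funext => y; rewrite mulrC [X in _ + X - _]mulrC.
  apply: is_derive_eq; rewrite sub0r opprK.
  by rewrite /GRing.scale /=; field.
by rewrite subr_ge0 sin_ge.
Qed.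

(** If [8/5] were below [pi / 2], its cosine would be positive, but the quartic upper bound at [8/5]
    is about [1 - 1.28 + 0.273 < 0]. *)
Lemma pi_le : (pi : R) <= 16 / 5.
Proof.
rewrite leNgt; apply/negP => h.
have h0 : 0 <= 8 / 5 :> R by lra.
have := cos_le h0; have : 0 < cos (8 / 5 : R) by apply: cos_gt0_pihalf; lra.
by move=> ?; nra.
Qed.

(** Eight squarings starting from [exp (1/80) <= 80/79], each followed by rounding up. The target is
    twice [64/5 = 4 * 16/5], so that [sinh (16/5) < 4 * 16/5]. *)
Lemma expR_16_5 : expR (16 / 5 : R) <= 512 / 20.
Proof.
have step (x a b : R) : expR x <= a -> a ^+ 2 <= b -> expR (x * 2) <= b.
  move=> h1; apply: le_trans; rewrite mulr_natr mulr2n expRD expr2.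
  by apply: ler_pM => //; exact: expR_ge0.
have h0 : expR (1 / 80 : R) <= 80 / 79.
  have := expR_ge1Dx (- (1 / 80) : R); rewrite expRN => h.
  have e0 := expR_gt0 (1 / 80 : R).
  by rewrite -[leLHS]invrK -[leRHS]invrK lef_pV2 ?posrE ?invr_gt0 //; lra.
have -> : 16 / 5 = 1 / 80 * 2 * 2 * 2 * 2 * 2 * 2 * 2 * 2 :> R by field.
apply: (step _ (504 / 100)); last by lra.
apply: (step _ (2243 / 1000)); last by lra.
apply: (step _ (14975 / 10000)); last by lra.
apply: (step _ (12236 / 10000)); last by lra.
apply: (step _ (11061 / 10000)); last by lra.
apply: (step _ (10517 / 10000)); last by lra.
apply: (step _ (10255 / 10000)); last by lra.
by apply: (step _ (80 / 79)); last by lra.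
Qed.

(* [4 x - sinh x] is concave, zero at [0] and nonnegative at [16/5 >= pi]. *)
Lemma sinhR_le4 (x : R) : 0 <= x <= pi -> sinhR x <= 4 * x.
Proof.
move=> /andP[x0 xpi]; have xb : x <= 16 / 5 by exact: le_trans pi_le.
rewrite leNgt; apply/negP => h.
have [c1 /andP[c10 c1x] E1] := mvt_ab x0 (fun t _ => is_derive_sinhR t).
have [c2 /andP[c2x _] E2] := mvt_ab xb (fun t _ => is_derive_sinhR t).
have c12 : coshR c1 <= coshR c2.
  apply: (@derive_ge0_le coshR sinhR); first exact: le_trans c2x.
    by move=> t _; exact: is_derive_coshR.
  by move=> t /andP[t1 _]; have t0 := le_trans c10 t1; apply: le_trans t0 (sinhR_ge t0).
have xp : 0 < x.
  by rewrite lt_neqAle x0 andbT eq_sym; apply/eqP => x00; move: h; rewrite x00 sinhR0; lra.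
have c14 : 4 < coshR c1.
  by rewrite -(ltr_pM2r xp); move: E1 h; rewrite sinhR0 !subr0 => <-.
have hs : sinhR (16 / 5) < 512 / 40.
  rewrite /sinhR; have := expR_16_5; have := expR_gt0 (- (16 / 5) : R); lra.
nra.
Qed.

End RealAnalysis.

Section DeriveRules.
Context {R : realType}.
Implicit Types V W : normedModType R.

Lemma is_derive_fM V (f h : V -> R) (x v : V) (df dh : R) :
  is_derive x v f df -> is_derive x v h dh ->
  is_derive x v (fun y => f y * h y) (f x * dh + h x * df).
Proof. by move=> hf hh; exact: is_deriveM. Qed.

Lemma is_derive_fD V W (f h : V -> W) (x v : V) (df dh : W) :
  is_derive x v f df -> is_derive x v h dh ->
  is_derive x v (fun y => f y + h y) (df + dh).
Proof. by move=> hf hh; exact: is_deriveD. Qed.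

Lemma is_derive_fB V W (f h : V -> W) (x v : V) (df dh : W) :
  is_derive x v f df -> is_derive x v h dh ->
  is_derive x v (fun y => f y - h y) (df - dh).
Proof. by move=> hf hh; exact: is_deriveB. Qed.

Lemma is_derive_fS V W n (f : 'I_n -> V -> W) (x v : V) (D : 'I_n -> W) :
  (forall i, is_derive x v (f i) (D i)) ->
  is_derive x v (fun y => \sum_(i < n) f i y) (\sum_(i < n) D i).
Proof.
move=> h; rewrite (_ : (fun y => _) = \sum_(i < n) f i).
  by have := @is_derive_sum _ _ _ n f x v D h.
by apply/funext => y; rewrite fct_sumE.
Qed.

Lemma is_derive_near V W (f h : V -> W) (x v : V) (D : W) (U : set V) :
  open U -> U x -> (forall y, U y -> f y = h y) ->
  is_derive x v f D -> is_derive x v h D.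
Proof.
move=> oU Ux fh; apply: near_eq_is_derive.
by near=> y; apply: fh; near: y; exact: open_nbhs_nbhs.
Unshelve. all: by end_near. Qed.

Lemma is_derive_uniq V W (f : V -> W) (x v : V) (D D' : W) :
  is_derive x v f D -> is_derive x v f D' -> D = D'.
Proof. by move=> [_ <-] [_ <-]. Qed.

Lemma is_derive_ray V W (f : V -> W) (v : V) (s : R) D :
  is_derive (s *: v) v f D -> is_derive s 1 (fun t : R => f (t *: v)) D.
Proof.
move=> h; have := (is_derive_lineP f 0 v s D).2; rewrite add0r => /(_ h).
by rewrite (_ : (fun t => f (0 + _)) = fun t => f (t *: v)) //;
  apply/funext => t; rewrite add0r.
Qed.

Lemma is_derive_coord V n (f : V -> 'rV[R]_n) (x v : V) (D : 'rV[R]_n) i :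
  is_derive x v f D -> is_derive x v (fun y => f y 0 i) (D 0 i).
Proof.
move=> [h <-]; split; first by move: h => /derivable_mxP; exact.
by rewrite derive_mx // mxE.
Qed.

Lemma is_derive_rV V n (f : V -> 'rV[R]_n) (x v : V) (D : 'rV[R]_n) :
  (forall i, is_derive x v (fun y => f y 0 i) (D 0 i)) -> is_derive x v f D.
Proof.
move=> h; have df : derivable f x v.
  by apply/derivable_mxP => i j; rewrite ord1; have [] := h j.
split=> //; rewrite derive_mx //; apply/rowP => j; rewrite mxE.
by have [_ <-] := h j.
Qed.

Lemma is_derive_continuous W (f : R -> W) (t : R) D :
  is_derive t 1 f D -> {for t, continuous f}.
Proof. by move=> [h _]; apply/differentiable_continuous/derivable1_diffP. Qed.

Lemma is_derive_idR (t : R) : is_derive t 1 (fun s : R => s) 1.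
Proof. exact: is_derive_id. Qed.

Lemma is_derive_fcst V W (c : W) (x v : V) : is_derive x v (fun=> c) 0.
Proof. exact: is_derive_cst. Qed.

Lemma sinhR_mono (x y : R) : x <= y -> sinhR x <= sinhR y.
Proof.
move=> xy; apply: (derive_ge0_le xy (fun t _ => is_derive_sinhR t)) => t _.
by apply: le_trans (coshR_ge1 t).
Qed.

Lemma coshR_mono (x y : R) : 0 <= x <= y -> coshR x <= coshR y.
Proof.
move=> /andP[x0 xy]; apply: (derive_ge0_le xy (fun t _ => is_derive_coshR t)) => t.
by move=> /andP[xt _]; have t0 := le_trans x0 xt; exact: le_trans (sinhR_ge t0).
Qed.

(** Equivalently [coth x >= 1 / x]: this bounds the comparison function from below at the start of
    the Rauch estimate. *)
Lemma sinhR_le_cosh (x : R) : 0 <= x -> sinhR x <= coshR x * x.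
Proof.
move=> x0; have [c /andP[c0 cx]] := mvt_ab x0 (fun t _ => is_derive_sinhR t).
by rewrite sinhR0 !subr0 => ->; rewrite ler_wpM2r // coshR_mono // c0.
Qed.

End DeriveRules.

(* The metric [g] and Levi-Civita connection [G], [G x a b] standing for
   [nabla_a b] at [x] of constant fields, in normal coordinates centred at [0];
   [dG x c] is the derivative of [G] in direction [c]. *)
Record normal_coords (R : realType) d (V : set 'rV[R]_d)
    (g : 'rV[R]_d -> 'rV[R]_d -> 'rV[R]_d -> R)
    (G : 'rV[R]_d -> 'rV[R]_d -> 'rV[R]_d -> 'rV[R]_d)
    (dG : 'rV[R]_d -> 'rV[R]_d -> 'rV[R]_d -> 'rV[R]_d -> 'rV[R]_d) : Prop :=
  NormalCoords {
  nc_open : open V;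
  nc_star : forall x (t : R), V x -> 0 <= t <= 1 -> V (t *: x);
  nc_sym : forall x a b, V x -> g x a b = g x b a;
  nc_lin : forall x s u v w, V x -> g x (s *: u + v) w = s * g x u w + g x v w;
  nc_pos : forall x a, V x -> a != 0 -> 0 < g x a a;
  nc_Gsym : forall x a b, V x -> G x a b = G x b a;
  nc_Glin : forall x s u v w, V x -> G x (s *: u + v) w = s *: G x u w + G x v w;
  nc_dg : forall x c a b, V x -> is_derive x c (fun y => g y a b)
    (g x (G x c a) b + g x a (G x c b));
  nc_dG : forall x c a b, V x -> is_derive x c (fun y => G y a b) (dG x c a b);
  nc_ray : forall x, V x -> G x x x = 0 }.

(** The commutator of covariant derivatives on constant fields; their Lie bracket vanishes, so there
    is no third term. *)
Definition riem_op (R : realType) d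
    (G : 'rV[R]_d -> 'rV[R]_d -> 'rV[R]_d -> 'rV[R]_d)
    (dG : 'rV[R]_d -> 'rV[R]_d -> 'rV[R]_d -> 'rV[R]_d -> 'rV[R]_d)
    (x a b c : 'rV[R]_d) : 'rV[R]_d :=
  dG x a b c - dG x b a c + G x a (G x b c) - G x b (G x a c).

(** * Comparison estimates in normal coordinates *)

Section NormalCoordinates.
Context {R : realType} {d : nat} {V : set 'rV[R]_d}
  {g : 'rV[R]_d -> 'rV[R]_d -> 'rV[R]_d -> R}
  {G : 'rV[R]_d -> 'rV[R]_d -> 'rV[R]_d -> 'rV[R]_d}
  {dG : 'rV[R]_d -> 'rV[R]_d -> 'rV[R]_d -> 'rV[R]_d -> 'rV[R]_d}
  (H : normal_coords V g G dG).
Implicit Types (x y u v w z a b : 'rV[R]_d) (s t : R).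

Lemma nc_gDl x u v w : V x -> g x (u + v) w = g x u w + g x v w.
Proof. by move=> Vx; rewrite -[u]scale1r (nc_lin H) // mul1r scale1r. Qed.
Lemma nc_g0l x w : V x -> g x 0 w = 0.
Proof. by move=> Vx; apply: (@addIr _ (g x 0 w)); rewrite -nc_gDl // !add0r. Qed.
Lemma nc_gZl x s u w : V x -> g x (s *: u) w = s * g x u w.
Proof. by move=> Vx; rewrite -[s *: u]addr0 (nc_lin H) // nc_g0l // addr0. Qed.
Lemma nc_gNl x u w : V x -> g x (- u) w = - g x u w.
Proof. by move=> Vx; rewrite -scaleN1r nc_gZl // mulN1r. Qed.
Lemma nc_gDr x u v w : V x -> g x w (u + v) = g x w u + g x w v.
Proof. by move=> Vx; rewrite (nc_sym H) // nc_gDl // ![g x _ w](nc_sym H). Qed.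
Lemma nc_gZr x s u w : V x -> g x w (s *: u) = s * g x w u.
Proof. by move=> Vx; rewrite (nc_sym H) // nc_gZl // (nc_sym H). Qed.
Lemma nc_gNr x u w : V x -> g x w (- u) = - g x w u.
Proof. by move=> Vx; rewrite -scaleN1r nc_gZr // mulN1r. Qed.
Lemma nc_g0r x w : V x -> g x w 0 = 0.
Proof. by move=> Vx; rewrite (nc_sym H) // nc_g0l. Qed.
Lemma nc_g_sum x u w : V x -> g x u w = \sum_(i < d) u 0 i * g x (delta_mx 0 i) w.
Proof.
move=> Vx; rewrite {1}(row_sum_delta u).
elim/big_rec2 : _ => [|i y1 y2 _ <-]; first by rewrite nc_g0l.
by rewrite (nc_lin H).
Qed.
Lemma nc_ge0 x u : V x -> 0 <= g x u u.
Proof.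
move=> Vx; have [->|u0] := eqVneq u 0; first by rewrite nc_g0l.
by rewrite ltW // (nc_pos H).
Qed.
Lemma nc_eq0 x u : V x -> (forall z, g x u z = 0) -> u = 0.
Proof.
move=> Vx h; apply/eqP/negPn/negP => u0.
by have := nc_pos H Vx u0; rewrite h ltxx.
Qed.
Lemma nc_cauchy x u v : V x -> g x u v ^+ 2 <= g x u u * g x v v.
Proof.
move=> Vx; have [->|v0] := eqVneq v 0.
  by rewrite !nc_g0r // expr0n mulr0.
have vv := nc_pos H Vx v0.
have := nc_ge0 (g x v v *: u - g x u v *: v) Vx.
rewrite nc_gDl // nc_gNl // !nc_gDr // !nc_gNr // !nc_gZl // !nc_gZr //.
rewrite (nc_sym H v u) // => h; rewrite -subr_ge0.
rewrite -(pmulr_rge0 _ vv); move: h; congr (0 <= _); ring.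
Qed.

Lemma nc_GDl x u v w : V x -> G x (u + v) w = G x u w + G x v w.
Proof. by move=> Vx; rewrite -[u]scale1r (nc_Glin H) // !scale1r. Qed.
Lemma nc_G0l x w : V x -> G x 0 w = 0.
Proof. by move=> Vx; apply: (@addIr _ (G x 0 w)); rewrite -nc_GDl // !add0r. Qed.
Lemma nc_GZl x s u w : V x -> G x (s *: u) w = s *: G x u w.
Proof. by move=> Vx; rewrite -[s *: u]addr0 (nc_Glin H) // nc_G0l // addr0. Qed.
Lemma nc_GDr x u v w : V x -> G x w (u + v) = G x w u + G x w v.
Proof. by move=> Vx; rewrite (nc_Gsym H) // nc_GDl // ![G x _ w](nc_Gsym H). Qed.
Lemma nc_GZr x s u w : V x -> G x w (s *: u) = s *: G x w u.
Proof. by move=> Vx; rewrite (nc_Gsym H) // nc_GZl // (nc_Gsym H). Qed.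
Lemma nc_G0r x w : V x -> G x w 0 = 0.
Proof. by move=> Vx; rewrite (nc_Gsym H) // nc_G0l. Qed.

Lemma nc_dGsym x c a b : V x -> dG x c a b = dG x c b a.
Proof.
move=> Vx; apply: is_derive_uniq (nc_dG H c a b Vx) _.
apply: is_derive_near (nc_open H) Vx _ (nc_dG H c b a Vx) => y Vy.
exact: (nc_Gsym H).
Qed.
Lemma nc_dGZl x c s a b : V x -> dG x c (s *: a) b = s *: dG x c a b.
Proof.
move=> Vx; apply: is_derive_uniq (nc_dG H c _ b Vx) _.
apply: is_derive_near (nc_open H) Vx _ (is_deriveZ s (nc_dG H c a b Vx)) => y Vy.
by rewrite nc_GZl.
Qed.
Lemma nc_dGZr x c s a b : V x -> dG x c b (s *: a) = s *: dG x c b a.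
Proof. by move=> Vx; rewrite nc_dGsym // nc_dGZl // nc_dGsym. Qed.

Lemma nc_V0 x : V x -> V 0.
Proof. by move=> Vx; rewrite -(scale0r x); apply: (nc_star H); rewrite // lexx ler01. Qed.

Lemma nc_dg_ray v a b t : V (t *: v) -> is_derive t 1 (fun s : R => g (s *: v) a b)
  (g (t *: v) (G (t *: v) v a) b + g (t *: v) a (G (t *: v) v b)).
Proof. by move=> Vt; apply: (@is_derive_ray _ _ _ (fun y => g y a b)); exact: (nc_dg H). Qed.

Lemma nc_dG_ray v a b t : V (t *: v) -> is_derive t 1 (fun s : R => G (s *: v) a b)
  (dG (t *: v) v a b).
Proof. by move=> Vt; apply: (@is_derive_ray _ _ _ (fun y => G y a b)); exact: (nc_dG H). Qed.

Lemma nc_GZray v t : V (t *: v) -> t != 0 -> G (t *: v) v v = 0.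
Proof.
move=> Vt t0; have := nc_ray H Vt; rewrite nc_GZl // nc_GZr // scalerA => /eqP.
by rewrite scaler_eq0 mulf_eq0 (negbTE t0) /= => /eqP.
Qed.

(** The derivative of the metric is given with its vector arguments frozen, so [y = x + s w] is
    substituted and the form expanded in powers of [s] before differentiating. [nc_deriv_G] proceeds
    in the same way. *)
Lemma nc_deriv_sq x w : V x -> is_derive x w (fun y => g y y y)
  (g x (G x w x) x + g x x (G x w x) + 2 * g x w x).
Proof.
move=> Vx; have E : x = x + 0 *: w by rewrite scale0r addr0.
rewrite {1}E; apply/is_derive_lineP.
pose f s := g (x + s *: w) x x + s * (2 * g (x + s *: w) x w) + s * (s * g (x + s *: w) w w).
have dg a b : is_derive (0 : R) 1 (fun s => g (x + s *: w) a b) (g x (G x w a) b + g x a (G x w b)).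
  by apply/(is_derive_lineP (fun y => g y a b)); rewrite -E; exact: (nc_dg H).
have df : is_derive (0 : R) 1 f (g x (G x w x) x + g x x (G x w x) + 2 * g x w x).
  rewrite /f; apply: (is_derive_eq (is_derive_fD (is_derive_fD (dg x x)
    (is_derive_fM (is_derive_idR 0) (is_derive_fM (is_derive_fcst _ _ _) (dg x w))))
    (is_derive_fM (is_derive_idR 0) (is_derive_fM (is_derive_idR 0) (dg w w))))).
  by rewrite -E (nc_sym H w x) //; ring.
have Vn : \forall s \near (0 : R), V (x + s *: w).
  have c0 : {for (0 : R), continuous (fun s : R => x + s *: w)}.
    by apply: cvgD; [exact: cvg_cst|apply: cvgZr_tmp; exact: cvg_id].
  by apply: c0; rewrite -E; apply: open_nbhs_nbhs; split; [exact: (nc_open H)|].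
apply: near_eq_is_derive df; near=> s.
have Vs : V (x + s *: w) by near: s.
rewrite /f !nc_gDl // !nc_gDr // !nc_gZl // !nc_gZr // (nc_sym H w x) //; ring.
Unshelve. all: by end_near. Qed.

Lemma nc_deriv_G x w : V x -> is_derive x w (fun y => G y y y)
  (dG x w x x + 2 *: G x w x).
Proof.
move=> Vx; have E : x = x + 0 *: w by rewrite scale0r addr0.
rewrite {1}E; apply/is_derive_lineP; apply: is_derive_rV => i.
pose f s := G (x + s *: w) x x 0 i + s * (2 * G (x + s *: w) x w 0 i)
   + s * (s * G (x + s *: w) w w 0 i).
have dg a b : is_derive (0 : R) 1 (fun s => G (x + s *: w) a b 0 i) (dG x w a b 0 i).
  apply: is_derive_coord.
  by apply/(is_derive_lineP (fun y => G y a b)); rewrite -E; exact: (nc_dG H).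
have df : is_derive (0 : R) 1 f ((dG x w x x + 2 *: G x w x) 0 i).
  rewrite /f; apply: (is_derive_eq (is_derive_fD (is_derive_fD (dg x x)
    (is_derive_fM (is_derive_idR 0) (is_derive_fM (is_derive_fcst _ _ _) (dg x w))))
    (is_derive_fM (is_derive_idR 0) (is_derive_fM (is_derive_idR 0) (dg w w))))).
  by rewrite -E !mxE (nc_Gsym H w x) //; ring.
have Vn : \forall s \near (0 : R), V (x + s *: w).
  have c0 : {for (0 : R), continuous (fun s : R => x + s *: w)}.
    by apply: cvgD; [exact: cvg_cst|apply: cvgZr_tmp; exact: cvg_id].
  by apply: c0; rewrite -E; apply: open_nbhs_nbhs; split; [exact: (nc_open H)|].
apply: near_eq_is_derive df; near=> s.
have Vs : V (x + s *: w) by near: s.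
rewrite /f !nc_GDl // !nc_GDr // !nc_GZl // !nc_GZr // (nc_Gsym H w x) // !mxE; ring.
Unshelve. all: by end_near. Qed.

(** Rays from the origin are geodesics, so their speed is constant. The ray equation has to be
    divided by the parameter, hence the mean value theorem with a point of the open interval. *)
Lemma nc_radial x : V x -> g x x x = g 0 x x.
Proof.
move=> Vx; pose f s := g (s *: x) x x.
have Vs s : 0 <= s <= 1 -> V (s *: x) by exact: (nc_star H).
have [c cx] : exists2 c, c \in `]0, 1[ & f 1 - f 0 =
   (g (c *: x) (G (c *: x) x x) x + g (c *: x) x (G (c *: x) x x)) * (1 - 0).
  apply: (@MVT R f (fun c => g (c *: x) (G (c *: x) x x) x + g (c *: x) x (G (c *: x) x x))) => //.
    by move=> s sx; apply: nc_dg_ray; apply: Vs; rewrite !ltW ?(itvP sx).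
  apply: derivable_within_continuous => s sx.
  have Vsx : V (s *: x) by apply: Vs; rewrite !(itvP sx).
  by have [] := nc_dg_ray x x Vsx.
have Vc : V (c *: x) by apply: Vs; rewrite !ltW ?(itvP cx).
rewrite nc_GZray // ?gt_eqF ?(itvP cx) // nc_g0l // nc_g0r // addr0 mul0r.
by rewrite /f scale1r scale0r => /eqP; rewrite subr_eq0 => /eqP.
Qed.

(** The derivative of the identity [nc_radial] in the direction [w]. *)
Lemma nc_gauss1 x w : V x -> g x (G x x w) x + g x x w = g 0 x w.
Proof.
move=> Vx; have V0 := nc_V0 Vx.
have h1 := nc_deriv_sq w Vx.
have h2 : is_derive x w (fun y => g 0 y y) (2 * g 0 x w).
  have E : x = x + 0 *: w by rewrite scale0r addr0.
  rewrite {1}E; apply/is_derive_lineP.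
  rewrite (_ : (fun t : R => _) = fun s => g 0 x x + (s * (2 * g 0 x w) + s * (s * g 0 w w))).
    apply: (is_derive_eq (is_derive_fD (is_derive_fcst _ _ _) (is_derive_fD
      (is_derive_fM (is_derive_idR 0) (is_derive_fcst _ _ _))
      (is_derive_fM (is_derive_idR 0) (is_derive_fM (is_derive_idR 0) (is_derive_fcst _ _ _)))))).
    ring.
  apply/funext => s; rewrite !nc_gDl // !nc_gDr // !nc_gZl // !nc_gZr // (nc_sym H w x) //; ring.
have h3 := is_derive_near (nc_open H) Vx nc_radial h1.
have := is_derive_uniq h3 h2; rewrite (nc_sym H x (G x w x)) // (nc_Gsym H w x) //.
rewrite (nc_sym H w x) // => E; apply: (@mulfI _ 2); rewrite // -E; ring.
Qed.

(** The Gauss lemma. Thanks to the factor [s] in [F], the derivative of [F] at [s] is the quantity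
    that [nc_gauss1] at the point [s x] makes zero. *)
Lemma nc_gauss x w : V x -> g x x w = g 0 x w.
Proof.
move=> Vx; have V0 := nc_V0 Vx.
have Vs s : 0 <= s <= 1 -> V (s *: x) by exact: (nc_star H).
pose F s := s * (g (s *: x) x w - g 0 x w).
pose D s := g (s *: x) (G (s *: x) x x) w + g (s *: x) x (G (s *: x) x w).
have dF s : 0 <= s <= 1 -> is_derive s 1 F (s * (D s - 0) + (g (s *: x) x w - g 0 x w) * 1).
  move=> s01; exact: (is_derive_fM (is_derive_idR s) (is_derive_fB
    (nc_dg_ray x w (Vs s s01)) (is_derive_fcst (g 0 x w) _ _))).
have [c cx] : exists2 c, c \in `]0, 1[ & F 1 - F 0 =
   (c * (D c - 0) + (g (c *: x) x w - g 0 x w) * 1) * (1 - 0).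
  apply: (@MVT R F (fun c => c * (D c - 0) + (g (c *: x) x w - g 0 x w) * 1)) => //.
    by move=> s sx; apply: dF; rewrite !ltW ?(itvP sx).
  apply: derivable_within_continuous => s sx.
  have s01 : 0 <= s <= 1 by rewrite !(itvP sx).
  by have [] := dF _ s01.
have Vc : V (c *: x) by apply: Vs; rewrite !ltW ?(itvP cx).
have c0 : c != 0 by rewrite gt_eqF ?(itvP cx).
have := nc_gauss1 w Vc; rewrite nc_GZl // !nc_gZl // nc_gZr // => E.
rewrite /D nc_GZray // nc_g0l // (nc_sym H x (G _ _ _)) //.
have -> : c * (0 + g (c *: x) (G (c *: x) x w) x - 0) + (g (c *: x) x w - g 0 x w) * 1 = 0.
  by apply: (mulfI c0); rewrite mulr0; move: E; nra.
by rewrite /F mul0r mul1r !scale1r mul0r subr0 => /eqP; rewrite subr_eq0 => /eqP.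
Qed.

(* For [z = w] the right-hand side is half the second derivative of [g 0 u u]
   along a geodesic [u'' = - G u u' u'] with [u = x] and [u' = w]. *)
Lemma nc_hess x w z : V x ->
  g x w z + g x (G x x w) z = g 0 w z - g 0 x (G x w z).
Proof.
move=> Vx; have V0 := nc_V0 Vx; have E : x = x + 0 *: w by rewrite scale0r addr0.
have h1 : is_derive x w (fun y => g y y z)
    (g x (G x w x) z + g x x (G x w z) + g x w z).
  rewrite {1}E; apply/is_derive_lineP.
  have dg a b : is_derive (0 : R) 1 (fun s => g (x + s *: w) a b) (g x (G x w a) b + g x a (G x w b)).
    by apply/(is_derive_lineP (fun y => g y a b)); rewrite -E; exact: (nc_dg H).
  have df : is_derive (0 : R) 1 (fun s => g (x + s *: w) x z + s * g (x + s *: w) w z)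
      (g x (G x w x) z + g x x (G x w z) + g x w z).
    apply: (is_derive_eq (is_derive_fD (dg x z) (is_derive_fM (is_derive_idR 0) (dg w z)))).
    by rewrite -E; ring.
  have Vn : \forall s \near (0 : R), V (x + s *: w).
    have c0 : {for (0 : R), continuous (fun s : R => x + s *: w)}.
      by apply: cvgD; [exact: cvg_cst|apply: cvgZr_tmp; exact: cvg_id].
    by apply: c0; rewrite -E; apply: open_nbhs_nbhs; split; [exact: (nc_open H)|].
  apply: near_eq_is_derive df; near=> s.
  have Vs : V (x + s *: w) by near: s.
  by rewrite !nc_gDl // !nc_gZl.
have h2 : is_derive x w (fun y => g 0 y z) (g 0 w z).
  rewrite {1}E; apply/is_derive_lineP.
  rewrite (_ : (fun t : R => _) = fun s => g 0 x z + s * g 0 w z).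
    apply: (is_derive_eq (is_derive_fD (is_derive_fcst _ _ _)
      (is_derive_fM (is_derive_idR 0) (is_derive_fcst _ _ _)))); ring.
  by apply/funext => s; rewrite !nc_gDl // !nc_gZl.
have h3 := is_derive_near (nc_open H) Vx (fun y => @nc_gauss y z) h1.
have := is_derive_uniq h3 h2; rewrite nc_gauss // (nc_Gsym H w x) // => <-; ring.
Unshelve. all: by end_near. Qed.

(** By [nc_hess] both sides, up to the symmetric term [g x w z], are the Hessian of half the squared
    radius, which is symmetric in [w] and [z]. *)
Lemma nc_selfadj x w z : V x -> g x (G x x w) z = g x (G x x z) w.
Proof.
move=> Vx; have h1 := nc_hess w z Vx; have h2 := nc_hess z w Vx.
have V0 := nc_V0 Vx.
apply: (@addrI _ (g x w z)); rewrite h1 (nc_sym H w z Vx) h2.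
by rewrite (nc_sym H w z V0) (nc_Gsym H w z Vx).
Qed.

Lemma linform_sum (L : 'rV[R]_d -> R) u :
  (forall s a b, L (s *: a + b) = s * L a + L b) ->
  L u = \sum_(i < d) u 0 i * L (delta_mx 0 i).
Proof.
move=> hL; have L0 : L 0 = 0.
  by have := hL 1 0 0; rewrite scaler0 addr0 mul1r -[X in X = _]addr0 => /addrI.
rewrite {1}(row_sum_delta u).
by elim/big_rec2 : _ => [|i y1 y2 _ <-] //; rewrite hL.
Qed.

Lemma nc_near_ray v t : V (t *: v) -> \forall s \near t, V (s *: v).
Proof.
move=> Vt; have c0 : {for t, continuous (fun s : R => s *: v)}.
  by apply: cvgZr_tmp; exact: cvg_id.
by apply: c0; apply: open_nbhs_nbhs; split; [exact: (nc_open H)|].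
Qed.

Lemma nc_dg_curve v (X : R -> 'rV[R]_d) X' z t : V (t *: v) ->
  is_derive t 1 X X' ->
  is_derive t 1 (fun s => g (s *: v) (X s) z)
    (g (t *: v) (G (t *: v) v (X t)) z + g (t *: v) (X t) (G (t *: v) v z)
     + g (t *: v) X' z).
Proof.
move=> Vt dX.
have df : is_derive t 1 (fun s => \sum_(i < d) X s 0 i * g (s *: v) (delta_mx 0 i) z)
    (\sum_(i < d) (X t 0 i * (g (t *: v) (G (t *: v) v (delta_mx 0 i)) z
       + g (t *: v) (delta_mx 0 i) (G (t *: v) v z))
      + g (t *: v) (delta_mx 0 i) z * X' 0 i)).
  apply: is_derive_fS => i; apply: is_derive_fM; first exact: is_derive_coord dX.
  exact: nc_dg_ray.
have Vn := nc_near_ray Vt.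
have {}df : is_derive t 1 (fun s => g (s *: v) (X s) z)
    (\sum_(i < d) (X t 0 i * (g (t *: v) (G (t *: v) v (delta_mx 0 i)) z
       + g (t *: v) (delta_mx 0 i) (G (t *: v) v z))
      + g (t *: v) (delta_mx 0 i) z * X' 0 i)).
  apply: near_eq_is_derive df; near=> s.
  by rewrite nc_g_sum //; near: s.
apply: is_derive_eq df _; rewrite big_split /=; congr (_ + _).
  rewrite -(@linform_sum (fun u => g (t *: v) (G (t *: v) v u) z + g (t *: v) u (G (t *: v) v z))) //.
  move=> s a b; rewrite nc_GDr // nc_GZr // (nc_lin H) // (nc_lin H) //; ring.
by rewrite [RHS]nc_g_sum //; apply: eq_bigr => i _; rewrite mulrC.
Unshelve. all: by end_near. Qed.

(* [t |-> t w] is a Jacobi field along the ray [t |-> t v]; this relation comes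
   from differentiating [G x x x = 0] and amounts to the Jacobi equation. *)
Lemma nc_jacobi v w t : V (t *: v) -> t != 0 ->
  t *: dG (t *: v) w v v = - (2 *: G (t *: v) v w).
Proof.
move=> Vt t0; have h := nc_deriv_G w Vt.
have h0 := is_derive_near (nc_open H) Vt (fun y Vy => nc_ray H Vy) h.
have := is_derive_uniq h0 (is_derive_fcst 0 (t *: v) w).
rewrite nc_dGZl // nc_dGZr // nc_GZr // (nc_Gsym H w v Vt).
rewrite [2 *: _]scalerA mulrC -scalerA -scalerDr => /eqP.
by rewrite scaler_eq0 (negbTE t0) /= addr_eq0 => /eqP.
Qed.

Lemma nc_dq v w t : V (t *: v) -> is_derive t 1 (fun s : R => g (s *: v) w w)
  (2 * g (t *: v) (G (t *: v) v w) w).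
Proof.
move=> Vt; apply: (is_derive_eq (nc_dg_ray w w Vt)).
by rewrite (nc_sym H w _ Vt); ring.
Qed.

(** The Riccati equation for the operator [G (t v) v]: metric compatibility produces the square, and
    [nc_jacobi] trades the remaining derivative of [G] for the curvature and the term in [2 / t]. *)
Lemma nc_db v w t : V (t *: v) -> t != 0 ->
  is_derive t 1 (fun s : R => g (s *: v) (G (s *: v) v w) w)
  (g (t *: v) (G (t *: v) v w) (G (t *: v) v w)
   - 2 / t * g (t *: v) (G (t *: v) v w) w
   - g (t *: v) (riem_op G dG (t *: v) w v v) w).
Proof.
move=> Vt t0; apply: (is_derive_eq (nc_dg_curve w Vt (nc_dG_ray v w Vt))).
have hj : dG (t *: v) w v v = - ((2 / t) *: G (t *: v) v w).
  apply: (scalerI t0); rewrite nc_jacobi // scalerN scalerA; congr (- (_ *: _)).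
  by field.
rewrite /riem_op nc_GZray // nc_G0r // addr0 hj.
rewrite !nc_gDl // !nc_gNl // nc_gZl // (nc_dGsym _ v w) // (nc_Gsym H w v Vt); ring.
Qed.

(** * Riccati comparison along a ray *)

Definition nc_Q v t : 'M[R]_d := \matrix_(i, j) g (t *: v) (delta_mx 0 i) (delta_mx 0 j).
Definition nc_B v t : 'M[R]_d :=
  \matrix_(i, j) g (t *: v) (G (t *: v) v (delta_mx 0 i)) (delta_mx 0 j).

Lemma qform_bilin (b : 'rV[R]_d -> 'rV[R]_d -> R) w :
  (forall s u v z, b (s *: u + v) z = s * b u z + b v z) ->
  (forall s u v z, b z (s *: u + v) = s * b z u + b z v) ->
  qform (\matrix_(i, j) b (delta_mx 0 i) (delta_mx 0 j)) w = b w w.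
Proof.
move=> bl br; rewrite (@linform_sum (b ^~ w)) //.
apply: eq_bigr => i _; rewrite (@linform_sum (b (delta_mx 0 i))) //.
by rewrite mulr_sumr; apply: eq_bigr => j _; rewrite !mxE; ring.
Qed.

Lemma nc_QE v t w : V (t *: v) -> qform (nc_Q v t) w = g (t *: v) w w.
Proof.
move=> Vt; rewrite /nc_Q (qform_bilin (b := g (t *: v))) // => s u u' z.
  by rewrite (nc_lin H).
by rewrite nc_gDr // nc_gZr.
Qed.

Lemma nc_BE v t w : V (t *: v) -> qform (nc_B v t) w = g (t *: v) (G (t *: v) v w) w.
Proof.
move=> Vt; rewrite /nc_B (qform_bilin (b := fun a b => g (t *: v) (G (t *: v) v a) b)) // => s u u' z.
  by rewrite nc_GDr // nc_GZr // (nc_lin H).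
by rewrite nc_gDr // nc_gZr.
Qed.

Lemma nc_Q_cont v t i j : V (t *: v) -> {for t, continuous (fun s => nc_Q v s i j)}.
Proof.
move=> Vt; rewrite (_ : (fun s => _) = fun s => g (s *: v) (delta_mx 0 i) (delta_mx 0 j)).
  by apply: is_derive_continuous; exact: nc_dg_ray.
by apply/funext => s; rewrite mxE.
Qed.

Lemma nc_B_cont v t i j : V (t *: v) -> {for t, continuous (fun s => nc_B v s i j)}.
Proof.
move=> Vt; rewrite (_ : (fun s => _) = fun s => g (s *: v) (G (s *: v) v (delta_mx 0 i)) (delta_mx 0 j)).
  by apply: is_derive_continuous; apply: nc_dg_curve => //; exact: nc_dG_ray.
by apply/funext => s; rewrite mxE.
Qed.

Lemma qform_lin (c1 c2 : R) (A B : 'M[R]_d) w :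
  qform (\matrix_(i, j) (c1 * (c2 * A i j + B i j))) w =
  c1 * (c2 * qform A w + qform B w).
Proof.
rewrite /qform [c2 * _]mulr_sumr -big_split mulr_sumr; apply: eq_bigr => i _.
rewrite /= [c2 * _]mulr_sumr -big_split mulr_sumr; apply: eq_bigr => j _.
by rewrite /= !mxE; ring.
Qed.

(** Evaluation at [s = - p / (r + 1)], which unlike [- p / r] also makes sense for [r = 0]. *)
Lemma quad_ge0_lin (p r : R) : 0 <= r -> (forall s, 0 <= 2 * s * p + s ^+ 2 * r) -> p = 0.
Proof.
move=> r0 /(_ (- p / (r + 1))) h; have r1 : 0 < r + 1 by rewrite ltr_wpDl.
have E : 2 * (- p / (r + 1)) * p + (- p / (r + 1)) ^+ 2 * r =
  - (p ^+ 2 * ((r + 2) / (r + 1) ^+ 2)) by field; rewrite gt_eqF.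
move: h; rewrite E oppr_ge0 pmulr_lle0; last first.
  by rewrite divr_gt0 // ?exprn_gt0 // ltr_wpDl.
by move=> h; apply/eqP; rewrite -sqrf_eq0 eq_le h sqr_ge0.
Qed.

(** The operator [S_t = 1 / t + G (t v) v] sends the Jacobi field [t w] to its covariant derivative
    and satisfies [S' + S^2 + R_v = 0]. The form of [S_t - h] is kept positive definite for [sg = 1]
    and negative definite for [sg = -1]: at a first null vector its derivative is the form of
    [- h' - h^2 - R_v], whose sign is the last hypothesis. *)
Lemma riccati_compare (sg : R) v (h h' : R -> R) (a : R) : sg * sg = 1 -> V v ->
  0 < a <= 1 ->
  (forall t, a <= t <= 1 -> is_derive t 1 h (h' t)) ->
  (forall w, w != 0 -> 0 < sg * ((a^-1 - h a) * g (a *: v) w w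
     + g (a *: v) (G (a *: v) v w) w)) ->
  (forall t w, a < t <= 1 -> w != 0 -> 0 < sg * ((- h' t - h t ^+ 2) * g (t *: v) w w
     - g (t *: v) (riem_op G dG (t *: v) w v v) w)) ->
  forall t, a <= t <= 1 -> forall w, w != 0 ->
    0 < sg * ((t^-1 - h t) * g (t *: v) w w + g (t *: v) (G (t *: v) v w) w).
Proof.
move=> sg2 Vv /andP[a0 a1] dh hstart hstep.
have Vs s : a <= s <= 1 -> V (s *: v).
  by move=> /andP[s0 s1]; apply: (nc_star H) => //; rewrite s1 (le_trans (ltW a0)).
pose q t : 'M[R]_d := \matrix_(i, j) (sg * ((t^-1 - h t) * nc_Q v t i j + nc_B v t i j)).
have qE t w : a <= t <= 1 -> qform (q t) w = sg * ((t^-1 - h t) * g (t *: v) w w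
     + g (t *: v) (G (t *: v) v w) w).
  by move=> /Vs Vt; rewrite /q qform_lin nc_QE // nc_BE.
have dinv t : a <= t -> is_derive t 1 (fun s : R => s^-1) (- t ^- 2).
  move=> at_; have t0 : t != 0 by rewrite gt_eqF // (lt_le_trans a0).
  by apply: (is_derive_eq (is_deriveV t0 (is_derive_idR t))); rewrite [LHS]mulr1.
move=> u1 u1ab w w0; rewrite -qE //.
apply: (@posdef_propagate _ _ q a 1) => //.
- move=> t t1 i j; have := t1 => /andP[at_ _].
  rewrite (_ : (fun s => _) = fun s => sg * ((s^-1 - h s) * nc_Q v s i j + nc_B v s i j)); last first.
    by apply/funext => s; rewrite mxE.
  apply: cvgM; first exact: cvg_cst.
  apply: cvgD; last by apply: nc_B_cont; exact: Vs.
  apply: cvgM; last by apply: nc_Q_cont; exact: Vs.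
  by apply: cvgB; apply: is_derive_continuous; [exact: dinv|exact: dh].
- by move=> z z0; rewrite qE ?lexx ?a1 //; exact: hstart.
move=> t /andP[at_ t1] ge0 z z0 qz.
have tab : a <= t <= 1 by rewrite ltW.
have Vt := Vs _ tab; have t0 : t != 0 by rewrite gt_eqF // (lt_trans a0).
pose C u := G (t *: v) v u.
have symC u u' : g (t *: v) (C u) u' = g (t *: v) (C u') u.
  have := nc_selfadj u u' Vt; rewrite !nc_GZl // !nc_gZl //.
  exact: mulfI.
(* A null vector of a semidefinite form lies in its kernel, so [C z] is the multiple [h t - 1 / t]
   of [z]. *)
have Tz u : sg * ((t^-1 - h t) * g (t *: v) z u + g (t *: v) (C z) u) = 0.
  apply: (@quad_ge0_lin _ (qform (q t) u)) => // s.
  have := ge0 (z + s *: u); move: qz; rewrite !qE // => qz.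
  rewrite nc_GDr // nc_GZr // !nc_gDl // !nc_gDr // !nc_gZl // !nc_gZr //.
  rewrite -/(C z) -/(C u) (symC u z) (nc_sym H u z Vt) => h1.
  apply: le_trans h1 _; move: qz; rewrite -/(C z) => qz.
  by rewrite le_eqVlt; apply/orP; left; apply/eqP; rewrite -[RHS]add0r -qz; ring.
have Cz : C z = (h t - t^-1) *: z.
  suff : (t^-1 - h t) *: z + C z = 0.
    by move=> /eqP; rewrite addrC addr_eq0 => /eqP ->; rewrite -scaleNr opprB.
  apply: (nc_eq0 Vt) => u; rewrite nc_gDl // nc_gZl //.
  have sg0 : sg != 0 by apply/eqP => sg0; move: sg2; rewrite sg0 mul0r => /eqP; rewrite eq_sym oner_eq0.
  by apply: (mulfI sg0); rewrite Tz mulr0.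
have df : is_derive t 1 (fun s => sg * ((s^-1 - h s) * g (s *: v) z z
     + g (s *: v) (G (s *: v) v z) z))
   (sg * ((- h' t - h t ^+ 2) * g (t *: v) z z
     - g (t *: v) (riem_op G dG (t *: v) z v v) z)).
  apply: (is_derive_eq (is_derive_fM (is_derive_fcst sg t 1) (is_derive_fD
    (is_derive_fM (is_derive_fB (dinv t (ltW at_)) (dh t tab)) (nc_dq z Vt)) (nc_db z Vt t0)))).
  by rewrite -/(C z) Cz !nc_gZl // !nc_gZr //; field.
exists (sg * ((- h' t - h t ^+ 2) * g (t *: v) z z
     - g (t *: v) (riem_op G dG (t *: v) z v v) z)).
  by apply: hstep => //; rewrite at_.
apply: near_eq_is_derive df; near=> s.
have Vsv : V (s *: v) by near: s; exact: nc_near_ray.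
by rewrite /q qform_lin nc_QE // nc_BE.
Unshelve. all: by end_near. Qed.

(** Bounds uniform in [w] near a starting parameter: they let a large scalar, [1 / t] or a
    hyperbolic cotangent close to its pole, decide the sign of the Riccati form there. *)
Lemma nc_start v t0 : V v -> 0 <= t0 <= 1 -> exists m C e : R,
  [/\ 0 < m, 0 < C, 0 < e & forall t, t0 <= t < t0 + e -> t <= 1 -> forall w,
   m * `|w| ^+ 2 <= g (t *: v) w w /\
   `|g (t *: v) (G (t *: v) v w) w| <= C * `|w| ^+ 2].
Proof.
move=> Vv t01; have Vs s : 0 <= s <= 1 -> V (s *: v) by exact: (nc_star H).
have Vt := Vs _ t01.
have [|m m0 hm] := @qform_min _ _ (nc_Q v t0).
  by move=> w w0; rewrite nc_QE //; exact: (nc_pos H).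
have e0 : 0 < m / 2 / (d * d).+1%:R by rewrite !divr_gt0 // ltr0Sn.
have hQ : \forall s \near t0, forall ij : 'I_d * 'I_d,
    `|nc_Q v s ij.1 ij.2 - nc_Q v t0 ij.1 ij.2| <= m / 2 / (d * d).+1%:R.
  apply: (@filter_forall _ _ (fun (ij : 'I_d * 'I_d) s =>
    `|nc_Q v s ij.1 ij.2 - nc_Q v t0 ij.1 ij.2| <= m / 2 / (d * d).+1%:R) (nbhs t0)) => -[i j] /=.
  have cQ : {for t0, continuous (fun s => nc_Q v s i j)} by exact: nc_Q_cont.
  have /cvgrPdist_le/(_ _ e0) := cQ.
  by apply: filterS => s; rewrite distrC.
pose K := \sum_(i < d) \sum_(j < d) `|nc_B v t0 i j|.
have KB i j : `|nc_B v t0 i j| <= K.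
  rewrite /K (bigD1 i) //= (bigD1 j) //= -addrA lerDl addr_ge0 //.
    by apply: sumr_ge0.
  by apply: sumr_ge0 => k _; apply: sumr_ge0.
have hB : \forall s \near t0, forall ij : 'I_d * 'I_d,
    `|nc_B v s ij.1 ij.2| <= K + 1.
  apply: (@filter_forall _ _ (fun (ij : 'I_d * 'I_d) s =>
    `|nc_B v s ij.1 ij.2| <= K + 1) (nbhs t0)) => -[i j] /=.
  have cB : {for t0, continuous (fun s => nc_B v s i j)} by exact: nc_B_cont.
  have /cvgrPdist_le/(_ _ ltr01) := cB.
  apply: filterS => s; rewrite distrC => hs.
  rewrite -[nc_B v s i j](subrK (nc_B v t0 i j)); apply: le_trans (ler_normD _ _) _.
  by rewrite addrC lerD.
have : \forall s \near t0, (forall ij : 'I_d * 'I_d,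
    `|nc_Q v s ij.1 ij.2 - nc_Q v t0 ij.1 ij.2| <= m / 2 / (d * d).+1%:R) /\
    (forall ij : 'I_d * 'I_d, `|nc_B v s ij.1 ij.2| <= K + 1).
  by near=> s; split; near: s.
move=> /nbhs_ballP[e /= e1 he].
have K0 : 0 <= K by apply: sumr_ge0 => i _; apply: sumr_ge0.
exists (m / 2), ((d * d).+1%:R * (K + 1)), e; split=> //.
- by rewrite divr_gt0.
- by rewrite mulr_gt0 ?ltr0Sn // ltr_wpDl.
move=> t /andP[t0t te] t1 w; have t0' : 0 <= t0 by case/andP: t01.
have Vt' : V (t *: v) by apply: Vs; rewrite t1 (le_trans t0').
have [|h1 h2] := he t.
  by rewrite /ball /= distrC ger0_norm ?subr_ge0 // ltrBlDr addrC.
split; last first.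
  rewrite -nc_BE //; apply: le_trans (qform_bound w (fun i j => h2 (i, j))) _.
  by rewrite ler_wpM2r ?exprn_ge0 // ler_wpM2r ?ler_nat // addr_ge0.
have hb : forall i j, `|(nc_Q v t - nc_Q v t0) i j| <= m / 2 / (d * d).+1%:R.
  by move=> i j; have := h1 (i, j); rewrite !mxE.
have {}hb := qform_bound w hb.
have E : qform (nc_Q v t) w = qform (nc_Q v t0) w + qform (nc_Q v t - nc_Q v t0) w.
  rewrite /qform -big_split; apply: eq_bigr => i _; rewrite -big_split.
  by apply: eq_bigr => j _; rewrite !mxE /=; ring.
have w2 : 0 <= `|w| ^+ 2 by rewrite exprn_ge0.
have hb2 : (d * d)%:R * (m / 2 / (d * d).+1%:R) * `|w| ^+ 2 <= m / 2 * `|w| ^+ 2.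
  rewrite ler_wpM2r // mulrCA ger_pMr ?divr_gt0 // ler_pdivrMr ?ltr0Sn // mul1r.
  by rewrite ler_nat.
rewrite -nc_QE // E; have h3 := hm w; have h4 := le_trans hb hb2.
have h5 : - qform (nc_Q v t - nc_Q v t0) w <= m / 2 * `|w| ^+ 2.
  by apply: le_trans h4; rewrite -normrN ler_norm.
have -> : m / 2 * `|w| ^+ 2 = m * `|w| ^+ 2 - m / 2 * `|w| ^+ 2 by field.
by rewrite lerBlDr; apply: le_trans h3 _; rewrite -addrA lerDl -lerBlDl sub0r.
Unshelve. all: by end_near. Qed.

(** Comparison with [h t = k1 cot (k1 (t + eta))]. The shift [eta] keeps [h] finite at [0], where
    [1 / t] blows up and makes the form positive; at [t = 1] the value [k1 cot k'] is still at least
    [cos k']. *)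
Lemma nc_hess_lower v (k k' : R) : V v -> 0 <= k < k' -> k' < pi / 2 ->
  (forall t w, 0 < t <= 1 ->
     g (t *: v) (riem_op G dG (t *: v) w v v) w <= k ^+ 2 * g (t *: v) w w) ->
  forall w, cos k' * g v w w <= g v w w + g v (G v v w) w.
Proof.
move=> Vv /andP[k0 kk'] k'pi hK w.
have [->|w0] := eqVneq w 0; first by rewrite nc_G0r // !nc_g0l // mulr0 addr0.
have Vs s : 0 <= s <= 1 -> V (s *: v) by exact: (nc_star H).
have k'0 : 0 < k' by exact: le_lt_trans kk'.
have pi0 : 0 < pi :> R by exact: pi_gt0.
have sk' : sin k' < k' by apply: sin_lt; rewrite k'0 /=; lra.
(* [k1 > k] makes the curvature inequality strict, [k1 < k'] makes [eta] positive, and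
   [k1 >= sin k'] gives [k1 cot k' >= cos k']. *)
pose k1 := Num.max (sin k') ((k + k') / 2).
have k1k' : k1 < k' by rewrite /k1 gt_max sk' /=; lra.
have kk1 : k < k1 by rewrite /k1 lt_max; apply/orP; right; lra.
have k10 : 0 < k1 by exact: le_lt_trans kk1.
have sk1 : sin k' <= k1 by rewrite /k1 le_max lexx.
pose eta := k' / k1 - 1.
have eta0 : 0 < eta by rewrite /eta subr_gt0 ltr_pdivlMr // mul1r.
pose th t := k1 * (t + eta).
have th1 : th 1 = k' by rewrite /th /eta; field; rewrite gt_eqF.
have thb t : 0 <= t <= 1 -> 0 < th t <= k'.
  move=> /andP[t0 t1]; rewrite -th1 /th mulr_gt0 //=.
    by rewrite ler_pM2l // lerD2r.
  by rewrite (lt_le_trans eta0) // lerDr.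
have sin0 t : 0 <= t <= 1 -> 0 < sin (th t).
  by move=> /thb /andP[h1 h2]; apply: sin_gt0_pi; rewrite h1 /=; lra.
pose h t := k1 * cos (th t) * (sin (th t))^-1.
pose h' t := - k1 ^+ 2 - h t ^+ 2.
have dth t : is_derive t 1 th k1.
  apply: (is_derive_eq (is_derive_fM (is_derive_fcst k1 t 1)
    (is_derive_fD (is_derive_idR t) (is_derive_fcst eta t 1)))).
  by rewrite mulr0 !addr0 mulr1.
have dh t : 0 <= t <= 1 -> is_derive t 1 h (h' t).
  move=> t01; have s0 := sin0 _ t01; have s0' : sin (th t) != 0 by rewrite gt_eqF.
  have dc := is_derive_compR (dth t) (is_derive_cos (th t)).
  have ds := is_derive_compR (dth t) (is_derive_sin (th t)).
  have dsV := @is_deriveV _ (sin \o th) t _ 1 s0' ds.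
  apply: (is_derive_eq (is_derive_fM (is_derive_fM (is_derive_fcst k1 t 1) dc) dsV)).
  rewrite /h' /h /GRing.scale /=.
  have c2 : cos (th t) ^+ 2 = 1 - sin (th t) ^+ 2 by rewrite -(cos2Dsin2 (th t)) addrK.
  have -> : - k1 ^+ 2 - (k1 * cos (th t) / sin (th t)) ^+ 2 =
    - k1 ^+ 2 - k1 ^+ 2 * cos (th t) ^+ 2 / sin (th t) ^+ 2 by field.
  have -> : k1 * cos (th t) * (- sin (th t) ^- 2 * (k1 * cos (th t))) +
    (sin (th t))^-1 * (k1 * (k1 * - sin (th t)) + cos (th t) * 0) =
    - k1 ^+ 2 - k1 ^+ 2 * cos (th t) ^+ 2 / sin (th t) ^+ 2 by field.
  by [].
have h01 (a : R) : 0 <= a <= 1 -> h a <= h 0.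
  move=> /andP[a0 a1].
  have hd (t : R) : 0 <= t <= a -> is_derive t 1 h (h' t).
    by move=> /andP[t0 ta]; apply: dh; rewrite t0 (le_trans ta).
  have hn (t : R) : 0 <= t <= a -> h' t <= 0.
    by move=> _; rewrite /h' -opprD oppr_le0 addr_ge0 // sqr_ge0.
  exact: (derive_le0_ge a0 hd hn).
have [|m [C [e [m0 C0 e0 hst]]]] := @nc_start v 0 Vv; first by rewrite lexx ler01.
have h00 : 0 < h 0 + C / m + 1.
  rewrite ltr_wpDl // addr_ge0 //; last by rewrite divr_ge0 // ltW.
  rewrite /h !mulr_ge0 //; first exact: ltW.
    have /andP[q1 q2] : 0 < th 0 <= k' by apply: thb; rewrite lexx ler01.
    by apply: cos_ge0_pihalf; lra.
  by rewrite invr_ge0 ltW // sin0 // lexx ler01.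
(* Small enough for the bounds of [nc_start] to hold at [a] and for [1 / a] to exceed
   [h 0 + C / m]. *)
pose a := Num.min (Num.min (e / 2) 1) (h 0 + C / m + 1)^-1.
have a0 : 0 < a by rewrite /a !lt_min divr_gt0 // ltr01 invr_gt0 h00.
have a1 : a <= 1 by rewrite /a !ge_min lexx orbT.
have ae : a < 0 + e.
  by rewrite add0r /a !gt_min gtr_pMr // invf_lt1 // ltr1n.
have ainv : h 0 + C / m + 1 <= a^-1.
  by rewrite -[leLHS]invrK lef_pV2 ?posrE ?invr_gt0 // /a ge_min lexx orbT.
have a01 : 0 < a <= 1 by rewrite a0.
have d1 t : a <= t <= 1 -> is_derive t 1 h (h' t).
  by move=> /andP[at_ t1]; apply: dh; rewrite t1 (le_trans (ltW a0)).
have d2 z : z != 0 -> 0 < 1 * ((a^-1 - h a) * g (a *: v) z z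
     + g (a *: v) (G (a *: v) v z) z).
  move=> z0; rewrite mul1r.
  have [|q1 q2] := hst a _ a1 z; first by rewrite (ltW a0).
  have z2 : 0 < `|z| ^+ 2 by rewrite exprn_gt0 // normr_gt0.
  have ha : C / m + 1 <= a^-1 - h a.
    rewrite lerBrDr; apply: le_trans ainv.
    by rewrite addrC addrA lerD2r lerD2r h01 // (ltW a0).
  have h3 : (C / m + 1) * (m * `|z| ^+ 2) <= (a^-1 - h a) * g (a *: v) z z.
    apply: ler_pM => //; last by rewrite mulr_ge0 // ltW.
    by rewrite addr_ge0 // divr_ge0 // ltW.
  have h4 : - (C * `|z| ^+ 2) <= g (a *: v) (G (a *: v) v z) z.
    by move: q2; rewrite ler_norml => /andP[].
  have h5 : (C / m + 1) * (m * `|z| ^+ 2) = C * `|z| ^+ 2 + m * `|z| ^+ 2.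
    by field; rewrite gt_eqF.
  have h6 : 0 < m * `|z| ^+ 2 by rewrite mulr_gt0.
  by rewrite h5 in h3; lra.
have d3 t z : a < t <= 1 -> z != 0 -> 0 < 1 * ((- h' t - h t ^+ 2) * g (t *: v) z z
     - g (t *: v) (riem_op G dG (t *: v) z v v) z).
  move=> /andP[at_ t1] z0.
  have -> : - h' t - h t ^+ 2 = k1 ^+ 2 by rewrite /h'; ring.
  rewrite mul1r subr_gt0.
  have t01 : 0 < t <= 1 by rewrite t1 (lt_trans a0).
  apply: le_lt_trans (hK t z t01) _; rewrite ltr_pM2r.
    by rewrite ltr_pXn2r // nnegrE ltW.
  by apply: (nc_pos H) => //; apply: Vs; rewrite t1 ltW //; case/andP: t01.
have a11 : a <= (1 : R) <= 1 by rewrite a1 /=.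
have := riccati_compare (mulr1 1) Vv a01 d1 d2 d3 a11 w0.
rewrite mul1r invr1 scale1r => hw.
have sk0 : 0 < sin k' by rewrite -th1 sin0 // ler01 lexx.
have ck0 : 0 < cos k' by apply: cos_gt0_pihalf; lra.
have q0 := nc_pos H Vv w0.
have h1 : cos k' <= h 1.
  rewrite /h th1 -[leLHS]mulr1 -mulrA mulrCA ler_pM2l // ler_pdivlMr // mul1r.
  exact: sk1.
have : cos k' * g v w w <= h 1 * g v w w by rewrite ler_pM2r.
move: hw; lra.
Qed.

(* [nu] plays the role of [sqrt|L| |v|]: the bound is the Rauch estimate
   [|J(1)| <= sinh(nu)/nu |J'(0)|] for the Jacobi field [J(t) = t w]. *)
Lemma nc_rauch v (nu : R) : V v -> 0 < nu ->
  (forall t w, 0 < t <= 1 -> w != 0 ->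
     - (nu ^+ 2 * g (t *: v) w w) < g (t *: v) (riem_op G dG (t *: v) w v v) w) ->
  forall w, nu ^+ 2 * g v w w <= sinhR nu ^+ 2 * g 0 w w.
Proof.
move=> Vv nu0 hL w; have V0 := nc_V0 Vv.
have [->|w0] := eqVneq w 0; first by rewrite !nc_g0l // !mulr0.
have Vs s : 0 <= s <= 1 -> V (s *: v) by exact: (nc_star H).
have main (a : R) : 0 < a < 1 ->
   g v w w * nu ^+ 2 * (1 - a) ^+ 2 <= g (a *: v) w w * sinhR nu ^+ 2.
  (* The comparison function [nu coth (nu (t - eta))] has its pole at [eta > 0], where the Riccati
     operator is still bounded. With [eta = a^2] the pole is much closer to [0] than [a] is, so
     nothing is lost as [a] tends to [0]. *)
  move=> /andP[a0 a1]; pose eta := a ^+ 2.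
  have eta0 : 0 < eta by rewrite exprn_gt0.
  have etaa : eta < a by rewrite /eta expr2 gtr_pMr.
  have eta1 : eta < 1 by exact: lt_trans a1.
  pose th t := nu * (t - eta).
  have dth t : is_derive t 1 th nu.
    apply: (is_derive_eq (is_derive_fM (is_derive_fcst nu t 1)
      (is_derive_fB (is_derive_idR t) (is_derive_fcst eta t 1)))).
    by rewrite mulr0 addr0 subr0 mulr1.
  have ds t : is_derive t 1 (sinhR \o th) (nu *: coshR (th t)).
    exact: is_derive_compR (dth t) (is_derive_sinhR (th t)).
  have th0 t : eta < t -> 0 < th t by move=> ?; rewrite /th mulr_gt0 // subr_gt0.
  have s0 t : eta < t -> 0 < sinhR (th t).
    by move=> /th0 h; apply: (lt_le_trans h); apply: sinhR_ge; exact: ltW.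
  pose h t := nu * coshR (th t) * (sinhR (th t))^-1.
  pose h' t := nu ^+ 2 - h t ^+ 2.
  have dsV t : eta < t -> is_derive t 1 (fun t => (sinhR (th t))^-1)
      (- sinhR (th t) ^- 2 *: (nu *: coshR (th t))).
    by move=> /s0 st; apply: (@is_deriveV _ (sinhR \o th)); rewrite ?gt_eqF.
  have dh t : eta < t -> is_derive t 1 h (h' t).
    move=> et; have st : sinhR (th t) != 0 by rewrite gt_eqF // s0.
    have dc := is_derive_compR (dth t) (is_derive_coshR (th t)).
    apply: (is_derive_eq (is_derive_fM (is_derive_fM (is_derive_fcst nu t 1) dc) (dsV _ et))).
    rewrite /h' /h /GRing.scale /=; field.
    exact: st.
  have [|m [C [e [m0 C0 e0 hst]]]] := @nc_start v eta Vv; first by rewrite !ltW.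
  (* So close to the pole that, through [coth x >= 1 / x], the comparison function exceeds the
     Riccati operator at [b = eta + del]. *)
  pose del := Num.min (Num.min (e / 2) (a - eta)) (eta^-1 + C / m + 1)^-1.
  have E0 : 0 < eta^-1 + C / m + 1.
    by rewrite ltr_wpDl // addr_ge0 // ?invr_ge0 ?divr_ge0 // ltW.
  have del0 : 0 < del by rewrite /del !lt_min divr_gt0 // subr_gt0 etaa invr_gt0 E0.
  have dele : del < e by rewrite /del !gt_min gtr_pMr // invf_lt1 // ltr1n.
  have dela : del <= a - eta by rewrite /del !ge_min lexx orbT.
  have delV : eta^-1 + C / m + 1 <= del^-1.
    by rewrite -[leLHS]invrK lef_pV2 ?posrE ?invr_gt0 // /del ge_min lexx orbT.
  pose b := eta + del.
  have etab : eta < b by rewrite ltrDl.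
  have b0 : 0 < b by exact: lt_trans etab.
  have ba : b <= a by rewrite /b -lerBrDl.
  have b1 : b <= 1 by exact: le_trans (ltW a1).
  have hb : del^-1 <= h b.
    have thb : th b = nu * del by rewrite /th /b addrAC subrr add0r.
    have tb0 : 0 <= nu * del by rewrite mulr_ge0 // ltW.
    have sb := s0 _ etab; rewrite /h thb ler_pdivlMr -?thb // thb ler_pdivrMl //.
    by apply: le_trans (sinhR_le_cosh tb0) _; rewrite mulrCA mulrA mulrC.
  have comp t : b <= t <= 1 -> (t^-1 - h t) * g (t *: v) w w + g (t *: v) (G (t *: v) v w) w <= 0.
    move=> tb; rewrite -oppr_ge0 -mulN1r ltW //.
    have sg2 : -1 * -1 = 1 :> R by rewrite mulrNN mulr1.
    have b01 : 0 < b <= 1 by rewrite b0.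
    have d1 s : b <= s <= 1 -> is_derive s 1 h (h' s).
      by move=> /andP[bs _]; apply: dh; exact: lt_le_trans bs.
    have d2 z : z != 0 -> 0 < -1 * ((b^-1 - h b) * g (b *: v) z z
       + g (b *: v) (G (b *: v) v z) z).
      move=> z0; have [|q1 q2] := hst b _ b1 z.
        by rewrite (ltW etab) /= ltrD2l.
      have z2 : 0 < `|z| ^+ 2 by rewrite exprn_gt0 // normr_gt0.
      have bi : b^-1 <= eta^-1 by rewrite lef_pV2 ?posrE // ltW.
      have ha : C / m + 1 <= h b - b^-1.
        rewrite lerBrDr; apply: le_trans hb; apply: le_trans delV.
        by rewrite [_ + b^-1]addrC addrA lerD2r lerD2r.
      have h3 : (C / m + 1) * (m * `|z| ^+ 2) <= (h b - b^-1) * g (b *: v) z z.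
        apply: ler_pM => //; last by rewrite mulr_ge0 // ltW.
        by rewrite addr_ge0 // divr_ge0 // ltW.
      have h4 : g (b *: v) (G (b *: v) v z) z <= C * `|z| ^+ 2.
        by move: q2; rewrite ler_norml => /andP[].
      have h5 : (C / m + 1) * (m * `|z| ^+ 2) = C * `|z| ^+ 2 + m * `|z| ^+ 2.
        by field; rewrite gt_eqF.
      have h6 : 0 < m * `|z| ^+ 2 by rewrite mulr_gt0.
      rewrite h5 in h3; rewrite mulN1r oppr_gt0.
      have -> : (b^-1 - h b) * g (b *: v) z z = - ((h b - b^-1) * g (b *: v) z z) by ring.
      lra.
    have d3 s z : b < s <= 1 -> z != 0 -> 0 < -1 * ((- h' s - h s ^+ 2) * g (s *: v) z z
       - g (s *: v) (riem_op G dG (s *: v) z v v) z).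
      move=> /andP[bs s1] z0.
      have s01 : 0 < s <= 1 by rewrite s1 (lt_trans b0).
      have := hL s z s01 z0; rewrite /h'; lra.
    exact: (riccati_compare sg2 Vv b01 d1 d2 d3 tb w0).
  (* The squared length of the field [t w] divided by that of the model solution; [comp] makes its
     derivative nonpositive, so it decreases from [a] to [1]. *)
  pose P t := t ^+ 2 * g (t *: v) w w * ((sinhR (th t))^-1 * (sinhR (th t))^-1).
  have PP : P 1 <= P a.
    apply: (@derive_le0_ge _ P (fun t => 2 * t ^+ 2 * ((sinhR (th t))^-1 * (sinhR (th t))^-1) *
      ((t^-1 - h t) * g (t *: v) w w + g (t *: v) (G (t *: v) v w) w))).
    - exact: ltW.
    - move=> t /andP[at_ t1]; have et : eta < t by exact: lt_le_trans at_.
      have Vt : V (t *: v) by apply: Vs; rewrite t1 (le_trans (ltW a0)).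
      have t0 : t != 0 by rewrite gt_eqF // (lt_trans eta0).
      have st : sinhR (th t) != 0 by rewrite gt_eqF // s0.
      apply: (is_derive_eq (is_derive_fM (is_derive_fM (is_derive_fM (is_derive_idR t)
        (is_derive_idR t)) (nc_dq w Vt)) (is_derive_fM (dsV _ et) (dsV _ et)))).
      by rewrite /h /GRing.scale /=; field; rewrite t0 st.
    - move=> t /andP[at_ t1]; rewrite mulr_ge0_le0 //.
        by rewrite -invfM -expr2 mulr_ge0 ?invr_ge0 ?sqr_ge0 // mulr_ge0 // sqr_ge0.
      by apply: comp; rewrite t1 (le_trans ba).
  have sa := s0 _ etaa; have s1 := s0 _ eta1.
  have q1 := nc_ge0 w Vv.
  have qa : 0 <= g (a *: v) w w by apply: nc_ge0; apply: Vs; rewrite !ltW.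
  have {PP} : g v w w * sinhR (th a) ^+ 2 <= a ^+ 2 * g (a *: v) w w * sinhR (th 1) ^+ 2.
    move: PP; rewrite /P scale1r expr1n mul1r -!invfM -!expr2 ler_pdivrMr ?exprn_gt0 //.
    by rewrite mulrAC ler_pdivlMr ?exprn_gt0.
  have sth1 : sinhR (th 1) <= sinhR nu.
    by apply: sinhR_mono; rewrite /th ger_pMr // lerBlDr lerDl ltW.
  have stha : nu * (a * (1 - a)) <= sinhR (th a).
    have -> : nu * (a * (1 - a)) = th a by rewrite /th /eta; ring.
    by apply: sinhR_ge; exact: ltW (th0 _ etaa).
  move=> h1.
  have h2 : g v w w * (nu * (a * (1 - a))) ^+ 2 <= g v w w * sinhR (th a) ^+ 2.
    rewrite ler_wpM2l // ler_pXn2r // nnegrE; last exact: ltW.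
    by rewrite !mulr_ge0 ?subr_ge0 // ltW.
  have h3 : a ^+ 2 * g (a *: v) w w * sinhR (th 1) ^+ 2 <= a ^+ 2 * g (a *: v) w w * sinhR nu ^+ 2.
    apply: ler_wpM2l; first by rewrite mulr_ge0 ?sqr_ge0.
    by rewrite ler_pXn2r // nnegrE ltW // (lt_le_trans s1).
  have a2 : 0 < a ^+ 2 by rewrite exprn_gt0.
  rewrite -(ler_pM2l a2) [leRHS]mulrA; apply: le_trans h3; apply: le_trans h1.
  apply: le_trans h2; rewrite le_eqVlt; apply/orP; left; apply/eqP; ring.
rewrite leNgt; apply/negP => hlt.
(* The inequality [main] passes to the limit [a = 0] by continuity of the metric along the ray. *)
pose f (a : R) := g (a *: v) w w * sinhR nu ^+ 2 - g v w w * nu ^+ 2 * ((1 - a) * (1 - a)).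
have cf : {for (0 : R), continuous f}.
  rewrite /f; apply: cvgB; apply: cvgM; do ?exact: cvg_cst.
    by apply: is_derive_continuous; apply: nc_dq; rewrite scale0r.
  by apply: cvgM; apply: cvgB; do ?[exact: cvg_cst|exact: cvg_id].
have f0 : f 0 < 0 by rewrite /f scale0r subr0 !mulr1 subr_lt0 mulrC [ltRHS]mulrC.
have /cvgrPdist_lt/(_ (- f 0)) := cf; rewrite oppr_gt0 => /(_ f0) /nbhs_ballP[e /= e0 he].
pose a := Num.min (e / 2) (1 / 2).
have a0 : 0 < a by rewrite /a lt_min !divr_gt0.
have a1 : a < 1 by rewrite /a gt_min; apply/orP; right; lra.
have /he : ball (0 : R) e a.
  by rewrite /ball /= sub0r normrN gtr0_norm // /a gt_min gtr_pMr // invf_lt1 // ltr1n.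
have fa : 0 <= f a by rewrite /f -expr2 subr_ge0 main // a0.
by rewrite ltr_norml => /andP[]; lra.
Qed.

End NormalCoordinates.

(** * The Levi-Civita connection of a chart *)

Section SmoothCharts.
Context {R : realType}.
Implicit Types VV W : normedModType R.

Lemma Ck_local VV W k (U : set VV) (f : VV -> W) :
  (forall x, U x -> exists U', [/\ open U', U' x & Ck k U' f]) -> Ck k U f.
Proof.
elim: k f => [|k IH] f h.
  by split=> // x /h [U' [_ U'x C]]; exact: Ck_cont C U'x.
split=> [x /h [U' [_ U'x C]]|v]; first exact: Ck_cont C U'x.
split=> [x /h [U' [_ U'x C]]|]; first exact: Ck_derivable C U'x.
by apply: IH => x /h [U' [oU' U'x C]]; exists U'; split => //; exact: Ck_D.
Qed.

Lemma smooth_on_Ck VV W k (U : set VV) (f : VV -> W) : open U ->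
  smooth_on U f -> Ck k U f.
Proof.
move=> oU sf; apply: Ck_local => x Ux; have [U' [F [oU' U'x CF FE]]] := sf x Ux.
have oI : open (U `&` U') by exact: openI.
exists (U `&` U'); split => //; apply: (Ck_eq oI) (Ck_sub _ (CF k)).
  by move=> y [Uy U'y]; exact: FE.
by move=> y [].
Qed.

Lemma dotvC m (u v : 'rV[R]_m) : dotv u v = dotv v u.
Proof. by apply: eq_bigr => i _; rewrite mulrC. Qed.

Lemma dotv_lin m (s : R) (u v w : 'rV[R]_m) : dotv (s *: u + v) w = s * dotv u w + dotv v w.
Proof.
by rewrite /dotv mulr_sumr -big_split; apply: eq_bigr => i _; rewrite !mxE /=; ring.
Qed.

Lemma dotv_ge0 m (u : 'rV[R]_m) : 0 <= dotv u u.
Proof. by apply: sumr_ge0 => i _; rewrite -expr2 sqr_ge0. Qed.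

Lemma dotv_eq0 m (u : 'rV[R]_m) : dotv u u = 0 -> u = 0.
Proof.
move=> /eqP; rewrite psumr_eq0; last by move=> i _; rewrite -expr2 sqr_ge0.
move=> /allP h; apply/rowP => i; rewrite mxE.
by have := h i (mem_index_enum i); rewrite /= -expr2 sqrf_eq0 => /eqP.
Qed.

Lemma dotv_gt0 m (u : 'rV[R]_m) : u != 0 -> 0 < dotv u u.
Proof.
move=> u0; rewrite lt_neqAle dotv_ge0 andbT eq_sym.
by apply/eqP => /dotv_eq0 /eqP; apply/negP.
Qed.

Lemma Ck_det VV k (U : set VV) n (A : VV -> 'M[R]_n) : open U ->
  (forall i j, Ck k U (fun x => A x i j)) -> Ck k U (fun x => \det (A x)).
Proof.
move=> oU h; apply: Ck_sum => // s _; apply: CkM => //; first exact: Ck_cst.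
by apply: Ck_prod => // i _; exact: h.
Qed.

Lemma Ck_invmx VV k (U : set VV) n (A : VV -> 'M[R]_n) : open U ->
  (forall x, U x -> A x \in unitmx) ->
  (forall i j, Ck k U (fun x => A x i j)) ->
  forall i j, Ck k U (fun x => invmx (A x) i j).
Proof.
move=> oU uA h i j.
apply: (@Ck_eq _ _ _ _ _ (fun x => (\det (A x))^-1 * \adj (A x) i j)) => //.
  by move=> x /uA uAx; rewrite /invmx uAx [RHS]mxE.
apply: CkM => //.
  apply: CkV => //; last exact: Ck_det.
  by move=> x /uA; rewrite unitmxE unitfE.
rewrite (_ : (fun x => _) = fun x => (-1) ^+ (j + i) * \det (row' j (col' i (A x)))).
  apply: CkM => //; first exact: Ck_cst.
  apply: Ck_det => // i' j'.
  rewrite (_ : (fun x => _) = fun x => A x (lift j i') (lift i j')) //.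
  by apply/funext => x; rewrite !mxE.
by apply/funext => x; rewrite mxE.
Qed.

End SmoothCharts.

(** The coordinates of [nabla_a b] for constant fields: this plays the part of [G] in
    [normal_coords], and [dGamv] that of [dG]. *)
Definition Gamv (R : realType) (m d : nat) (phi : 'rV[R]_d -> 'rV[R]_m)
    (x a b : 'rV[R]_d) : 'rV[R]_d :=
  \row_k \sum_(i < d) \sum_(j < d) christoffel phi k i j x * a 0 i * b 0 j.

Definition dGamv (R : realType) (m d : nat) (phi : 'rV[R]_d -> 'rV[R]_m)
    (x c a b : 'rV[R]_d) : 'rV[R]_d :=
  \row_k \sum_(i < d) \sum_(j < d) 'D_c (christoffel phi k i j) x * a 0 i * b 0 j.

Section ChartGeometry.
Context {R : realType} {m d : nat} {V : set 'rV[R]_d} {phi : 'rV[R]_d -> 'rV[R]_m}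
  (oV : open V) (Cphi : forall k, Ck k V phi)
  (imm : forall x w, V x -> 'D_w phi x = 0 -> w = 0).
Implicit Types (x y a b c w : 'rV[R]_d).

Lemma chart_diff x : V x -> differentiable phi x.
Proof. by move=> Vx; apply: C1_differentiable_mx (Cphi 1) Vx. Qed.

Lemma metric_mxE x i j : metric_mx phi x i j = dotv (partial i phi x) (partial j phi x).
Proof. by rewrite [LHS]mxE. Qed.

Lemma metric_mxC x i j : metric_mx phi x i j = metric_mx phi x j i.
Proof. by rewrite [LHS]metric_mxE [RHS]metric_mxE; exact: dotvC. Qed.

Lemma metric_dot x a b : V x -> metric phi x a b = dotv ('D_a phi x) ('D_b phi x).
Proof.
move=> Vx; have dphi := chart_diff Vx.
rewrite (derive_sum_coord a dphi) (derive_sum_coord b dphi).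
transitivity (\sum_(i < d) \sum_(j < d) a 0 i * (b 0 j *
   dotv (partial i phi x) (partial j phi x))).
  by apply: eq_bigr => i _; apply: eq_bigr => j _; rewrite metric_mxE -mulrA mulrC -mulrA.
have lin2 u n (f : 'I_n -> 'rV[R]_m) (s : 'I_n -> R) :
    dotv (\sum_(i < n) s i *: f i) u = \sum_(i < n) s i * dotv (f i) u.
  elim/big_rec2 : _ => [|i y1 y2 _ <-]; last by rewrite dotv_lin.
  by rewrite /dotv big1 // => i _; rewrite mxE mul0r.
rewrite lin2; apply: eq_bigr => i _; rewrite dotvC lin2 mulr_sumr.
by apply: eq_bigr => j _; rewrite dotvC.
Qed.

Lemma metric_sym x a b : metric phi x a b = metric phi x b a.
Proof.
rewrite /metric exchange_big; apply: eq_bigr => i _; apply: eq_bigr => j _ /=.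
by rewrite metric_mxC mulrAC.
Qed.

Lemma metric_lin x s a b c : metric phi x (s *: a + b) c = s * metric phi x a c + metric phi x b c.
Proof.
rewrite /metric mulr_sumr -big_split; apply: eq_bigr => i _.
by rewrite mulr_sumr -big_split; apply: eq_bigr => j _ /=;
  rewrite [X in _ * X * _]mxE [X in _ * (X + _) * _]mxE; ring.
Qed.

Lemma metric_pos x a : V x -> a != 0 -> 0 < metric phi x a a.
Proof.
move=> Vx a0; rewrite metric_dot //; apply: dotv_gt0.
by apply/eqP => /(imm Vx)/eqP; apply/negP.
Qed.

Lemma metric_mx_unit x : V x -> metric_mx phi x \in unitmx.
Proof.
move=> Vx; rewrite -row_free_unit -kermx_eq0; apply/eqP/row_matrixP => i.
rewrite row0; set u := row i _.
have uA : u *m metric_mx phi x = 0.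
  by apply: sub_kermxP; rewrite /u row_sub.
apply/eqP/negPn/negP => u0; have := metric_pos Vx u0.
have -> : metric phi x u u = (u *m metric_mx phi x *m u^T) 0 0.
  rewrite [RHS]mxE /metric exchange_big; apply: eq_bigr => j _ /=.
  rewrite [X in _ = X * _]mxE [X in _ = _ * X]mxE mulr_suml; apply: eq_bigr => k _.
  by rewrite [metric_mx _ _ _ _ * _]mulrC.
by rewrite uA mul0mx mxE ltxx.
Qed.

Lemma Ck_metric_mx k i j : Ck k V (fun x => metric_mx phi x i j).
Proof.
rewrite (_ : (fun x => _) = fun x => \sum_(l < m) partial i phi x 0 l * partial j phi x 0 l).
  apply: Ck_sum => // l _; apply: CkM => //.
    by have /(Ck_coordP _ _ oV) := Ck_D (delta_mx 0 i) (Cphi k.+1); exact.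
  by have /(Ck_coordP _ _ oV) := Ck_D (delta_mx 0 j) (Cphi k.+1); exact.
by apply/funext => x; exact: metric_mxE.
Qed.

Lemma Ck_christoffel n k i j : Ck n V (christoffel phi k i j).
Proof.
apply: CkM => //; first exact: Ck_cst.
apply: Ck_sum => // l _; apply: CkM => //.
  apply: Ck_invmx => //; first exact: metric_mx_unit.
  by move=> *; exact: Ck_metric_mx.
apply: CkD => //; last first.
  by apply: CkN => //; apply: Ck_D; exact: (Ck_metric_mx n.+1).
by apply: CkD => //; apply: Ck_D; exact: (Ck_metric_mx n.+1).
Qed.

Lemma christoffelC x k i j : christoffel phi k i j x = christoffel phi k j i x.
Proof.
have E : (fun y => metric_mx phi y i j) = (fun y => metric_mx phi y j i).
  by apply/funext => y; exact: metric_mxC.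
rewrite /christoffel E; congr (_ * _); apply: eq_bigr => l _.
by rewrite [partial i _ x + _]addrC.
Qed.

Lemma Gamv_sym x a b : Gamv phi x a b = Gamv phi x b a.
Proof.
apply/rowP => k; rewrite !mxE exchange_big; apply: eq_bigr => i _.
by apply: eq_bigr => j _ /=; rewrite christoffelC mulrAC.
Qed.

Lemma Gamv_lin x s a b c : Gamv phi x (s *: a + b) c = s *: Gamv phi x a c + Gamv phi x b c.
Proof.
apply/rowP => k; rewrite !mxE mulr_sumr -big_split; apply: eq_bigr => i _.
by rewrite mulr_sumr -big_split; apply: eq_bigr => j _ /=;
  rewrite [X in _ * X * _]mxE [X in _ * (X + _) * _]mxE; ring.
Qed.

Lemma Gamv_deriv x c a b : V x ->
  is_derive x c (fun y => Gamv phi y a b) (dGamv phi x c a b).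
Proof.
move=> Vx; apply: is_derive_rV => k.
rewrite (_ : (fun y => _) = fun y => \sum_(i < d) \sum_(j < d)
    christoffel phi k i j y * (a 0 i * b 0 j)); last first.
  apply/funext => y; rewrite mxE; apply: eq_bigr => i _.
  by apply: eq_bigr => j _; rewrite mulrA.
rewrite mxE.
apply: is_derive_fS => i; apply: is_derive_fS => j.
have dC := derivableP (Ck_derivable (Ck_christoffel 1 k i j) Vx : derivable _ _ c).
apply: (is_derive_eq (is_derive_fM dC (is_derive_fcst (a 0 i * b 0 j) x c))).
by rewrite mulr0 add0r; ring.
Qed.

(** Lowering the index cancels the inverse metric matrix and leaves the Christoffel symbols of the
    first kind. *)
Lemma metric_Gam x a b c : V x -> metric phi x (Gamv phi x c a) b =
  \sum_(i < d) \sum_(j < d) \sum_(q < d) c 0 i * a 0 j * b 0 q * (2^-1 *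
   (partial i (fun y => metric_mx phi y j q) x
    + partial j (fun y => metric_mx phi y i q) x
    - partial q (fun y => metric_mx phi y i j) x)).
Proof.
move=> Vx; pose X i j (l : 'I_d) : R := partial i (fun y => metric_mx phi y j l) x
    + partial j (fun y => metric_mx phi y i l) x
    - partial l (fun y => metric_mx phi y i j) x.
have low q i j : \sum_(k < d) metric_mx phi x k q * christoffel phi k i j x = 2^-1 * X i j q.
  have /(congr1 (fun A : 'cV[R]_d => A q 0)) := mulKVmx (metric_mx_unit Vx) (\col_l X i j l).
  rewrite [RHS]mxE mxE => <-; rewrite mulr_sumr; apply: eq_bigr => k _.
  rewrite [metric_mx phi x k q]metric_mxC [RHS]mulrCA; congr (_ * _).
  rewrite [X in _ = _ * X]mxE; congr (_ * _); apply: eq_bigr => l _.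
  by rewrite [X in _ = _ * X]mxE.
transitivity (\sum_(q < d) \sum_(i < d) \sum_(j < d) c 0 i * a 0 j * b 0 q *
    \sum_(k < d) metric_mx phi x k q * christoffel phi k i j x).
  rewrite /metric exchange_big; apply: eq_bigr => q _ /=.
  transitivity (\sum_(k < d) \sum_(i < d) \sum_(j < d) c 0 i * a 0 j * b 0 q *
     (metric_mx phi x k q * christoffel phi k i j x)).
    apply: eq_bigr => k _; rewrite [Gamv _ _ _ _ _ _]mxE.
    rewrite mulr_sumr mulr_suml; apply: eq_bigr => i _.
    by rewrite mulr_sumr mulr_suml; apply: eq_bigr => j _; ring.
  rewrite exchange_big; apply: eq_bigr => i _ /=.
  by rewrite exchange_big; apply: eq_bigr => j _ /=; rewrite mulr_sumr.
rewrite exchange_big; apply: eq_bigr => i _ /=; rewrite exchange_big.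
by apply: eq_bigr => j _ /=; apply: eq_bigr => q _; rewrite low.
Qed.

(** Metric compatibility: of the six partial derivatives in the two first-kind symbols, the two
    copies of [P i j q] add up and the other four cancel. *)
Lemma metric_deriv x c a b : V x -> is_derive x c (fun y => metric phi y a b)
  (metric phi x (Gamv phi x c a) b + metric phi x a (Gamv phi x c b)).
Proof.
move=> Vx; pose P i j l : R := partial i (fun y => metric_mx phi y j l) x.
have PC i j l : P i j l = P i l j.
  by congr (partial _ _ _); apply/funext => y; exact: metric_mxC.
have D1 : is_derive x c (fun y => metric phi y a b)
   (\sum_(j < d) \sum_(q < d) (\sum_(i < d) c 0 i * P i j q) * (a 0 j * b 0 q)).
  rewrite (_ : (fun y => _) = fun y => \sum_(j < d) \sum_(q < d)
     metric_mx phi y j q * (a 0 j * b 0 q)); last first.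
    by apply/funext => y; apply: eq_bigr => j _; apply: eq_bigr => q _; rewrite mulrA.
  apply: is_derive_fS => j; apply: is_derive_fS => q.
  have dC := derivableP (Ck_derivable (Ck_metric_mx 1 j q) Vx : derivable _ _ c).
  apply: (is_derive_eq (is_derive_fM dC (is_derive_fcst (a 0 j * b 0 q) x c))).
  rewrite mulr0 add0r mulrC; congr (_ * _).
  by rewrite (derive_sum_coord c (C1_differentiable oV (Ck_metric_mx 1 j q) Vx)).
apply: (is_derive_eq D1); rewrite (metric_sym x a) !metric_Gam //.
transitivity (\sum_(i < d) \sum_(j < d) \sum_(q < d) c 0 i * a 0 j * b 0 q * P i j q).
  rewrite [RHS]exchange_big; apply: eq_bigr => j _; rewrite [RHS]exchange_big.
  apply: eq_bigr => q _; rewrite mulr_suml; apply: eq_bigr => i _ /=; ring.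
rewrite -big_split; apply: eq_bigr => i _.
rewrite /= [X in _ = _ + X]exchange_big -big_split; apply: eq_bigr => j _.
rewrite /= -big_split; apply: eq_bigr => q _ /=.
rewrite -!/(P _ _ _) (PC i q j) (PC q i j) (PC j i q).
move: (P i j q) (P j q i) (P q j i) (c 0 i) (a 0 j) (b 0 q) => p1 p2 p3 c1 a1 b1.
by field.
Qed.

Lemma curvature_opE x a b c : V x ->
  curvature_op phi x a b c = riem_op (Gamv phi) (dGamv phi) x a b c.
Proof.
move=> Vx; apply/rowP => l; rewrite !mxE.
have dG a' b' c' : \sum_(j < d) \sum_(k < d) 'D_a' (christoffel phi l j k) x * b' 0 j * c' 0 k =
   \sum_(i < d) \sum_(j < d) \sum_(k < d) partial i (christoffel phi l j k) x * a' 0 i * b' 0 j * c' 0 k.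
  rewrite [RHS]exchange_big; apply: eq_bigr => j _; rewrite [RHS]exchange_big.
  apply: eq_bigr => k _ /=.
  rewrite (derive_sum_coord a' (C1_differentiable oV (Ck_christoffel 1 l j k) Vx)).
  rewrite !mulr_suml; apply: eq_bigr => i _; rewrite /GRing.scale /=.
  by rewrite [X in X * _ * _]mulrC.
have GG a' b' c' : \sum_(i < d) \sum_(s < d) christoffel phi l i s x * a' 0 i * (Gamv phi x b' c') 0 s =
   \sum_(i < d) \sum_(j < d) \sum_(k < d) (\sum_(s < d) christoffel phi s j k x * christoffel phi l i s x)
     * a' 0 i * b' 0 j * c' 0 k.
  apply: eq_bigr => i _.
  transitivity (\sum_(s < d) \sum_(j < d) \sum_(k < d) christoffel phi s j k x * christoffel phi l i s x
     * a' 0 i * b' 0 j * c' 0 k).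
    apply: eq_bigr => s _; rewrite mxE mulr_sumr; apply: eq_bigr => j _.
    by rewrite mulr_sumr; apply: eq_bigr => k _; ring.
  rewrite exchange_big; apply: eq_bigr => j _ /=; rewrite exchange_big.
  by apply: eq_bigr => k _ /=; rewrite !mulr_suml.
rewrite !dG !GG.
rewrite [X in _ = _ - X + _ - _]exchange_big [X in _ = _ - X]exchange_big /=.
rewrite -sumrB -big_split -sumrB; apply: eq_bigr => i _ /=.
rewrite -sumrB -big_split -sumrB; apply: eq_bigr => j _ /=.
rewrite -sumrB -big_split -sumrB; apply: eq_bigr => k _ /=.
rewrite /riemann sumrB.
move: (partial i (christoffel phi l j k) x) (partial j (christoffel phi l i k) x)
  (\sum_(s < d) christoffel phi s j k x * christoffel phi l i s x)
  (\sum_(s < d) christoffel phi s i k x * christoffel phi l j s x)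
  (a 0 i) (b 0 j) (c 0 k) => p1 p2 s1 s2 a1 b1 c1; ring.
Qed.

End ChartGeometry.

(** * Submanifolds and their parametrizations *)

Section Submanifold.
Context {R : realType}.
Implicit Types VV W : normedModType R.

Lemma open_preimage_on (T S : topologicalType) (A : set T) (B : set S) (f : T -> S) :
  open A -> open B -> (forall x, A x -> {for x, continuous f}) ->
  open (A `&` f @^-1` B).
Proof.
move=> oA oB cf; rewrite openE => x [Ax Bfx]; rewrite /interior; near=> y; split.
  by near: y; exact: open_nbhs_nbhs.
by near: y; apply: (cf _ Ax); exact: open_nbhs_nbhs.
Unshelve. all: by end_near. Qed.

Lemma CkZ VV W k (U : set VV) (a : R) (f : VV -> W) : open U ->
  Ck k U f -> Ck k U (fun x => a *: f x).
Proof.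
move=> oU; elim: k f => [|k IH] f Cf.
  by split=> // x Ux; apply: continuous_comp; [exact: (Ck_cont Cf)|exact: scaler_continuous].
split=> [x Ux|v]; first by apply: continuous_comp; [exact: (Ck_cont Cf)|exact: scaler_continuous].
split=> [x Ux|]; first by apply: derivableZ; exact: Ck_derivable Cf Ux.
apply: Ck_eq (IH _ (Ck_D v Cf)) => // x Ux.
by rewrite deriveZ //; exact: Ck_derivable Cf Ux.
Qed.

Lemma Ck_id VV k (U : set VV) : open U -> Ck k U (fun x : VV => x).
Proof.
move=> oU; case: k => [|k]; first by split=> // x _; exact: cvg_id.
split=> [x _|v]; first exact: cvg_id.
split=> [x _|]; first exact: derivable_id.
apply: (@Ck_eq _ _ _ _ _ (fun=> v)) => //; last exact: Ck_cst.
by move=> x _; rewrite derive_id.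
Qed.

Lemma CkR W k (U : set R) (f : R -> W) : open U ->
  (forall x, U x -> derivable f x 1) -> Ck k U ('D_1 f) -> Ck k.+1 U f.
Proof.
move=> oU df CD; split=> [x Ux|v].
  by apply/differentiable_continuous/derivable1_diffP; exact: df.
have dv x : U x -> is_derive x v f (v *: 'D_1 f x).
  move=> /df dx; have := is_derive_scalev v dx.
  by rewrite (_ : v *: (1 : R) = v) // [LHS]mulr1.
split=> [x /dv []//|].
apply: Ck_eq (CkZ v oU CD) => // x /dv dx.
by have [_ ->] := dx.
Qed.

Lemma Ck_rescale W k (U U' : set R) (s : R) (f : R -> W) : open U -> open U' ->
  (forall t, U t -> U' (s * t)) -> Ck k U' f -> Ck k U (fun t => f (s * t)).
Proof.
move=> oU oU' UU'; have cs t : {for t, continuous (fun t => s * t)}.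
  by apply: cvgM; [exact: cvg_cst|exact: cvg_id].
elim: k f => [|k IH] f Cf.
  split=> // x Ux; apply: continuous_comp; first exact: cs.
  by apply: Ck_cont Cf _; exact: UU'.
have dfs t : U t -> is_derive t 1 (fun t => f (s * t)) (s *: 'D_1 f (s * t)).
  move=> /UU' Ut; apply: (@is_derive_compR _ _ (fun t => s * t)).
    apply: (is_derive_eq (is_derive_fM (is_derive_fcst s t 1) (is_derive_idR t))).
    by rewrite mulr0 addr0 mulr1.
  by apply: derivableP; exact: Ck_derivable Cf Ut.
apply: CkR => // [x /dfs []//|].
apply: (@Ck_eq _ _ _ _ _ (fun t => s *: 'D_1 f (s * t))) => //.
  by move=> x /dfs [_ ->].
apply: CkZ => //; apply: (IH ('D_1 f)); exact: Ck_D Cf.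
Qed.

Lemma Ck_line n k (U : set R) (x w : 'rV[R]_n) : open U -> Ck k U (fun t : R => x + t *: w).
Proof.
move=> oU; apply/(Ck_coordP _ _ oU) => i j.
rewrite (_ : (fun t : R => _) = fun t => x i j + t * w i j); last by apply/funext => t; rewrite !mxE.
apply: CkD => //; first exact: Ck_cst.
by apply: CkM => //; [exact: Ck_id|exact: Ck_cst].
Qed.

Lemma Ck_smooth_on VV W (U : set VV) (f : VV -> W) : open U ->
  (forall k, Ck k U f) -> smooth_on U f.
Proof. by move=> oU Cf x Ux; exists U, f. Qed.

(** A derivative is determined by the values to the right of the point. No more is available when a
    geodesic is known to agree with the exponential map only on [[0, 1]]. *)
Lemma is_derive_right_uniq W (f h : R -> W) (t e : R) D D' : 0 < e ->
  is_derive t 1 f D -> is_derive t 1 h D' ->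
  (forall s, t <= s < t + e -> f s = h s) -> D = D'.
Proof.
move=> e0 [df <-] [dh <-] fh; rewrite /derive.
rewrite (cvg_at_rightE _ _ df) (cvg_at_rightE _ _ dh); congr (lim _).
have tt : t <= t < t + e by rewrite lexx ltrDl.
have hn : \forall s \near 0^'+, f (s%:A + t) = h (s%:A + t).
  near=> s; apply: fh; rewrite [s%:A]mulr1.
  have s0 : 0 < s by near: s; exact: nbhs_right_gt.
  by rewrite lerDr ltW //= addrC ltrD2l; near: s; exact: nbhs_right_lt.
rewrite eqEsubset; split; apply: near_eq_cvg; near=> s => /=.
  by rewrite (fh _ tt) (near hn s).
by rewrite (fh _ tt) (near hn s).
Unshelve. all: by end_near. Qed.

Lemma open_itvoo (a b : R) : open `]a, b[%classic.
Proof. exact: interval_open. Qed.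

Section LocalParam.
Context {m d : nat} {M : set 'rV[R]_m} {V : set 'rV[R]_d} {U : set 'rV[R]_m}
  {phi : 'rV[R]_d -> 'rV[R]_m} {psi : 'rV[R]_m -> 'rV[R]_d}
  (lp : local_param M V U phi psi).

Lemma lp_open : open V. Proof. by case: lp. Qed.
Lemma lp_Ck k : Ck k V phi.
Proof. by case: lp => oV oU [s1 s2 _ _]; exact: smooth_on_Ck. Qed.
Lemma lp_in x : V x -> M (phi x) /\ U (phi x).
Proof. by case: lp => oV oU [s1 s2 h _] /h [[]]. Qed.
Lemma lp_K x : V x -> psi (phi x) = x.
Proof. by case: lp => oV oU [s1 s2 h _] /h []. Qed.
Lemma lp_inV y : M y -> U y -> V (psi y).
Proof. by case: lp => oV oU [s1 s2 _ h] My Uy; have [] := h y (conj My Uy). Qed.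
Lemma lp_KV y : M y -> U y -> phi (psi y) = y.
Proof. by case: lp => oV oU [s1 s2 _ h] My Uy; have [] := h y (conj My Uy). Qed.

Lemma lp_ext y : M y -> U y -> exists U' Psi, [/\ open U', U' y, U' `<=` U,
  forall k, Ck k U' Psi & forall z, M z -> U' z -> Psi z = psi z].
Proof.
case: lp => oV oU [s1 s2 _ h] My Uy; have [U' [Psi [oU' U'y C E]]] := s2 y (conj My Uy).
exists (U `&` U'), Psi; split => //; first exact: openI.
- by move=> k; apply: Ck_sub (C k) => z [].
- by move=> z Mz [Uz U'z]; exact: E.
Qed.

(** [psi] is smooth only on a subset of [M], so a smooth extension [Psi] is differentiated:
    [Psi \o phi] is the identity near [x], and the chain rule gives a left inverse of the
    differential of [phi]. *)
Lemma lp_retr x : V x -> exists A : 'M[R]_(m, d), forall w, 'D_w phi x *m A = w.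
Proof.
move=> Vx; have [Mx Ux] := lp_in Vx.
have [U' [Psi [oU' U'x sU C E]]] := lp_ext Mx Ux.
have dPsi : differentiable Psi (phi x) by apply: C1_differentiable_mx (C 1) U'x.
exists (jacobian Psi (phi x)) => w; rewrite -deriveEjacobian //.
have h1 : is_derive x w (Psi \o phi) ('D_('D_w phi x) Psi (phi x)).
  by apply: is_derive_comp => //; exact: Ck_derivable (lp_Ck 1) Vx.
have oN : open (V `&` phi @^-1` U').
  apply: open_preimage_on => //; first exact: lp_open.
  by move=> z Vz; exact: Ck_cont (lp_Ck 0) Vz.
have h2 : is_derive x w (fun y : 'rV[R]_d => y) ('D_('D_w phi x) Psi (phi x)).
  apply: (is_derive_near oN _ _ h1); first by split.
  by move=> y [Vy U'y] /=; rewrite E ?lp_K //; case: (lp_in Vy).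
exact: is_derive_uniq h2 (is_derive_id x w).
Qed.

Lemma lp_imm x w : V x -> 'D_w phi x = 0 -> w = 0.
Proof. by move=> /lp_retr [A hA] w0; rewrite -(hA w) w0 mul0mx. Qed.

(** Near [t] the map [psi \o c] coincides with a smooth extension of [psi] composed with [c],
    because [c] stays in [M]. *)
Lemma lp_curve (c : R -> 'rV[R]_m) (a b t : R) :
  smooth_on `]a, b[%classic c -> (forall t, t \in `]a, b[ -> M (c t)) ->
  t \in `]a, b[ -> U (c t) ->
  exists N : set R, [/\ open N, N t, N `<=` `]a, b[%classic,
    forall s, N s -> M (c s) /\ U (c s) & forall k, Ck k N (psi \o c)].
Proof.
move=> sc Mc tab Ut; have oI := @open_itvoo a b.
have Cc k : Ck k `]a, b[%classic c by exact: smooth_on_Ck.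
have [U' [Psi [oU' U't sU C E]]] := lp_ext (Mc _ tab) Ut.
exists (`]a, b[%classic `&` c @^-1` U').
have oO : open (`]a, b[%classic `&` c @^-1` U').
  by apply: open_preimage_on => // x xab; exact: Ck_cont (Cc 0) xab.
split => //.
- by move=> s [sab U's]; split; [exact: Mc|exact: sU].
move=> k; apply: (@Ck_eq _ _ _ _ _ (Psi \o c)) => //.
  by move=> s [sab U's] /=; apply: E => //; exact: Mc.
apply: (@Ck_comp_mx _ _ _ _ _ _ _ U') => //.
  by move=> s [].
by apply: Ck_sub (Cc k) => s [].
Qed.

Lemma lp_curve_deriv (c : R -> 'rV[R]_m) (O : set R) t :
  open O -> O t -> (forall s, O s -> M (c s) /\ U (c s)) ->
  Ck 1 O (psi \o c) ->
  is_derive t 1 c ('D_('D_1 (psi \o c) t) phi (psi (c t))).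
Proof.
move=> oO Ot OMU Cu; have [Mt Ut] := OMU _ Ot; have Vt := lp_inV Mt Ut.
have h1 : is_derive t 1 (phi \o (psi \o c)) ('D_('D_1 (psi \o c) t) phi (psi (c t))).
  apply: is_derive_comp; first exact: Ck_derivable Cu Ot.
  by apply: C1_differentiable_mx (lp_Ck 1) Vt; exact: lp_open.
apply: (is_derive_near oO Ot _ h1) => s Os /=.
by have [Ms Us] := OMU _ Os; rewrite lp_KV.
Qed.

Lemma lp_tangent_sub x v : V x -> tangent M (phi x) v -> exists w, v = 'D_w phi x.
Proof.
move=> Vx [e [c [e0 sc Mc c0 <-]]].
have t0 : (0 : R) \in `]- e, e[ by rewrite in_itv /= oppr_lt0 e0.
have U0 : U (c 0) by rewrite c0; case: (lp_in Vx).
have [N [oN N0 _ NMU Cu]] := lp_curve sc Mc t0 U0.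
have [_] := lp_curve_deriv oN N0 NMU (Cu 1).
by rewrite derive1E c0 lp_K // => ->; eexists.
Qed.

Lemma lp_tangent x w : V x -> tangent M (phi x) ('D_w phi x).
Proof.
move=> Vx; have oV := lp_open.
pose l (t : R) := x + t *: w.
have l0 : l 0 = x by rewrite /l scale0r addr0.
have oN : open ([set: R] `&` l @^-1` V).
  exact: (open_preimage_on openT oV (fun t h => Ck_cont (Ck_line 0 x w openT) h)).
have N0 : ([set: R] `&` l @^-1` V) 0 by split=> //=; rewrite l0.
have [e /= e0 he] : exists2 e : R, 0 < e & ball (0 : R) e `<=` l @^-1` V.
  have /nbhs_ballP[e /= e0 he] := open_nbhs_nbhs (conj oN N0).
  by exists e => // t /he [].
have hl t : t \in `]- e, e[ -> V (l t).
  rewrite in_itv /= => te; apply: he.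
  by rewrite /ball /= sub0r normrN ltr_norml.
exists e, (phi \o l); split => //=.
- have oI := @open_itvoo (- e) e; apply: Ck_smooth_on => // k.
  exact: (Ck_comp_mx oI oV hl (Ck_line k x w oI) (lp_Ck k)).
- by move=> t /hl /lp_in [].
- by rewrite l0.
rewrite derive1E; have [_ ->] : is_derive (0 : R) 1 (phi \o l) ('D_w phi x).
  apply/(is_derive_lineP phi); rewrite scale0r addr0.
  by apply: derivableP; exact: Ck_derivable (lp_Ck 1) Vx.
by [].
Qed.

End LocalParam.

End Submanifold.

(** * Uniqueness of geodesics and the exponential map *)

Section GeodesicUniqueness.
Context {R : realType}.

Lemma Ck_D1 (W : normedModType R) k (U : set R) (f : R -> W) :
  Ck k.+1 U f -> Ck k U ('D_(1 : R) f).
Proof. exact: Ck_D. Qed.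

Lemma continuous_norm_near (T : topologicalType) (W : normedModType R) (f : T -> W) t :
  {for t, continuous f} -> \forall s \near t, `|f s| <= `|f t| + 1.
Proof.
move=> /cvgrPdist_le/(_ _ ltr01); apply: filterS => s; rewrite distrC => h.
by rewrite -[f s](subrK (f t)); apply: le_trans (ler_normD _ _) _; rewrite addrC lerD.
Qed.

Lemma normNB (W : normedModType R) (a b : W) : `|- a - - b| = `|a - b|.
Proof. by rewrite -opprD normrN. Qed.

Lemma norm_rV_le n (v : 'rV[R]_n) (B : R) : 0 <= B ->
  (forall i, `|v 0 i| <= B) -> `|v| <= B.
Proof.
move=> B0 h; rewrite [leLHS]/Num.Def.normr/= mx_normrE.
by apply: bigmax_le => // -[i j] _ /=; rewrite ord1.
Qed.

Lemma mvt_abs (f f' : R -> R) (t0 eta B s : R) :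
  (forall x, `|x - t0| <= eta -> is_derive x 1 f (f' x)) ->
  (forall x, `|x - t0| <= eta -> `|f' x| <= B) ->
  `|s - t0| <= eta -> `|f s - f t0| <= B * eta.
Proof.
move=> df hB hs; have eta0 : 0 <= eta by apply: le_trans hs.
have B0 : 0 <= B by apply: le_trans (hB t0 _) => //; rewrite subrr normr0.
have [ts|st] := leP t0 s.
  have [x tx|c cx ->] := mvt_ab ts (df := f') (f := f).
    apply: df; move: tx => /andP[tx xs]; rewrite ger0_norm ?subr_ge0 //.
    by apply: le_trans hs; rewrite ger0_norm ?subr_ge0 // lerD2r.
  rewrite normrM ler_pM // hB //; move: cx => /andP[tx xs].
  by rewrite ger0_norm ?subr_ge0 //; apply: le_trans hs; rewrite ger0_norm ?subr_ge0 // lerD2r.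
have [x tx|c cx E] := mvt_ab (ltW st) (df := f') (f := f).
  apply: df; move: tx => /andP[sx xt]; rewrite distrC ger0_norm ?subr_ge0 //.
  have /(le_trans _) : t0 - s <= eta by move: hs; rewrite distrC ger0_norm // subr_ge0 ltW.
  by apply; rewrite lerD2l lerN2.
rewrite distrC E normrM ler_pM //; last by rewrite distrC.
apply: hB; move: cx => /andP[sx xt]; rewrite distrC ger0_norm ?subr_ge0 //.
have /(le_trans _) : t0 - s <= eta by move: hs; rewrite distrC ger0_norm // subr_ge0 ltW.
  by apply; rewrite lerD2l lerN2.
Qed.

(** The radius is quantified by [\near], so that finitely many functions, here the Christoffel
    symbols, can share one. *)
Lemma C1_lip n (V : set 'rV[R]_n) (f : 'rV[R]_n -> R) x0 : open V -> Ck 1 V f -> V x0 ->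
  exists B : R, 0 <= B /\ \forall e \near (0 : R)^'+, forall x y,
    ball x0 e x -> ball x0 e y -> `|f x - f y| <= B * `|x - y| /\ `|f x| <= B.
Proof.
move=> oV Cf Vx0.
pose B0 := \sum_(i < n) `|'D_(delta_mx 0 i) f x0|.
have B00 : 0 <= B0 by apply: sumr_ge0.
have Bi i : `|'D_(delta_mx 0 i) f x0| <= B0.
  by rewrite /B0 (bigD1 i) //= lerDl sumr_ge0.
pose B := n%:R * (B0 + 1) + `|f x0| + 1.
exists B; have BB : n%:R * (B0 + 1) <= B by rewrite /B -addrA lerDl addr_ge0.
split; first by rewrite /B !addr_ge0 // mulr_ge0 // addr_ge0.
have : \forall y \near x0, V y /\ (forall i, `|'D_(delta_mx 0 i) f y| <= B0 + 1) /\ `|f y| <= B.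
  near=> y; split; first by near: y; exact: open_nbhs_nbhs.
  split.
    near: y; apply: filter_forall => i.
    have /cvgrPdist_le/(_ _ ltr01) := Ck_cont (Ck_D (delta_mx 0 i) Cf) Vx0.
    apply: filterS => y; rewrite distrC => h.
    rewrite -['D_(delta_mx 0 i) f y](subrK ('D_(delta_mx 0 i) f x0)).
    by apply: le_trans (ler_normD _ _) _; rewrite addrC lerD.
  near: y; have /cvgrPdist_le/(_ _ ltr01) := Ck_cont Cf Vx0.
  apply: filterS => y; rewrite distrC => h; rewrite -[f y](subrK (f x0)).
  apply: le_trans (ler_normD _ _) _; rewrite /B -addrA; apply: ler_wpDl.
    by rewrite mulr_ge0 // addr_ge0.
  by rewrite addrC lerD.
move=> /nbhs_ballP[d /= d0 hd]; near=> e.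
have ed : e <= d by near: e; apply: nbhs_right_le.
have hb z : ball x0 e z -> ball x0 d z by exact: le_ball.
move=> x y xb yb; split; last by have [_ []] := hd _ (hb _ xb).
have conv (s : R) : 0 <= s <= 1 -> ball x0 e (y + s *: (x - y)).
  move=> /andP[s0 s1]; move: xb yb; rewrite -!ball_normE /= => xb yb.
  have -> : x0 - (y + s *: (x - y)) = s *: (x0 - x) + (1 - s) *: (x0 - y).
    by apply/rowP => i; rewrite !mxE; ring.
  apply: le_lt_trans (ler_normD _ _) _; rewrite !normrZ (ger0_norm s0).
  rewrite ger0_norm ?subr_ge0 //.
  have [->|s1'] := eqVneq s 1; first by rewrite subrr mul0r addr0 mul1r.
  have s1'' : 0 < 1 - s by rewrite subr_gt0 lt_neqAle s1'.
  have h1 : s * `|x0 - x| <= s * e by rewrite ler_wpM2l // ltW.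
  have h2 : (1 - s) * `|x0 - y| < (1 - s) * e by rewrite ltr_pM2l.
  by apply: lt_le_trans (ler_ltD h1 h2) _; rewrite -mulrDl addrC subrK mul1r.
have [|xi xi01 E] := @mvt_line _ _ f y (x - y).
  by move=> s /conv /hb /hd [Vs _]; exact: Ck_derivable Cf Vs.
have yx : y + (x - y) = x by rewrite addrC subrK.
move: E; rewrite yx => ->; have [Vz [hz _]] := hd _ (hb _ (conv _ xi01)).
rewrite (derive_sum_coord _ (C1_differentiable oV Cf Vz)).
apply: le_trans (ler_norm_sum _ _ _) _.
apply: (@le_trans _ _ (\sum_(i < n) (B0 + 1) * `|x - y|)).
  by apply: ler_sum => i _; rewrite normrM mulrC ler_pM // le_coord_norm.
rewrite sumr_const card_ord -mulr_natl mulrA ler_wpM2r //.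
Unshelve. all: by end_near. Qed.

Lemma Gamv_lip m d (V : set 'rV[R]_d) (phi : 'rV[R]_d -> 'rV[R]_m) x0 (P : R) :
  open V -> (forall k, Ck k V phi) ->
  (forall x w, V x -> 'D_w phi x = 0 -> w = 0) -> V x0 -> 0 <= P ->
  exists C e : R, [/\ 0 <= C, 0 < e & forall x1 x2 p1 p2,
    ball x0 e x1 -> ball x0 e x2 -> `|p1| <= P -> `|p2| <= P ->
    `|Gamv phi x1 p1 p1 - Gamv phi x2 p2 p2| <= C * Num.max `|x1 - x2| `|p1 - p2|].
Proof.
move=> oV Cphi imm Vx0 P0.
have lip (kij : 'I_d * ('I_d * 'I_d)) :=
  C1_lip oV (Ck_christoffel oV Cphi imm 1 kij.1 kij.2.1 kij.2.2) Vx0.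
have [Bf hB] := choice lip.
pose B := \sum_kij Bf kij.
have Bi kij : Bf kij <= B.
  rewrite /B (bigD1 kij) //= lerDl; apply: sumr_ge0 => i _; by have [] := hB i.
have B0 : 0 <= B by apply: sumr_ge0 => i _; have [] := hB i.
have : \forall e \near (0 : R)^'+, forall kij : 'I_d * ('I_d * 'I_d), forall x y,
    ball x0 e x -> ball x0 e y ->
    `|christoffel phi kij.1 kij.2.1 kij.2.2 x - christoffel phi kij.1 kij.2.1 kij.2.2 y|
      <= Bf kij * `|x - y| /\ `|christoffel phi kij.1 kij.2.1 kij.2.2 x| <= Bf kij.
  apply: (@filter_forall _ _ (fun (kij : 'I_d * ('I_d * 'I_d)) e => forall x y,
    ball x0 e x -> ball x0 e y ->
    `|christoffel phi kij.1 kij.2.1 kij.2.2 x - christoffel phi kij.1 kij.2.1 kij.2.2 y|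
      <= Bf kij * `|x - y| /\ `|christoffel phi kij.1 kij.2.1 kij.2.2 x| <= Bf kij) ((0 : R)^'+)) => kij.
  by have [] := hB kij.
move=> hnear; pose C := (d * d)%:R * (B * (P * P + P + P)).
have [e [e0 he]] : exists e : R, 0 < e /\ forall kij : 'I_d * ('I_d * 'I_d), forall x y,
    ball x0 e x -> ball x0 e y ->
    `|christoffel phi kij.1 kij.2.1 kij.2.2 x - christoffel phi kij.1 kij.2.1 kij.2.2 y|
      <= Bf kij * `|x - y| /\ `|christoffel phi kij.1 kij.2.1 kij.2.2 x| <= Bf kij.
  have /filter_ex [e he] : \forall e \near (0 : R)^'+, 0 < e /\ forall kij : 'I_d * ('I_d * 'I_d), forall x y,
    ball x0 e x -> ball x0 e y ->
    `|christoffel phi kij.1 kij.2.1 kij.2.2 x - christoffel phi kij.1 kij.2.1 kij.2.2 y|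
      <= Bf kij * `|x - y| /\ `|christoffel phi kij.1 kij.2.1 kij.2.2 x| <= Bf kij.
    by near=> e; split; [near: e; exact: nbhs_right_gt|near: e].
  by exists e.
exists C, e; split => //.
  by rewrite /C !mulr_ge0 // !addr_ge0 // mulr_ge0.
move=> x1 x2 p1 p2 b1 b2 h1 h2; set D := Num.max _ _.
have D0 : 0 <= D by rewrite /D le_max normr_ge0.
have Dx : `|x1 - x2| <= D by rewrite /D le_max lexx.
have Dp i : `|p1 0 i - p2 0 i| <= D.
  rewrite /D le_max; apply/orP; right; have := le_coord_norm (p1 - p2) i.
  by rewrite !mxE.
apply: norm_rV_le => [|k].
  by rewrite /C !mulr_ge0 // !addr_ge0 // mulr_ge0.
rewrite !mxE -sumrB; apply: le_trans (ler_norm_sum _ _ _) _.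
rewrite /C natrM -2!mulrA mulr_natl -[X in _ *+ X](card_ord d) -sumr_const.
apply: ler_sum => i _; rewrite -sumrB; apply: le_trans (ler_norm_sum _ _ _) _.
rewrite mulr_natl -[X in _ *+ X](card_ord d) -sumr_const.
apply: ler_sum => j _.
have [g1 g2] := he (k, (i, j)) x1 x2 b1 b2; rewrite /= in g1 g2.
have [_ g3] := he (k, (i, j)) x2 x1 b2 b1; rewrite /= in g3.
have [q1 q2 q3 q4] : [/\ `|p1 0 i| <= P, `|p1 0 j| <= P, `|p2 0 i| <= P & `|p2 0 j| <= P].
  by split; (apply: le_trans (le_coord_norm _ _) _).
move: (christoffel phi k i j x1) (christoffel phi k i j x2) g1 g2 g3 => ga gb g1 g2 g3.
have -> : ga * p1 0 i * p1 0 j - gb * p2 0 i * p2 0 j =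
  (ga - gb) * (p1 0 i * p1 0 j) + gb * ((p1 0 i - p2 0 i) * p1 0 j)
   + gb * (p2 0 i * (p1 0 j - p2 0 j)) by ring.
apply: le_trans (ler_normD _ _) _; apply: le_trans (lerD (ler_normD _ _) (lexx _)) _.
rewrite !normrM !mulrDr mulrDl.
have Bk := Bi (k, (i, j)).
have G1 : `|ga - gb| <= B * D.
  by apply: le_trans g1 _; apply: ler_pM => //; have [] := hB (k, (i, j)).
have G3 : `|gb| <= B by exact: le_trans g3 Bk.
have PP : `|p1 0 i| * `|p1 0 j| <= P * P by apply: ler_pM.
rewrite mulrDl; apply: lerD; first apply: lerD.
- by rewrite mulrAC; apply: ler_pM => //; rewrite mulr_ge0.
- rewrite -[B * P * D]mulrA [P * D]mulrC; apply: ler_pM; rewrite ?mulr_ge0 //.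
  by apply: ler_pM.
- rewrite -[B * P * D]mulrA; apply: ler_pM; rewrite ?mulr_ge0 //.
  by apply: ler_pM.
Unshelve. all: by end_near. Qed.

(** In place of a Gronwall estimate: where the gap [N] is largest on [[t0 - eta, t0 + eta]], the
    mean value theorem bounds it by [eta * (C + 1)], at most one half, times itself. *)
Lemma ode2_uniq_local d (u1 u2 p1 p2 f1 f2 : R -> 'rV[R]_d) (t0 r C : R) :
  0 < r -> 0 <= C ->
  (forall s, ball t0 r s -> [/\ is_derive s 1 u1 (p1 s), is_derive s 1 u2 (p2 s),
     is_derive s 1 p1 (f1 s) & is_derive s 1 p2 (f2 s)]) ->
  (forall s, ball t0 r s ->
     `|f1 s - f2 s| <= C * Num.max `|u1 s - u2 s| `|p1 s - p2 s|) ->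
  u1 t0 = u2 t0 -> p1 t0 = p2 t0 ->
  exists2 e : R, 0 < e & forall s, ball t0 e s -> u1 s = u2 s /\ p1 s = p2 s.
Proof.
move=> r0 C0 hd hl u0 p0.
pose eta := Num.min (r / 2) (2 * (C + 1))^-1.
have C1 : 0 < C + 1 by rewrite ltr_wpDl.
have eta0 : 0 < eta by rewrite /eta lt_min divr_gt0 // invr_gt0 mulr_gt0.
have etar : eta < r by rewrite /eta gt_min gtr_pMr // invf_lt1 // ltr1n.
have etaC : eta * (C + 1) <= 1 / 2.
  have : eta <= (2 * (C + 1))^-1 by rewrite /eta ge_min lexx orbT.
  move=> h; apply: (@le_trans _ _ ((2 * (C + 1))^-1 * (C + 1))); first by rewrite ler_wpM2r // ltW.
  by rewrite invfM -mulrA mulVf ?gt_eqF // mulr1 mul1r.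
have inb s : `|s - t0| <= eta -> ball t0 r s.
  by move=> h; rewrite /ball /= distrC; exact: le_lt_trans etar.
pose N s := Num.max `|u1 s - u2 s| `|p1 s - p2 s|.
have Nge s : 0 <= N s by rewrite /N le_max normr_ge0.
have cN : {within `[t0 - eta, t0 + eta], continuous N}.
  apply: continuous_in_subspaceT => s; rewrite inE /= in_itv /= => /andP[s1 s2].
  have [d1 d2 d3 d4] : [/\ is_derive s 1 u1 (p1 s), is_derive s 1 u2 (p2 s),
     is_derive s 1 p1 (f1 s) & is_derive s 1 p2 (f2 s)].
    by apply: hd; apply: inb; rewrite ler_norml; apply/andP; split; lra.
  have k1 : {for s, continuous (fun s => `|u1 s - u2 s|)}.
    by apply: cvg_norm; apply: cvgB; apply: is_derive_continuous; eassumption.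
  have k2 : {for s, continuous (fun s => `|p1 s - p2 s|)}.
    by apply: cvg_norm; apply: cvgB; apply: is_derive_continuous; eassumption.
  exact: (continuous_max k1 k2).
have [|sm smI hmax] := EVT_max _ cN; first by lra.
have sabs s : `|s - t0| <= eta -> s \in `[t0 - eta, t0 + eta].
  by rewrite ler_norml in_itv /= => /andP[h1 h2]; apply/andP; split; lra.
have absm : `|sm - t0| <= eta.
  by move: smI; rewrite in_itv /= ler_norml => /andP[h1 h2]; apply/andP; split; lra.
have Nm0 : N sm <= 0.
  suff : N sm <= N sm * (eta * (C + 1)).
    move=> h; have := Nge sm; have : N sm * (eta * (C + 1)) <= N sm * (1 / 2).
      by rewrite ler_wpM2l.
    lra.
  have bu : `|u1 sm - u2 sm| <= N sm * eta.
    apply: norm_rV_le => [|i]; first by rewrite mulr_ge0 // ltW.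
    have := @mvt_abs (fun s => u1 s 0 i - u2 s 0 i) (fun s => p1 s 0 i - p2 s 0 i) t0 eta (N sm) sm.
    rewrite u0 subrr subr0 !mxE; apply => // x xb.
      have [d1 d2 d3 d4] := hd _ (inb _ xb).
      by apply: is_derive_fB; exact: is_derive_coord.
    apply: le_trans (hmax _ (sabs _ xb)); rewrite /N le_max; apply/orP; right.
    by have := le_coord_norm (p1 x - p2 x) i; rewrite !mxE.
  have bp : `|p1 sm - p2 sm| <= (C * N sm) * eta.
    apply: norm_rV_le => [|i]; first by rewrite !mulr_ge0 // ltW.
    have := @mvt_abs (fun s => p1 s 0 i - p2 s 0 i) (fun s => f1 s 0 i - f2 s 0 i) t0 eta (C * N sm) sm.
    rewrite p0 subrr subr0 !mxE; apply => // x xb.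
      have [d1 d2 d3 d4] := hd _ (inb _ xb).
      by apply: is_derive_fB; exact: is_derive_coord.
    apply: le_trans (_ : `|f1 x - f2 x| <= _).
      by have := le_coord_norm (f1 x - f2 x) i; rewrite !mxE.
    apply: le_trans (hl _ (inb _ xb)) _; rewrite ler_wpM2l //.
    exact: (hmax _ (sabs _ xb)).
  rewrite [X in X <= _]/N ge_max; apply/andP; split.
    by apply: le_trans bu _; rewrite ler_wpM2l // ler_peMr ?(ltW eta0) // lerDr.
  apply: le_trans bp _; rewrite [C * _]mulrC -mulrA ler_wpM2l // mulrC ler_wpM2l ?(ltW eta0) //.
  by rewrite lerDl.
exists eta => // s; rewrite /ball /= distrC => /ltW sb.
have : N s <= 0 by apply: le_trans (hmax _ (sabs _ sb)) Nm0.
rewrite /N ge_max !normr_le0 !subr_eq0 => /andP[/eqP -> /eqP ->] //.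
Qed.

Section Geodesics.
Context {m d : nat} {M : set 'rV[R]_m} (hM : embedded_submanifold d M).

Lemma geo_chart V U (phi : 'rV[R]_d -> 'rV[R]_m) psi a b c t :
  local_param M V U phi psi -> geodesic_on d M a b c -> t \in `]a, b[ -> U (c t) ->
  exists N : set R, [/\ open N, N t, N `<=` `]a, b[%classic,
    forall s, N s -> M (c s) /\ U (c s) &
    (forall k, Ck k N (psi \o c)) /\
    forall s, N s -> is_derive s 1 ('D_1 (psi \o c))
      (- Gamv phi (psi (c s)) ('D_1 (psi \o c) s) ('D_1 (psi \o c) s))].
Proof.
move=> lp [sc Mc ode] tab Ut.
have [N [oN Nt Nab NMU Cu]] := lp_curve lp sc Mc tab Ut.
exists N; split => //; split => // s Ns.
have CD : Ck 1 N ('D_1 (psi \o c)) := Ck_D1 (Cu 2).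
have d2 : derivable ('D_1 (psi \o c)) s 1 := Ck_derivable CD Ns.
split => //; apply/rowP => k.
have [_ Us] := NMU _ Ns; have := ode _ _ _ _ lp s (Nab _ Ns) Us k.
have DE : derive1 (psi \o c) = 'D_1 (psi \o c) by apply/funext => y; exact: derive1E.
rewrite /derive1n /= DE derive1E => /eqP; rewrite addr_eq0 => /eqP ->.
by rewrite [RHS]mxE [X in _ = - X]mxE.
Qed.

(** In a chart the geodesic equation is a second-order system with locally Lipschitz right-hand
    side; equality of the velocities in the ambient space carries over to the chart by the left
    inverse of [lp_retr]. *)
Lemma geo_uniq_local a1 b1 a2 b2 c1 c2 t0 :
  geodesic_on d M a1 b1 c1 -> geodesic_on d M a2 b2 c2 ->
  t0 \in `]a1, b1[ -> t0 \in `]a2, b2[ -> c1 t0 = c2 t0 -> 'D_1 c1 t0 = 'D_1 c2 t0 ->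
  exists2 e : R, 0 < e & forall s, ball t0 e s -> c1 s = c2 s /\ 'D_1 c1 s = 'D_1 c2 s.
Proof.
move=> g1 g2 t1 t2 E0 D0.
have M1 : M (c1 t0) by have [_ h _] := g1; exact: h.
have [V [U [phi [psi [U0 lp]]]]] := hM M1.
have [N1 [oN1 N1t N1ab N1MU [Cu1 ode1]]] := geo_chart lp g1 t1 U0.
have U02 : U (c2 t0) by rewrite -E0.
have [N2 [oN2 N2t N2ab N2MU [Cu2 ode2]]] := geo_chart lp g2 t2 U02.
have cd1 s : N1 s -> 'D_1 c1 s = 'D_('D_1 (psi \o c1) s) phi (psi (c1 s)).
  by move=> Ns; have [_ ->] := lp_curve_deriv lp oN1 Ns N1MU (Cu1 1).
have cd2 s : N2 s -> 'D_1 c2 s = 'D_('D_1 (psi \o c2) s) phi (psi (c2 s)).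
  by move=> Ns; have [_ ->] := lp_curve_deriv lp oN2 Ns N2MU (Cu2 1).
have u0 : (psi \o c1) t0 = (psi \o c2) t0 by rewrite /= E0.
have V0 : V (psi (c1 t0)) by exact: (lp_inV lp M1 U0).
have p0 : 'D_1 (psi \o c1) t0 = 'D_1 (psi \o c2) t0.
  have [A hA] := lp_retr lp V0.
  by rewrite -(hA ('D_1 (psi \o c1) t0)) -(cd1 _ N1t) D0 (cd2 _ N2t) -E0 hA.
pose P := `|'D_1 (psi \o c1) t0| + 1.
have P0 : 0 <= P by rewrite addr_ge0.
have [C [e [C0 e0 hlip]]] := Gamv_lip (lp_open lp) (lp_Ck lp) (@lp_imm _ _ _ _ _ _ _ _ lp) V0 P0.
have : \forall s \near t0, [/\ N1 s, N2 s,
    ball (psi (c1 t0)) e ((psi \o c1) s) /\ ball (psi (c1 t0)) e ((psi \o c2) s),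
    `|'D_1 (psi \o c1) s| <= P & `|'D_1 (psi \o c2) s| <= P].
  have c_u1 := Ck_cont (Cu1 0) N1t; have c_u2 := Ck_cont (Cu2 0) N2t.
  have c_p1 := Ck_cont (Ck_D1 (Cu1 1)) N1t; have c_p2 := Ck_cont (Ck_D1 (Cu2 1)) N2t.
  have B1 := continuous_norm_near c_p1; have B2 := continuous_norm_near c_p2.
  rewrite -p0 in B2.
  have nb1 : nbhs t0 N1 by exact: open_nbhs_nbhs.
  have nb2 : nbhs t0 N2 by exact: open_nbhs_nbhs.
  have q1 : \forall s \near t0, ball (psi (c1 t0)) e ((psi \o c1) s).
    by apply: c_u1; exact: nbhsx_ballx.
  have q2 : \forall s \near t0, ball (psi (c1 t0)) e ((psi \o c2) s).
    by apply: c_u2; rewrite /= -E0; exact: nbhsx_ballx.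
  apply: filterS (filterI (filterI nb1 nb2) (filterI (filterI q1 q2) (filterI B1 B2))).
  by move=> s [[h1 h2] [[h3 h4] [h5 h6]]]; exact: And5 h1 h2 (conj h3 h4) h5 h6.
move=> /nbhs_ballP[r /= r0 hr].
have [s|s|eps eps0 heps] := @ode2_uniq_local d (psi \o c1) (psi \o c2) ('D_1 (psi \o c1)) ('D_1 (psi \o c2))
   (fun s => - Gamv phi ((psi \o c1) s) ('D_1 (psi \o c1) s) ('D_1 (psi \o c1) s))
   (fun s => - Gamv phi ((psi \o c2) s) ('D_1 (psi \o c2) s) ('D_1 (psi \o c2) s)) t0 r C r0 C0 _ _ u0 p0.
- move=> /hr [n1 n2 _ _ _]; split; [| |exact: ode1|exact: ode2].
    by apply: derivableP; exact: Ck_derivable (Cu1 1) n1.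
  by apply: derivableP; exact: Ck_derivable (Cu2 1) n2.
- move=> /hr [n1 n2 [q1 q2] q3 q4]; rewrite normNB; exact: (hlip _ _ _ _ q1 q2 q3 q4).
exists (Num.min eps r); first by rewrite lt_min eps0.
move=> s sb; have sb1 : ball t0 eps s by apply: le_ball sb; rewrite ge_min lexx.
have sb2 : ball t0 r s by apply: le_ball sb; rewrite ge_min lexx orbT.
have [n1 n2 _ _ _] := hr _ sb2; have [h1 h2] := heps _ sb1.
have [m1 v1] := N1MU _ n1; have [m2 v2] := N2MU _ n2.
have Ec : c1 s = c2 s.
  by rewrite -(lp_KV lp m1 v1) -(lp_KV lp m2 v2); congr (phi _); exact: h1.
split; first exact: Ec.
by rewrite (cd1 _ n1) (cd2 _ n2) h2 Ec.
Qed.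

(** Positions and velocities are propagated together: local uniqueness is the open step, continuity
    of the curves and of their derivatives the closed one. *)
Lemma geo_uniq e1 e2 c1 c2 : 0 < e1 -> 0 < e2 ->
  geodesic_on d M (- e1) (1 + e1) c1 -> geodesic_on d M (- e2) (1 + e2) c2 ->
  c1 0 = c2 0 -> 'D_1 c1 0 = 'D_1 c2 0 -> forall t, 0 <= t <= 1 -> c1 t = c2 t.
Proof.
move=> e10 e20 g1 g2 E0 D0.
have in1 t : 0 <= t <= 1 -> t \in `]- e1, 1 + e1[.
  by move=> /andP[t0 t1]; rewrite in_itv /=; apply/andP; split; lra.
have in2 t : 0 <= t <= 1 -> t \in `]- e2, 1 + e2[.
  by move=> /andP[t0 t1]; rewrite in_itv /=; apply/andP; split; lra.
have Cc1 : forall k, Ck k `]- e1, 1 + e1[%classic c1.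
  by move=> k; have [s _ _] := g1; apply: smooth_on_Ck s; exact: open_itvoo.
have Cc2 : forall k, Ck k `]- e2, 1 + e2[%classic c2.
  by move=> k; have [s _ _] := g2; apply: smooth_on_Ck s; exact: open_itvoo.
suff h : forall t, 0 <= t <= 1 -> c1 t = c2 t /\ 'D_1 c1 t = 'D_1 c2 t.
  by move=> t /h [].
apply: real_induction; first by split.
- move=> t /andP[t0 t1] /(_ t); rewrite t0 lexx => /(_ isT) [Et Dt].
  have t01 : 0 <= t <= 1 by rewrite t0 ltW.
  have [e e0 he] := geo_uniq_local g1 g2 (in1 _ t01) (in2 _ t01) Et Dt.
  exists e => // s /andP[ts se] _; apply: he.
  by rewrite /ball /= distrC gtr0_norm ?subr_gt0 // ltrBlDr addrC.
move=> t /andP[t0 t1] hlt; have t01 : 0 <= t <= 1 by rewrite ltW.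
have lim (f1 f2 : R -> 'rV[R]_m) : {for t, continuous f1} -> {for t, continuous f2} ->
    (forall s, 0 <= s < t -> f1 s = f2 s) -> f1 t = f2 t.
  move=> cf1 cf2 h; apply: (@cvg_unique _ _ (f1 @ t^'-)) => //.
    exact: (cvg_at_left_filter cf1).
  apply: cvg_trans (cvg_at_left_filter cf2); apply: near_eq_cvg; near=> s.
  rewrite h //; apply/andP; split; last by near: s; exact: nbhs_left_lt.
  by near: s; exact: nbhs_left_ge.
split; [apply: (lim c1 c2)|apply: (lim ('D_1 c1) ('D_1 c2))].
- exact: Ck_cont (Cc1 0) (in1 _ t01).
- exact: Ck_cont (Cc2 0) (in2 _ t01).
- by move=> s /hlt [].
- exact: Ck_cont (Ck_D1 (Cc1 1)) (in1 _ t01).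
- exact: Ck_cont (Ck_D1 (Cc2 1)) (in2 _ t01).
- by move=> s /hlt [].
Unshelve. all: by end_near. Qed.

End Geodesics.

End GeodesicUniqueness.

(** * The exponential map along rays *)

Section Exponential.
Context {R : realType} {m d : nat} {M : set 'rV[R]_m} (hM : embedded_submanifold d M).
Implicit Types (p q v : 'rV[R]_m) (e s t : R).

Lemma is_derive_mull (s t : R) : is_derive t 1 (fun t : R => s * t) s.
Proof.
apply: (is_derive_eq (is_derive_fM (is_derive_fcst s t 1) (is_derive_idR t))).
by rewrite mulr0 addr0 mulr1.
Qed.

Lemma geodesic_intro (a b : R) (c : R -> 'rV[R]_m) :
  (forall k, Ck k `]a, b[%classic c) -> (forall t, t \in `]a, b[ -> M (c t)) ->
  (forall V U (phi : 'rV[R]_d -> 'rV[R]_m) psi t, local_param M V U phi psi ->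
    t \in `]a, b[ -> U (c t) -> exists (N : set R) (u' : R -> 'rV[R]_d),
    [/\ open N, N t, forall s, N s -> is_derive s 1 (psi \o c) (u' s) &
        is_derive t 1 u' (- Gamv phi (psi (c t)) (u' t) (u' t))]) ->
  geodesic_on d M a b c.
Proof.
move=> Cc Mc ode; split => //.
  by apply: Ck_smooth_on => //; exact: open_itvoo.
move=> V U phi psi lp t tab Ut k; have [N [u' [oN Nt du ddu]]] := ode _ _ _ _ _ lp tab Ut.
have E1 s : N s -> derive1 (psi \o c) s = u' s.
  by move=> /du [_ h]; rewrite derive1E.
have E2 : derive1n 2 (psi \o c) t = - Gamv phi (psi (c t)) (u' t) (u' t).
  rewrite /derive1n /= derive1E.
  suff [_ ->] : is_derive t 1 (derive1 (psi \o c)) (- Gamv phi (psi (c t)) (u' t) (u' t)) by [].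
  by apply: (is_derive_near oN Nt _ ddu) => s Ns; rewrite E1.
move=> u; rewrite /u E2 E1 // [X in X + _ = _]mxE [X in - X + _ = _]mxE addNr //.
Qed.

Lemma Gamv_symZ (phi : 'rV[R]_d -> 'rV[R]_m) x s a :
  Gamv phi x (s *: a) (s *: a) = s ^+ 2 *: Gamv phi x a a.
Proof.
apply/rowP => k; rewrite [LHS]mxE [RHS]mxE [X in _ = _ * X]mxE mulr_sumr.
apply: eq_bigr => i _; rewrite mulr_sumr; apply: eq_bigr => j _.
by rewrite [(s *: a) 0 i]mxE [(s *: a) 0 j]mxE; ring.
Qed.

Lemma geodesic_rescale e c s : 0 < e -> 0 <= s <= 1 ->
  geodesic_on d M (- e) (1 + e) c -> geodesic_on d M (- e) (1 + e) (fun t => c (s * t)).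
Proof.
move=> e0 /andP[s0 s1] g; have [sc Mc _] := g.
have oI := @open_itvoo _ (- e) (1 + e).
have Cc k : Ck k `]- e, 1 + e[%classic c by exact: smooth_on_Ck.
have sI t : t \in `]- e, 1 + e[ -> s * t \in `]- e, 1 + e[.
  rewrite !in_itv /= => /andP[t1 t2]; have [t0|t0] := leP 0 t.
    have h1 : 0 <= s * t by rewrite mulr_ge0.
    have h2 : s * t <= t by rewrite ler_piMl.
    by apply/andP; split; lra.
  have h1 : t <= s * t by rewrite ler_niMl // ltW.
  have h2 : s * t <= 0 by rewrite mulr_ge0_le0 // ltW.
  by apply/andP; split; lra.
apply: geodesic_intro.
- by move=> k; apply: (Ck_rescale oI oI _ (Cc k)).
- by move=> t /sI /Mc.
move=> V U phi psi t lp tab Ut.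
have [N [oN Nt Nab NMU [Cu ode]]] := geo_chart lp g (sI _ tab) Ut.
exists ((fun t => s * t) @^-1` N), (fun t => s *: 'D_1 (psi \o c) (s * t)).
have cs x : {for x, continuous (fun t : R => s * t)}.
  by apply: cvgM; [exact: cvg_cst|exact: cvg_id].
have ds := is_derive_mull s.
split => //.
- by apply: open_comp => // x _; exact: cs.
- move=> x Nx; have hx : is_derive (s * x) 1 (psi \o c) ('D_1 (psi \o c) (s * x)).
    by apply: derivableP; exact: Ck_derivable (Cu 1) Nx.
  exact: (is_derive_compR (ds x) hx).
have h := @is_derive_compR _ _ (fun t => s * t) ('D_1 (psi \o c)) t s _ (ds t) (ode _ Nt).
apply: is_derive_rV => i.
have hi := is_derive_coord i h.
have -> : (fun y : R => (s *: 'D_1 (psi \o c) (s * y)) 0 i) =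
  (fun y => s * (('D_1 (psi \o c) \o (fun t => s * t)) y 0 i)).
  by apply/funext => y; rewrite [LHS]mxE.
apply: (is_derive_eq (is_derive_fM (is_derive_fcst s t 1) hi)).
rewrite mulr0 addr0 (Gamv_symZ _ _ s).
by move: (Gamv _ _ _ _) => G; rewrite !mxE; ring.
Qed.

Lemma is_Exp_uniq p v q1 q2 : is_Exp d M p v q1 -> is_Exp d M p v q2 -> q1 = q2.
Proof.
move=> [e1 [c1 [e10 g1 p1 v1 <-]]] [e2 [c2 [e20 g2 p2 v2 <-]]].
apply: (geo_uniq hM e10 e20 g1 g2); rewrite ?lexx ?ler01 //; first by rewrite p1 p2.
by rewrite -!derive1E v1 v2.
Qed.

Lemma ExpE p v q : is_Exp d M p v q -> Exp d M p v = q.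
Proof.
by move=> h; apply: xget_unique => // y hy; exact: is_Exp_uniq hy h.
Qed.

(** Slowing the geodesic of [v] down by the factor [s] gives the geodesic of [s v], and uniqueness
    identifies its endpoint with the value of [Exp]. *)
Lemma Exp_curve p v : Exp_dom d M p v -> exists e c, [/\ 0 < e,
  geodesic_on d M (- e) (1 + e) c, c 0 = p, derive1 c 0 = v &
  forall s, 0 <= s <= 1 -> Exp_dom d M p (s *: v) /\ Exp d M p (s *: v) = c s].
Proof.
move=> [q [e [c [e0 g c0 dc c1]]]]; exists e, c; split => // s s01.
suff h : is_Exp d M p (s *: v) (c s) by split; [exists (c s)|exact: ExpE].
exists e, (fun t => c (s * t)); split => //.
- exact: geodesic_rescale.
- by rewrite mulr0.
- have i0 : `]- e, 1 + e[%classic (0 : R) by rewrite /= in_itv /= oppr_lt0 e0 addr_gt0.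
  have Cc : Ck 1 `]- e, 1 + e[%classic c.
    by have [sc _ _] := g; apply: smooth_on_Ck sc; exact: open_itvoo.
  have ds := is_derive_mull s 0.
  have hc : is_derive (s * 0) 1 c ('D_1 c 0).
    by rewrite mulr0; apply: derivableP; exact: Ck_derivable Cc i0.
  have [_] := is_derive_compR ds hc.
  by rewrite derive1E => ->; rewrite -dc derive1E.
- by rewrite mulr1.
Qed.

Lemma Exp_in p v : M p -> M (Exp d M p v).
Proof.
move=> Mp; have [[q hq]|nE] := pselect (Exp_dom d M p v).
  rewrite (ExpE hq); have [e [c [e0 [_ Mc _] _ _ <-]]] := hq.
  by apply: Mc; rewrite in_itv /= ltrDl e0 andbT; lra.
(* Off its domain [Exp] takes the default value [p], which lies in [M]. *)
rewrite /Exp; case: xgetP => // y _ hy; case: nE; by exists y.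
Qed.

End Exponential.

(** * Normal charts *)

Section Openness.
Context {R : realType}.

Lemma dotvDl m (u v w : 'rV[R]_m) : dotv (u + v) w = dotv u w + dotv v w.
Proof. by rewrite -[u]scale1r dotv_lin mul1r scale1r. Qed.

Lemma dotvZl m s (u w : 'rV[R]_m) : dotv (s *: u) w = s * dotv u w.
Proof.
rewrite -[s *: u]addr0 dotv_lin [X in _ + X](_ : _ = 0) ?addr0 //.
by rewrite /dotv big1 // => i _; rewrite mxE mul0r.
Qed.

Lemma dotvNl m (u w : 'rV[R]_m) : dotv (- u) w = - dotv u w.
Proof. by rewrite -scaleN1r dotvZl mulN1r. Qed.

Lemma dotv_lepm m (a b : 'rV[R]_m) :
  dotv (a + b) (a + b) <= 2 * dotv a a + 2 * dotv b b.
Proof.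
have := dotv_ge0 (a - b).
rewrite !dotvDl !dotvNl ![dotv _ (_ + _)]dotvC !dotvDl !dotvNl [dotv b a]dotvC; lra.
Qed.

Lemma dotv_continuous (T : topologicalType) n (f : T -> 'rV[R]_n) x :
  {for x, continuous f} -> {for x, continuous (fun y => dotv (f y) (f y))}.
Proof.
move=> cf; rewrite /prop_for /continuous_at /dotv; apply: cvg_big => //.
  exact: add_continuous.
by move=> i _; apply: cvgM; exact: cvg_coord_mx cf.
Qed.

Lemma dotv_deriv (W : normedModType R) m (f g : W -> 'rV[R]_m) x v df dg :
  is_derive x v f df -> is_derive x v g dg ->
  is_derive x v (fun y => dotv (f y) (g y)) (dotv (f x) dg + dotv (g x) df).
Proof.
move=> hf hg; rewrite /dotv -big_split /=; apply: is_derive_fS => i.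
by apply: is_derive_fM; exact: is_derive_coord.
Qed.

(* The point of a small closed ball whose image is nearest to [z] is interior,
   hence critical, hence mapped to [z]. *)
Lemma immersion_open d (V : set 'rV[R]_d) (F : 'rV[R]_d -> 'rV[R]_d) x0 :
  open V -> Ck 1 V F -> (forall x w, V x -> 'D_w F x = 0 -> w = 0) ->
  (forall x y, V x -> V y -> F x = F y -> x = y) -> V x0 ->
  nbhs (F x0) (F @` V).
Proof.
move=> oV CF imm inj Vx0.
have [e e0 he] : exists2 e : R, 0 < e & forall x, `|x - x0| <= e -> V x.
  have /nbhs_ballP[e /= e0 he] := open_nbhs_nbhs (conj oV Vx0).
  exists (e / 2); first by rewrite divr_gt0.
  move=> x xe; apply: he; rewrite -ball_normE /= distrC; apply: le_lt_trans xe _.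
  by rewrite gtr_pMr // invf_lt1 // ltr1n.
have compact_K (P : set R) : closed P -> (forall t, P t -> t <= e) ->
    compact [set x : 'rV[R]_d | P `|x - x0|].
  move=> cP Pe; apply: bounded_closed_compact.
    exists (e + `|x0|); split; first exact: num_real.
    move=> y ye x /= /Pe xe; apply: le_trans (ltW ye).
    by rewrite -[x](subrK x0); apply: le_trans (ler_normD _ _) _; rewrite lerD2r.
  apply: (@closed_comp _ _ (fun x : 'rV[R]_d => `|x - x0|) P) => // x _.
  have c1 : {for x, continuous (fun y : 'rV[R]_d => y - x0)}.
    exact: (cvgB (@cvg_id _ (nbhs x)) (cvg_cst x0)).
  exact: cvg_norm c1.
have cdist z x : V x -> {for x, continuous (fun x => dotv (F x - z) (F x - z))}.
  move=> Vx; have cF : {for x, continuous F} by exact: Ck_cont CF Vx.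
  exact: (dotv_continuous (cvgB cF (cvg_cst z))).
(* On the sphere of radius [e], injectivity keeps the image at a positive distance from [F x0]; this
   prevents the nearest point from lying on the boundary. *)
have [mu mu0 hmu] : exists2 mu : R, 0 < mu &
    forall x, `|x - x0| = e -> mu <= dotv (F x - F x0) (F x - F x0).
  have [[y0 hy0]|nE] := pselect (exists y, `|y - x0| = e); last first.
    by exists 1 => // x xe; case: nE; exists x.
  have cK1 : compact [set x : 'rV[R]_d | [set e] `|x - x0|].
    by apply: compact_K; [exact: closed_eq|move=> t ->].
  have [||c cS hc] := @EVT_min_rV _ _ (fun x => dotv (F x - F x0) (F x - F x0)) _ _ cK1.
  - by exists y0.
  - apply: continuous_in_subspaceT => x; rewrite inE /= => xe.
    by apply: cdist; apply: he; rewrite xe.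
  move: cS; rewrite inE /= => ce.
  exists (dotv (F c - F x0) (F c - F x0)).
    apply: dotv_gt0; rewrite subr_eq0; apply/eqP => /inj cx.
    have E : c = x0 by apply: cx => //; apply: he; rewrite ce.
    by move: ce e0; rewrite E subrr normr0 => <-; rewrite ltxx.
  by move=> x xe; apply: hc; rewrite inE.
have cz : {for F x0, continuous (fun z : 'rV[R]_d => dotv (z - F x0) (z - F x0))}.
  exact: (dotv_continuous (cvgB (@cvg_id _ (nbhs (F x0))) (cvg_cst (F x0)))).
(* For [|z - F x0|^2 < mu / 4], a minimizer on the sphere would give [mu < 2 (mu / 4) + 2 (mu / 4)]
   by [dotv_lepm]. *)
have mu4 : 0 < mu / 4 by rewrite divr_gt0.
have /cvgrPdist_lt/(_ _ mu4) := cz; apply: filterS => z.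
rewrite subrr [dotv 0 0](_ : _ = 0); last by rewrite /dotv big1 // => i _; rewrite mxE mul0r.
rewrite sub0r normrN ger0_norm ?dotv_ge0 // => hz.
have cK2 : compact [set x : 'rV[R]_d | [set t | t <= e] `|x - x0|].
  by apply: compact_K => //; exact: closed_le.
have [||x1 x1K hmin] := @EVT_min_rV _ _ (fun x => dotv (F x - z) (F x - z)) _ _ cK2.
- by exists x0; rewrite /= subrr normr0 ltW.
- apply: continuous_in_subspaceT => x; rewrite inE /= => xe.
  by apply: cdist; exact: he.
move: x1K; rewrite inE /= => x1e.
have hx0 : dotv (F x0 - z) (F x0 - z) = dotv (z - F x0) (z - F x0).
  by rewrite -opprB dotvNl dotvC dotvNl opprK.
have x1lt : `|x1 - x0| < e.
  rewrite lt_neqAle x1e andbT; apply/eqP => /hmu h.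
  have h0 : dotv (F x1 - z) (F x1 - z) <= dotv (F x0 - z) (F x0 - z).
    by apply: hmin; rewrite inE /= subrr normr0 ltW.
  have := dotv_lepm (F x1 - z) (z - F x0); rewrite addrA subrK.
  rewrite hx0 in h0; lra.
exists x1; first exact: he.
have Vx1 := he _ x1e.
have crit w : dotv (F x1 - z) ('D_w F x1) = 0.
  pose h y := dotv (F y - z) (F y - z).
  have dh y : V y -> is_derive y w h (2 * dotv (F y - z) ('D_w F y)).
    move=> Vy; have dF : is_derive y w F ('D_w F y).
      by apply: derivableP; exact: Ck_derivable CF Vy.
    have dFz : is_derive y w (fun x => F x - z) ('D_w F y).
      by apply: (is_derive_eq (is_derive_fB dF (is_derive_fcst z y w))); rewrite subr0.
    by apply: (is_derive_eq (dotv_deriv dFz dFz)); ring.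
  have cl : {for (0 : R), continuous (fun t : R => x1 + t *: w)}.
    by apply: Ck_cont (Ck_line 0 x1 w openT) _.
  have nb : \forall t \near (0 : R), `|x1 + t *: w - x0| < e.
    have cn : {for (0 : R), continuous (fun t : R => `|x1 + t *: w - x0|)}.
      by apply: cvg_norm; apply: cvgB; [exact: cl|exact: cvg_cst].
    have on : nbhs `|x1 + (0 : R) *: w - x0| [set t | t < e].
      by apply: open_nbhs_nbhs; split; [exact: open_lt|rewrite /= scale0r addr0].
    exact: (cn _ on).
  have /nbhs_ballP[r /= r0 hr] := nb.
  have te t : t \in `]- r, r[ -> `|x1 + t *: w - x0| < e.
    by rewrite in_itv /= => tr; apply: hr; rewrite /ball /= sub0r normrN ltr_norml.
  have D0 : is_derive (0 : R) 1 (fun t : R => h (x1 + t *: w)) 0.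
    apply: (@derive1_at_min _ _ (- r) r).
    - by rewrite ltW // gtrN.
    - by move=> t /te /ltW /he /dh /(is_derive_lineP h) [].
    - by rewrite in_itv /= oppr_lt0 r0.
    - by move=> t /te /ltW tx; rewrite scale0r addr0; apply: hmin; rewrite inE.
  have /dh dx1 := Vx1.
  have : is_derive (0 : R) 1 (fun t : R => h (x1 + t *: w)) (2 * dotv (F x1 - z) ('D_w F x1)).
    by apply/is_derive_lineP; rewrite scale0r addr0.
  by move=> /(is_derive_uniq D0) E; lra.
suff h0 : F x1 - z = 0 by apply/eqP; rewrite -subr_eq0 h0.
apply: dotv_eq0.
have dF : differentiable F x1 by exact: C1_differentiable_mx oV CF Vx1.
pose J := jacobian F x1.
have JE w : 'D_w F x1 = w *m J by exact: deriveEjacobian.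
have uJ : J \in unitmx.
  rewrite -row_free_unit -kermx_eq0; apply/eqP/row_matrixP => i.
  rewrite row0; apply: (imm x1) => //; rewrite JE.
  by apply/sub_kermxP; exact: row_sub.
(* The direction whose image under the differential is [F x1 - z] itself. *)
by have := crit ((F x1 - z) *m invmx J); rewrite JE mulmxKV.
Qed.

End Openness.

(** * Exponential charts *)

Section NormalChart.
Context {R : realType} {m d : nat} {M : set 'rV[R]_m} (hM : embedded_submanifold d M).
Implicit Types (p q v : 'rV[R]_m) (x w : 'rV[R]_d) (s t : R).

Lemma enorm_ge0 n (v : 'rV[R]_n) : 0 <= enorm v.
Proof. exact: sqrtr_ge0. Qed.

Lemma enorm_sq n (v : 'rV[R]_n) : enorm v ^+ 2 = dotv v v.
Proof. by rewrite sqr_sqrtr // dotv_ge0. Qed.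

Lemma enormZ n (a : R) (v : 'rV[R]_n) : enorm (a *: v) = `|a| * enorm v.
Proof.
rewrite /enorm dotvZl dotvC dotvZl mulrA -expr2 sqrtrM ?sqr_ge0 //.
by rewrite sqrtr_sqr.
Qed.

Lemma enorm0 n : enorm (0 : 'rV[R]_n) = 0.
Proof. by rewrite -(scale0r (0 : 'rV[R]_n)) enormZ normr0 mul0r. Qed.

Lemma Ck_mulmxr (W : normedModType R) n1 n2 k (U : set W) (f : W -> 'rV[R]_n1)
  (B : 'M[R]_(n1, n2)) : open U -> Ck k U f -> Ck k U (fun z : W => f z *m B).
Proof.
move=> oU /(Ck_coordP _ _ oU) Cf; apply/(Ck_coordP _ _ oU) => i j.
rewrite (_ : (fun x : W => _) = fun z : W => \sum_l f z i l * B l j); last first.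
  by apply/funext => z; rewrite mxE.
by apply: Ck_sum => // l _; apply: CkM => //; exact: Ck_cst.
Qed.

Lemma is_derive_mulmxr n1 n2 (B : 'M[R]_(n1, n2)) (x w : 'rV[R]_n1) :
  is_derive x w (fun y : 'rV[R]_n1 => y *m B) (w *m B).
Proof.
rewrite -[x in is_derive x]addr0 -(scale0r w).
apply/(is_derive_lineP (fun y : 'rV[R]_n1 => y *m B)).
rewrite (_ : (fun t => _) = fun t : R => x *m B + t *: (w *m B)); last first.
  by apply/funext => t; rewrite mulmxDl -scalemxAl.
apply/(is_derive_lineP (fun y : 'rV[R]_n2 => y)); exact: is_derive_id.
Qed.

Lemma enorm_ball_open n1 n2 (B : 'M[R]_(n1, n2)) s :
  open [set z : 'rV[R]_n1 | enorm (z *m B) < s].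
Proof.
have cdot (y : 'rV[R]_n1) : {for y, continuous (fun z : 'rV[R]_n1 => enorm (z *m B))}.
  apply: (@continuous_comp _ _ _ (fun z : 'rV[R]_n1 => dotv (z *m B) (z *m B))); last exact: sqrt_continuous.
  apply: dotv_continuous.
  exact: (Ck_cont (Ck_mulmxr B openT (Ck_id 0 openT)) (I : setT y)).
apply: (@open_comp _ _ (fun z : 'rV[R]_n1 => enorm (z *m B)) [set t | t < s]) => [x _|]; first exact: cdot.
exact: open_lt.
Qed.

Lemma tangent_frame p : M p -> exists (B : 'M[R]_(d, m)) (A : 'M[R]_(m, d)),
  (forall w, w *m B *m A = w) /\ (forall v, tangent M p v <-> exists w, v = w *m B).
Proof.
move=> Mp; have [V [U [phi [psi [Up lp]]]]] := hM Mp.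
have Vx := lp_inV lp Mp Up; have px := lp_KV lp Mp Up.
have [A hA] := lp_retr lp Vx.
have dphi : differentiable phi (psi p) by apply: chart_diff (lp_open lp) (lp_Ck lp) _ Vx.
exists (jacobian phi (psi p)), A; split=> [w|v]; first by rewrite -deriveEjacobian.
split=> [tv|[w ->]].
  have [w ->] : exists w, v = 'D_w phi (psi p) by apply: (lp_tangent_sub lp) => //; rewrite px.
  by exists w; rewrite deriveEjacobian.
by rewrite -deriveEjacobian //; have := lp_tangent lp w Vx; rewrite px.
Qed.

(** Membership in the set whose supremum is [inj_at]. *)
Definition good_radius p s := [/\ 0 < s, tball M p s `<=` Exp_dom d M p &
  diffeomorphism (tball M p s) (geoball d M p s) (Exp d M p)].

(** The supremum defining [inj_at] need not be attained, so good radii are obtained strictly below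
    it, by restricting a larger one. *)
Lemma good_radius_lt p s : 0 < s -> (s%:E < inj_at d M p)%E -> good_radius p s.
Proof.
move=> s0 /ereal_sup_gt[_ [s' [s'0 dom [K [sE sK hK hE]]]] <-]; rewrite lte_fin => ss'.
have sub : tball M p s `<=` tball M p s' by move=> v [tv vs]; split => //; exact: lt_trans ss'.
have gsub : geoball d M p s `<=` geoball d M p s' by move=> _ [v /sub hv <-]; exists v.
split => //; first by move=> v /sub /dom.
exists K; split.
- move=> v /sub /sE [U [F [oU Uv CF E]]]; exists U, F; split => // y /sub; exact: E.
- move=> v /gsub /sK [U [F [oU Uv CF E]]]; exists U, F; split => // y /gsub; exact: E.
- by move=> v hv; split; [exists v|case: (hK v (sub _ hv))].
- move=> _ [v hv <-]; have [_ ->] := hK v (sub _ hv); by [].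
Qed.

(* The rows of [B] are a basis of the tangent space, so that [x *m B] is the
   tangent vector with coordinates [x]. *)
Record normal_chart p s (B : 'M[R]_(d, m)) (U : set 'rV[R]_m)
    (K : 'rV[R]_m -> 'rV[R]_d) : Prop := NormalChart {
  nb_pos : 0 < s;
  nb_lp : local_param M [set x | enorm (x *m B) < s] U (fun x => Exp d M p (x *m B)) K;
  nb_T : forall v, tangent M p v <-> exists w, v = w *m B;
  nb_inj : forall w, w *m B = 0 -> w = 0;
  nb_dom : forall x, enorm (x *m B) < s -> Exp_dom d M p (x *m B);
  nb_ball : M `&` U = geoball d M p s }.

(** The point is that the geodesic ball is open in [M], so that an open [U] of the ambient space
    cuts it out. Read in another chart, the exponential map is an injective immersion between spaces
    of the same dimension, and [immersion_open] applies. *)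
Lemma normal_chart_exists p s : M p -> good_radius p s ->
  exists B U K, normal_chart p s B U K.
Proof.
move=> Mp [s0 dom [K0 [sE sK hK hE]]]; have [B [A [BA hT]]] := tangent_frame Mp.
have Binj w : w *m B = 0 -> w = 0 by move=> wB; rewrite -(BA w) wB mul0mx.
pose V := [set x | enorm (x *m B) < s]; pose E x := Exp d M p (x *m B).
have oV : open V by exact: enorm_ball_open.
have tV x : V x -> tball M p s (x *m B) by move=> Vx; split => //; apply/hT; exists x.
have tVP v : tball M p s v -> exists2 w, V w & v = w *m B.
  by move=> [/hT [w ->] h]; exists w.
have cB k U : open U -> Ck k U (fun x : 'rV[R]_d => x *m B).
  by move=> oU; apply: Ck_mulmxr => //; exact: Ck_id.
have ctsB y : {for y, continuous (fun x : 'rV[R]_d => x *m B)}.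
  exact: (Ck_cont (cB 0 setT openT) (I : setT y)).
have CE k : Ck k V E.
  apply: Ck_local => x Vx; have [U' [F [oU' U'x CF FE]]] := sE _ (tV _ Vx).
  have oN : open (V `&` (fun x => x *m B) @^-1` U').
    exact: (open_preimage_on oV oU' (fun y _ => ctsB y)).
  exists (V `&` (fun x => x *m B) @^-1` U'); split => //.
  apply: (@Ck_eq _ _ _ _ _ (F \o (fun x => x *m B))) => //.
    by move=> y [Vy U'y] /=; apply: FE => //; exact: tV.
  by apply: (@Ck_comp_mx _ _ _ _ _ _ _ U') => //; [move=> y []|exact: cB].
have K0E x : V x -> K0 (E x) = x *m B by move=> /tV /hK [].
have Einj x y : V x -> V y -> E x = E y -> x = y.
  move=> Vx Vy xy; rewrite -(BA x) -(BA y); congr (_ *m A).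
  by rewrite -(K0E _ Vx) -(K0E _ Vy) xy.
have gE x : V x -> geoball d M p s (E x) by move=> /tV h; exists (x *m B).
have ME x : M (E x) by exact: Exp_in.
(* The smooth inverse of [Exp], composed with [E], is the injective linear map [x |-> x *m B]. *)
have imm x w : V x -> 'D_w E x = 0 -> w = 0.
  move=> Vx D0; apply: Binj.
  have [U' [G [oU' U'x CG GE]]] := sK _ (gE _ Vx).
  have dG : differentiable G (E x) by apply: C1_differentiable_mx (CG 1) U'x.
  have h1 : is_derive x w (G \o E) ('D_('D_w E x) G (E x)).
    by apply: is_derive_comp => //; exact: Ck_derivable (CE 1) Vx.
  have oN : open (V `&` E @^-1` U').
    by apply: open_preimage_on => // z Vz; exact: Ck_cont (CE 0) Vz.
  have h2 : is_derive x w (fun y : 'rV[R]_d => y *m B) ('D_('D_w E x) G (E x)).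
    apply: (is_derive_near oN _ _ h1); first by split.
    by move=> y [Vy U'y] /=; rewrite GE ?K0E //; exact: gE.
  rewrite -(is_derive_uniq h2 (is_derive_mulmxr B x w)) D0.
  by rewrite deriveE // linear0.
have opn x : V x -> exists W, [/\ open W, W (E x) & forall y, W y -> M y -> geoball d M p s y].
  move=> Vx; have [V1 [U1 [phi1 [psi1 [U1q lp1]]]]] := hM (ME x).
  have [U' [Psi [oU' U'q sU CP PE]]] := lp_ext lp1 (ME x) U1q.
  pose N := V `&` E @^-1` U'; pose F := Psi \o E.
  have oN : open N by apply: open_preimage_on => // z Vz; exact: Ck_cont (CE 0) Vz.
  have CF : Ck 1 N F.
    apply: (@Ck_comp_mx _ _ _ _ _ _ _ U') => //; first by move=> y [].
    by apply: Ck_sub (CE 1) => y [].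
  have FE y : N y -> F y = psi1 (E y) by move=> [Vy U'y]; rewrite /F /= PE.
  have V1F y : N y -> V1 (F y).
    by move=> Ny; rewrite FE //; apply: (lp_inV lp1) => //; case: Ny => _ /sU.
  have phiF y : N y -> phi1 (F y) = E y.
    by move=> Ny; rewrite FE // (lp_KV lp1) //; case: Ny => _ /sU.
  have immF y w : N y -> 'D_w F y = 0 -> w = 0.
    move=> Ny D0; apply: (imm y); first by case: Ny.
    have h1 : is_derive y w (phi1 \o F) ('D_('D_w F y) phi1 (F y)).
      apply: is_derive_comp; first exact: Ck_derivable CF Ny.
      by apply: chart_diff (lp_open lp1) (lp_Ck lp1) _ (V1F _ Ny).
    have [_ ->] : is_derive y w E ('D_('D_w F y) phi1 (F y)).
      by apply: (is_derive_near oN Ny _ h1) => z Nz /=; rewrite phiF.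
    rewrite D0 deriveE ?linear0 //.
    by apply: chart_diff (lp_open lp1) (lp_Ck lp1) _ (V1F _ Ny).
  have injF y z : N y -> N z -> F y = F z -> y = z.
    move=> Ny Nz yz; apply: Einj; [by case: Ny|by case: Nz|].
    by rewrite -(phiF _ Ny) -(phiF _ Nz) yz.
  have Nx : N x by [].
  have nF := immersion_open oN CF immF injF Nx.
  exists (U' `&` Psi @^-1` (F @` N)°); split.
  - by apply: open_preimage_on => //; [exact: open_interior|move=> y U'y; exact: Ck_cont (CP 0) U'y].
  - by split.
  move=> y [U'y /interior_subset [z Nz zy]] My.
  have -> : y = E z by rewrite -(phiF _ Nz) zy PE // (lp_KV lp1) //; exact: sU.
  by apply: gE; case: Nz.
(* The largest open set that meets [M] only inside the geodesic ball. *)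
pose U := [set y | exists W, [/\ open W, W y & forall z, W z -> M z -> geoball d M p s z]].
have oU : open U.
  rewrite openE => y [W [oW Wy h]]; rewrite /interior.
  by apply: filterS (open_nbhs_nbhs (conj oW Wy)) => z Wz; exists W.
have MU y : M y -> U y -> geoball d M p s y by move=> My [W [oW Wy h]]; exact: h.
have UE x : V x -> U (E x) by exact: opn.
exists B, U, (fun y => K0 y *m A); split => //.
- split => //; split.
  + exact: Ck_smooth_on.
  + move=> y [My Uy]; have [U' [G [oU' U'y CG GE]]] := sK _ (MU _ My Uy).
    exists U', (fun y => G y *m A); split => //; first by move=> k; exact: Ck_mulmxr.
    by move=> z [Mz Uz] U'z; rewrite GE //; exact: MU.
  + by move=> x Vx; split; [split; [exact: ME|exact: UE]|rewrite [K0 _](K0E x Vx) BA].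
  + move=> y [My Uy]; have [v /[dup] tv /tVP[w Vw vw] <-] := MU _ My Uy.
    by rewrite vw [K0 _](K0E w Vw) BA.
- by move=> x Vx; apply: dom; exact: tV.
- rewrite eqEsubset; split=> [y [My Uy]|_ [v /tVP[w Vw ->] <-]]; first exact: MU.
  by split; [exact: ME|exact: UE].
Qed.

End NormalChart.

(** * Metric, connection and curvature in a normal chart *)

Section NormalChartGeometry.
Context {R : realType} {m d : nat} {M : set 'rV[R]_m} (hM : embedded_submanifold d M).
Implicit Types (x w a b v : 'rV[R]_d) (s t : R).

(** A positive Gram determinant makes the two image vectors span a plane, so [sec_coord] is one of
    the values over which [kappa_l] and [kappa_u] are taken. *)
Lemma sec_bounds V U (phi : 'rV[R]_d -> 'rV[R]_m) psi x a b :
  local_param M V U phi psi -> V x ->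
  0 < metric phi x a a * metric phi x b b - metric phi x a b ^+ 2 ->
  (kappa_l d M <= (sec_coord phi x a b)%:E <= kappa_u d M)%E.
Proof.
move=> lp Vx D0; have [Mx Ux] := lp_in lp Vx.
have dphi : differentiable phi x by exact: chart_diff (lp_open lp) (lp_Ck lp) _ Vx.
pose J := jacobian phi x.
have JE w : 'D_w phi x = w *m J by exact: deriveEjacobian.
have mE u v : metric phi x u v = dotv (u *m J) (v *m J).
  by rewrite (metric_dot (lp_open lp) (lp_Ck lp)) // !JE.
rewrite !mE in D0.
have b0 : b *m J != 0.
  apply/eqP => h; move: D0; rewrite h -(scale0r (0 : 'rV[R]_m)) [X in _ - X ^+ 2]dotvC !dotvZl.
  by rewrite !mul0r mulr0 expr0n subrr ltxx.
have fr : free [:: a *m J; b *m J].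
  rewrite free_cons seq1_free b0 andbT span_seq1; apply/negP => /vlineP[k ak].
  move: D0; rewrite ak !dotvZl ![dotv _ (_ *: _)]dotvC !dotvZl.
  by rewrite (_ : _ - _ = 0) ?ltxx //; ring.
pose S := <<[:: a *m J; b *m J]>>%VS.
have secv : sec_values d M (sec_coord phi x a b)%:E.
  exists (sec_coord phi x a b) => //; exists (phi x), S; split => //.
  - by move: fr; rewrite /free => /eqP.
  - move=> v; rewrite /S span_cons span_seq1 => /memv_addP[_ /vlineP[k1 ->]].
    move=> [_ /vlineP[k2 ->] ->]; rewrite !scalemxAl -mulmxDl -JE.
    exact: (lp_tangent lp _ Vx).
  - exists V, U, phi, psi, a, b; rewrite (lp_K lp) //; split => //.
    by rewrite !JE /basis_of eqxx.
apply/andP; split.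
  by apply: le_trans (ereal_inf_lbound secv); rewrite /kappa_l ge_min lexx orbT.
by apply: le_trans (ereal_sup_ubound secv) _; rewrite /kappa_u le_max lexx orbT.
Qed.

Section NC.
Context {p : 'rV[R]_m} {s : R} {B : 'M[R]_(d, m)} {U : set 'rV[R]_m}
  {K : 'rV[R]_m -> 'rV[R]_d} (nb : normal_chart (M := M) p s B U K).

Let V := [set x : 'rV[R]_d | enorm (x *m B) < s].
Let E x := Exp d M p (x *m B).
Let lp : local_param M V U E K := nb_lp nb.

(** [nb_curve] describes the geodesic of a ray on [[0, 1]] only; writing [x = r x'] with [r < 1]
    places [x] in the interior of a longer ray, where two-sided derivatives are available. *)
Lemma nb_shrink x : V x -> exists2 r : R, 0 < r < 1 & exists2 x', V x' & x = r *: x'.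
Proof.
move=> Vx; pose e := enorm (x *m B); have e0 : 0 <= e by exact: enorm_ge0.
have es : e < s by exact: Vx.
have s0 := nb_pos nb.
have r0 : 0 < (e + s) / (2 * s) by rewrite divr_gt0 ?mulr_gt0 // ltr_wpDl.
have r1 : (e + s) / (2 * s) < 1 by rewrite ltr_pdivrMr ?mulr_gt0 // mul1r; lra.
exists ((e + s) / (2 * s)); first by rewrite r0.
exists (((e + s) / (2 * s))^-1 *: x); last by rewrite scalerA divff ?scale1r // gt_eqF.
rewrite /V /= -scalemxAl enormZ ger0_norm ?invr_ge0 ?ltW // -/e invf_div.
have es0 : 0 < e + s by rewrite ltr_wpDl.
by rewrite mulrAC ltr_pdivrMr // [2 * s]mulrC -mulrA ltr_pM2l //; lra.
Qed.

Lemma nb_V0 : V 0. Proof. by rewrite /V /= mul0mx enorm0; exact: nb_pos nb. Qed.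

Lemma nb_curve x : V x -> exists e (c : R -> 'rV[R]_m), [/\ 0 < e,
  geodesic_on d M (- e) (1 + e) c, c 0 = p, is_derive (0 : R) 1 c (x *m B) &
  forall t : R, 0 <= t <= 1 -> c t = E (t *: x)].
Proof.
move=> Vx; have [e [c [e0 g c0 dc h]]] := Exp_curve hM (nb_dom nb Vx).
exists e, c; split => //.
  rewrite -dc derive1E; apply: derivableP.
  have [sc _ _] := g; have Cc : Ck 1 `]- e, 1 + e[%classic c by apply: smooth_on_Ck sc; exact: open_itvoo.
  by apply: Ck_derivable Cc _; rewrite /= in_itv /= oppr_lt0 e0 addr_gt0.
by move=> t /h [_]; rewrite /E scalemxAl.
Qed.

(** The differential of the exponential map at [0] is the identity. Since [E (t x)] is known to be
    the geodesic for [t >= 0] only, derivatives are compared from the right. *)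
Lemma nb_derive0 w : 'D_w E 0 = w *m B.
Proof.
have [k k0 Vk] : exists2 k : R, 0 < k & V (k *: w).
  exists (s / (2 * (enorm (w *m B) + 1))).
    by rewrite divr_gt0 ?(nb_pos nb) // mulr_gt0 // ltr_wpDl // enorm_ge0.
  have e0 := enorm_ge0 (w *m B); have s0 := nb_pos nb.
  rewrite /V /= -scalemxAl enormZ ger0_norm; last first.
    by rewrite divr_ge0 ?mulr_ge0 // ?ltW // ltr_wpDl.
  have e1 : 0 < 2 * (enorm (w *m B) + 1) by rewrite mulr_gt0 // ltr_wpDl.
  rewrite mulrAC ltr_pdivrMr // ltr_pM2l //; lra.
have [e [c [e0 g c0 dc h]]] := nb_curve Vk.
have dE v : derivable E 0 v by exact: Ck_derivable (lp_Ck lp 1) nb_V0.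
have d1 : is_derive (0 : R) 1 (fun t : R => E (t *: (k *: w))) ('D_(k *: w) E 0).
  by apply: is_derive_ray; rewrite scale0r; exact: derivableP.
have E0 : k *: w *m B = 'D_(k *: w) E 0.
  apply: (is_derive_right_uniq ltr01 dc d1) => t; rewrite add0r => /andP[t0 /ltW t1].
  by rewrite h // t0.
have [_ E1] := is_derive_scalev k (dE w).
by move: E0; rewrite E1 -scalemxAl => /scalerI ->; rewrite // gt_eqF.
Qed.

Lemma nb_metric0 a b : metric E 0 a b = dotv (a *m B) (b *m B).
Proof. by rewrite (metric_dot (lp_open lp) (lp_Ck lp) _ _ nb_V0) !nb_derive0. Qed.

(** In its own chart the radial geodesic is the straight line [t x'], so the geodesic equation
    reduces to its Christoffel term. *)
Lemma nb_ray x : V x -> Gamv E x x x = 0.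
Proof.
move=> Vx; have [r /andP[r0 r1] [x' Vx' xE]] := nb_shrink Vx.
have [e [c [e0 g c0 dc h]]] := nb_curve Vx'.
have r01 : 0 <= r <= 1 by rewrite !ltW.
have rI : r \in `]- e, 1 + e[ by rewrite in_itv /=; apply/andP; split; lra.
have cr : c r = E x by rewrite h // -xE.
have Ur : U (c r) by rewrite cr; case: (lp_in lp Vx).
have [N [oN Nr _ NMU [Cu ode]]] := geo_chart lp g rI Ur.
pose N' := N `&` `]0, 1[%classic.
have oN' : open N' by apply: openI => //; exact: open_itvoo.
have N'r : N' r by split => //; rewrite /= in_itv /= r0.
have V't t : 0 <= t <= 1 -> V (t *: x').
  move=> /andP[t0 t1]; rewrite /V /= -scalemxAl enormZ ger0_norm //.
  by apply: le_lt_trans Vx'; rewrite ler_piMl // enorm_ge0.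
have uE t : N' t -> (K \o c) t = t *: x'.
  move=> [_]; rewrite /= in_itv /= => /andP[t0 t1].
  by rewrite /= h ?ltW // (lp_K lp) //; apply: V't; rewrite !ltW.
have du t : N' t -> 'D_1 (K \o c) t = x'.
  move=> N't; have [_] : is_derive t 1 (K \o c) x' => //.
  apply: (@is_derive_near _ _ _ (fun t : R => t *: x') _ _ _ _ N') => //.
    by move=> y /uE ->.
  rewrite (_ : (fun t => _) = fun t : R => 0 + t *: x'); last by apply/funext => y; rewrite add0r.
  by apply/(is_derive_lineP (fun y : 'rV[R]_d => y)); exact: is_derive_id.
have h0 : is_derive r 1 ('D_1 (K \o c)) 0.
  by apply: (is_derive_near oN' N'r _ (is_derive_fcst x' r 1)) => y /du ->.
have [Nr' _] := N'r.
have := is_derive_uniq (ode _ Nr') h0; rewrite du // cr (lp_K lp) // => /eqP.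
by rewrite oppr_eq0 xE => /eqP G0; rewrite Gamv_symZ G0 scaler0.
Qed.

Lemma nb_coords : normal_coords V (metric E) (Gamv E) (dGamv E).
Proof.
have oV := lp_open lp; have CE := lp_Ck lp; have imm := @lp_imm _ _ _ _ _ _ _ _ lp.
split => //.
- move=> x t Vx /andP[t0 t1]; rewrite /V /= -scalemxAl enormZ ger0_norm //.
  by apply: le_lt_trans Vx; rewrite ler_piMl // enorm_ge0.
- by move=> x a b _; exact: metric_sym.
- by move=> x t u v w _; exact: metric_lin.
- by move=> x a Vx; exact: (metric_pos oV CE imm).
- by move=> x a b _; exact: Gamv_sym.
- by move=> x t u v w _; exact: Gamv_lin.
- by move=> x c a b Vx; exact: (metric_deriv oV CE imm).
- by move=> x c a b Vx; exact: (Gamv_deriv oV CE imm).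
- by move=> x; exact: nb_ray.
Qed.

Lemma nb_radial x : V x -> metric E x x x = enorm (x *m B) ^+ 2.
Proof. by move=> Vx; rewrite (nc_radial nb_coords Vx) nb_metric0 enorm_sq. Qed.

Lemma nb_gauss x w : V x -> metric E x x w = dotv (x *m B) (w *m B).
Proof. by move=> Vx; rewrite (nc_gauss nb_coords) // nb_metric0. Qed.

Lemma nb_riem_dep x k b : V x -> riem_op (Gamv E) (dGamv E) x (k *: b) b b = 0.
Proof.
move=> Vx; rewrite /riem_op.
have h1 := nc_dG nb_coords (k *: b) b b Vx; have [h2 h2'] := nc_dG nb_coords b b b Vx.
have h3 := is_derive_scalev k h2; rewrite h2' in h3.
rewrite (is_derive_uniq h1 h3) (nc_dGZl nb_coords) // (nc_GZl nb_coords) //.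
rewrite [Gamv E x (k *: b) b](nc_GZl nb_coords) // (nc_GZr nb_coords) //.
by rewrite subrr add0r subrr.
Qed.

Lemma nb_riem0 x w : V x -> riem_op (Gamv E) (dGamv E) x w 0 0 = 0.
Proof.
move=> Vx; rewrite /riem_op.
have H := nb_coords.
have := nc_dGZl H w 0 0 0 Vx; rewrite !scale0r => ->.
have := nc_dGZr H 0 0 0 w Vx; rewrite !scale0r => ->.
by rewrite !(nc_G0l H) // !(nc_G0r H) // !subrr addr0 subrr.
Qed.

(** Pairs that span no plane escape the curvature bounds; for them [v] vanishes or [w] is a multiple
    of [v], and antisymmetry of the curvature gives zero. *)
Lemma nb_dep x w v : V x ->
  metric E x w w * metric E x v v - metric E x w v ^+ 2 <= 0 ->
  riem_op (Gamv E) (dGamv E) x w v v = 0.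
Proof.
have H := nb_coords; move=> Vx D0; have [->|v0] := eqVneq v 0; first exact: nb_riem0.
have gv := nc_pos H Vx v0.
pose k := metric E x w v / metric E x v v.
suff -> : w = k *: v by exact: nb_riem_dep.
apply/eqP; rewrite -subr_eq0; apply/eqP; apply: contrapT => /eqP wk.
have := nc_pos H Vx wk.
rewrite !(nc_gDl H) // !(nc_gNl H) // !(nc_gDr H) // !(nc_gNr H) //.
rewrite !(nc_gZl H) // !(nc_gZr H) // (nc_sym H v w Vx).
have -> : metric E x w w + - (k * metric E x w v) - (k * metric E x w v + - (k * (k * metric E x v v)))
  = (metric E x w w * metric E x v v - metric E x w v ^+ 2) / metric E x v v.
  by rewrite /k; field; rewrite gt_eqF.
by rewrite pmulr_lgt0 ?invr_gt0 // => /lt_le_trans /(_ D0); rewrite ltxx.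
Qed.

Lemma nb_sec_upper x w v (k : R) : V x -> 0 <= k -> (kappa_u d M <= k%:E)%E ->
  metric E x (riem_op (Gamv E) (dGamv E) x w v v) w <= k * (metric E x v v * metric E x w w).
Proof.
move=> Vx k0 kk; have H := nb_coords.
have gg : 0 <= metric E x v v * metric E x w w by rewrite mulr_ge0 // (nc_ge0 H).
have [D0|D0] := leP (metric E x w w * metric E x v v - metric E x w v ^+ 2) 0.
  by rewrite nb_dep // (nc_g0l H) // mulr_ge0.
have /andP[_ h] := sec_bounds lp Vx D0; have := le_trans h kk.
rewrite lee_fin /sec_coord (curvature_opE (lp_open lp) (lp_Ck lp) (@lp_imm _ _ _ _ _ _ _ _ lp)) //.
rewrite ler_pdivrMr // => /le_trans; apply; rewrite ler_wpM2l // mulrC.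
by rewrite lerBlDr lerDl sqr_ge0.
Qed.

Lemma nb_sec_lower x w v (l : R) : V x -> l <= 0 -> (l%:E <= kappa_l d M)%E ->
  l * (metric E x v v * metric E x w w) <= metric E x (riem_op (Gamv E) (dGamv E) x w v v) w.
Proof.
move=> Vx l0 ll; have H := nb_coords.
have gg : 0 <= metric E x v v * metric E x w w by rewrite mulr_ge0 // (nc_ge0 H).
have [D0|D0] := leP (metric E x w w * metric E x v v - metric E x w v ^+ 2) 0.
  by rewrite nb_dep // (nc_g0l H) // mulr_le0_ge0.
have /andP[h _] := sec_bounds lp Vx D0; have := le_trans ll h.
rewrite lee_fin /sec_coord (curvature_opE (lp_open lp) (lp_Ck lp) (@lp_imm _ _ _ _ _ _ _ _ lp)) //.
rewrite ler_pdivlMr // => h'; apply: le_trans h'; rewrite ler_wnM2l // mulrC.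
by rewrite lerBlDr lerDl sqr_ge0.
Qed.

Lemma nb_speed_ray x t : V x -> 0 < t <= 1 ->
  V (t *: x) /\ metric E (t *: x) x x = enorm (x *m B) ^+ 2.
Proof.
move=> Vx /andP[t0 t1]; have H := nb_coords.
have Vt : V (t *: x) by apply: (nc_star H) => //; rewrite ltW.
split => //; have := nb_radial Vt.
rewrite (nc_gZl H) // (nc_gZr H) // -scalemxAl enormZ exprMn (gtr0_norm t0) mulrA -expr2.
by apply: mulfI; rewrite gt_eqF // exprn_gt0.
Qed.

Lemma nb_hess x (k k' : R) : V x -> 0 <= k -> (kappa_u d M <= (k ^+ 2)%:E)%E ->
  k * enorm (x *m B) < k' -> k' < pi / 2 ->
  forall w, cos k' * metric E x w w <= metric E x w w + metric E x (Gamv E x x w) w.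
Proof.
move=> Vx k0 kk kx k'p; apply: (nc_hess_lower nb_coords Vx _ k'p (k := k * enorm (x *m B))).
  by rewrite mulr_ge0 ?enorm_ge0.
move=> t w t01; have [Vt gt] := nb_speed_ray Vx t01.
apply: le_trans (nb_sec_upper w x Vt _ kk) _; first exact: sqr_ge0.
by rewrite gt exprMn mulrA.
Qed.

(** [nc_rauch] with [nu = pi], admissible by the bound on [x]; then [sinh pi <= 4 pi], and
    [16 = 4^2]. *)
Lemma nb_rauch x (l : R) : V x -> l <= 0 -> (l%:E <= kappa_l d M)%E ->
  - l * enorm (x *m B) ^+ 2 < pi ^+ 2 ->
  forall w, metric E x w w <= 16 * metric E 0 w w.
Proof.
move=> Vx l0 ll lx w; have H := nb_coords.
have pi0 : (0 : R) < pi by exact: pi_gt0.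
have := nc_rauch H Vx pi0 (_ : forall t w, _ -> _ -> _); move/(_ _ w) => h.
have {}h : pi ^+ 2 * metric E x w w <= sinhR pi ^+ 2 * metric E 0 w w.
  apply: h => t {}w t01 w0; have [Vt gt] := nb_speed_ray Vx t01.
  apply: lt_le_trans (nb_sec_lower w x Vt l0 ll).
  have gw := nc_pos H Vt w0.
  by rewrite gt ltrNl -!mulNr mulrA ltr_pM2r // mulNr.
have sh0 : 0 <= sinhR (pi : R) := le_trans (ltW pi0) (sinhR_ge (ltW pi0)).
have s4 : sinhR (pi : R) ^+ 2 <= (4 * pi) ^+ 2.
  have p4 : 0 <= 4 * pi :> R by rewrite mulr_ge0 // ltW.
  by rewrite (ler_sqr sh0 p4); apply: sinhR_le4; rewrite lexx ltW.
have g0 : 0 <= metric E 0 w w by apply: (nc_ge0 H); exact: nb_V0.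
rewrite -(ler_pM2l (_ : 0 < pi ^+ 2)) ?exprn_gt0 //.
apply: le_trans h _; apply: le_trans (ler_wpM2r g0 s4) _.
by rewrite [leLHS](_ : _ = pi ^+ 2 * (16 * metric E 0 w w)) //; ring.
Qed.

End NC.
End NormalChartGeometry.

(** * Length of curves *)

Section Curves.
Context {R : realType}.
Implicit Types (s t e r : R).
Notation mu := (@lebesgue_measure R).

Lemma dotv_cauchy n (u v : 'rV[R]_n) : dotv u v ^+ 2 <= dotv u u * dotv v v.
Proof.
have [->|v0] := eqVneq v 0.
  by rewrite -(scale0r (0 : 'rV[R]_n)) dotvC !dotvZl !mul0r mulr0 expr0n.
have gv := dotv_gt0 v0; pose k := dotv u v / dotv v v.
have := dotv_ge0 (u - k *: v).
rewrite !dotvDl !dotvNl ![dotv _ (_ - _)]dotvC !dotvDl !dotvNl !dotvZl.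
rewrite ![dotv _ (_ *: _)]dotvC !dotvZl [dotv v u]dotvC.
have -> : dotv u u - k * dotv u v - (k * dotv u v - k * (k * dotv v v)) =
  (dotv u u * dotv v v - dotv u v ^+ 2) / dotv v v by rewrite /k; field; rewrite gt_eqF.
by rewrite pmulr_lge0 ?invr_gt0 // subr_ge0.
Qed.

Lemma dotv_le_enorm n (u v : 'rV[R]_n) : dotv u v <= enorm u * enorm v.
Proof.
apply: le_trans (ler_norm _) _; rewrite -ler_sqr ?nnegrE ?mulr_ge0 ?enorm_ge0 //.
by rewrite real_normK ?num_real // exprMn !enorm_sq dotv_cauchy.
Qed.

Lemma enormD n (u v : 'rV[R]_n) : enorm (u + v) <= enorm u + enorm v.
Proof.
rewrite -ler_sqr ?nnegrE ?addr_ge0 ?enorm_ge0 // sqrrD !enorm_sq.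
rewrite dotvDl ![dotv _ (_ + _)]dotvC !dotvDl [dotv v u]dotvC.
by have := dotv_le_enorm u v; lra.
Qed.

Lemma enorm_continuous (T : topologicalType) n (f : T -> 'rV[R]_n) x :
  {for x, continuous f} -> {for x, continuous (fun y => enorm (f y))}.
Proof.
move=> cf; apply: (@continuous_comp _ _ _ (fun y => dotv (f y) (f y))).
  exact: dotv_continuous.
exact: sqrt_continuous.
Qed.

Lemma dotv_continuous2 (T : topologicalType) n (f g : T -> 'rV[R]_n) x :
  {for x, continuous f} -> {for x, continuous g} ->
  {for x, continuous (fun y => dotv (f y) (g y))}.
Proof.
move=> cf cg; rewrite /prop_for /continuous_at /dotv; apply: cvg_big => //.
  exact: add_continuous.
by move=> i _; apply: cvgM; [exact: cvg_coord_mx cf|exact: cvg_coord_mx cg].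
Qed.

Lemma left_lim_closed (T : topologicalType) (f : R -> T) (A : set T) t e : closed A -> 0 < e ->
  {for t, continuous f} -> (forall s, t - e < s < t -> A (f s)) -> A (f t).
Proof.
move=> cA e0 cf h; apply: (@closed_cvg _ _ (t^'-) _ f A cA) (cvg_at_left_filter cf).
near=> s; apply: h; apply/andP; split.
  by near: s; apply: nbhs_left_gt; rewrite ltrBlDr ltrDl.
by near: s; exact: nbhs_left_lt.
Unshelve. all: by end_near. Qed.

Lemma partition_right (a b t : R) (s : seq R) : path <%O a s -> last a s = b -> a <= t < b ->
  exists2 i, (i < size s)%N & nth 0 (a :: s) i <= t < nth 0 (a :: s) i.+1.
Proof.
elim: s a => [|y s IH] a /=; first by move=> _ -> /andP[/le_lt_trans h /h]; rewrite ltxx.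
move=> /andP[ay ys] lb /andP[at_ tb]; have [ty|yt] := ltP t y.
  by exists 0%N => //=; rewrite at_.
have [|i si hi] := IH y ys lb; first by rewrite yt.
by exists i.+1.
Qed.

Lemma partition_left (a b t : R) (s : seq R) : path <%O a s -> last a s = b -> a < t <= b ->
  exists2 i, (i < size s)%N & nth 0 (a :: s) i < t <= nth 0 (a :: s) i.+1.
Proof.
elim: s a => [|y s IH] a /=; first by move=> _ -> /andP[/lt_le_trans h /h]; rewrite ltxx.
move=> /andP[ay ys] lb /andP[at_ tb]; have [ty|yt] := leP t y.
  by exists 0%N => //=; rewrite at_.
have [|i si hi] := IH y ys lb; first by rewrite yt.
by exists i.+1.
Qed.

(** At a breakpoint a curve has only one-sided smooth extensions; the right one serves the step
    hypothesis of [real_induction], and that of [smooth_left] its limit hypothesis. *)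
Lemma smooth_right m (c : R -> 'rV[R]_m) t : piecewise_smooth c -> 0 <= t < 1 ->
  exists e (F : R -> 'rV[R]_m) (W : set R), [/\ 0 < e, open W, forall k, Ck k W F &
    forall s, t <= s < t + e -> W s /\ c s = F s].
Proof.
move=> [s [ps /eqP ls] sm] t01; have [i si /andP[ai bi]] := partition_right ps ls t01.
have [|W [F [oW Wt CF FE]]] := sm i si t; first by rewrite /= in_itv /= ai ltW.
have /nbhs_ballP[e /= e0 he] := open_nbhs_nbhs (conj oW Wt).
exists (Num.min e (nth 0 (0 :: s) i.+1 - t)), F, W; split => //.
  by rewrite lt_min e0 subr_gt0.
move=> r /andP[tr]; rewrite -ltrBlDl lt_min => /andP[re rb].
have Wr : W r by apply: he; rewrite /ball /= distrC ger0_norm // subr_ge0.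
by split => //; rewrite FE //= in_itv /= (le_trans ai) //= ltW // -(ltrD2r (- t)).
Qed.

Lemma smooth_left m (c : R -> 'rV[R]_m) t : piecewise_smooth c -> 0 < t <= 1 ->
  exists e (F : R -> 'rV[R]_m) (W : set R), [/\ 0 < e, open W, forall k, Ck k W F &
    forall s, t - e < s <= t -> W s /\ c s = F s].
Proof.
move=> [s [ps /eqP ls] sm] t01; have [i si /andP[ai bi]] := partition_left ps ls t01.
have [|W [F [oW Wt CF FE]]] := sm i si t; first by rewrite /= in_itv /= bi ltW.
have /nbhs_ballP[e /= e0 he] := open_nbhs_nbhs (conj oW Wt).
exists (Num.min e (t - nth 0 (0 :: s) i)), F, W; split => //.
  by rewrite lt_min e0 subr_gt0.
move=> r /andP[]; rewrite ltrBlDr -ltrBlDl lt_min => /andP[re rb] rt.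
have Wr : W r by apply: he; rewrite /ball /= ger0_norm // subr_ge0.
split => //; rewrite FE //= in_itv /= (le_trans rt) // andbT ltW //; lra.
Qed.

Lemma derive1_near_eq m (c F : R -> 'rV[R]_m) (W : set R) (a b t : R) : open W ->
  Ck 1 W F -> (forall s, a < s < b -> W s /\ c s = F s) -> a < t < b ->
  derive1 c t = 'D_1 F t.
Proof.
move=> oW CF h tab; have [Wt _] := h _ tab.
have dF : is_derive t 1 F ('D_1 F t) by apply: derivableP; exact: Ck_derivable CF Wt.
rewrite derive1E.
have [_ ->] : is_derive t 1 c ('D_1 F t) => //.
have tI : `]a, b[%classic t by rewrite /= in_itv.
apply: (is_derive_near (@open_itvoo R a b) tI _ dF) => s.
by rewrite /= in_itv /= => /h [_ ->].
Qed.

Lemma speed_measurable_oo m (c F : R -> 'rV[R]_m) (W : set R) (a b : R) : open W ->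
  Ck 1 W F -> (forall s, a < s < b -> W s /\ c s = F s) ->
  measurable_fun `]a, b[%classic (fun t : R => enorm (derive1 c t)).
Proof.
move=> oW CF h.
apply: (@eq_measurable_fun _ _ _ _ `]a, b[%classic (fun t => enorm ('D_1 F t))).
  by move=> t; rewrite inE /= in_itv /= => tab; rewrite (derive1_near_eq oW CF h tab).
apply: open_continuous_measurable_fun; first exact: open_itvoo.
move=> t; rewrite inE /= in_itv /= => /h [Wt _].
have cD : {for t, continuous ('D_1 F)} := Ck_cont (Ck_D1 CF) Wt.
exact: (enorm_continuous cD).
Qed.

Lemma measurable_fun_ext (f : R -> R) (a b : R) : 0 <= a -> a < b ->
  measurable_fun `[0, a]%classic f -> measurable_fun `]a, b[%classic f ->
  measurable_fun `[0, b]%classic f.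
Proof.
move=> a0 ab m1 m2.
have -> : `[0, b]%classic = `[0, a]%classic `|` (`]a, b[%classic `|` [set b]).
  apply/seteqP; split=> r /=; rewrite !in_itv /=.
    move=> /andP[r0 rb]; have [ra|ar] := leP r a; first by left; rewrite r0.
    by right; have [->|rb'] := eqVneq r b; [right|left; rewrite lt_neqAle rb'].
  move=> [/andP[-> ra]|[/andP[ar rb]|->]] /=.
  - by rewrite (le_trans ra) // ltW.
  - by rewrite (ltW rb) andbT (le_trans a0) // ltW.
  - by rewrite lexx andbT (le_trans a0) // ltW.
have mU : measurable (`]a, b[%classic `|` [set b]) by apply: measurableU.
apply/measurable_funU => //; split => //.
apply/measurable_funU => //; split => //; exact: measurable_fun_set1.
Qed.

(** Measurability is what allows the length integral to be split at a parameter. As [derive1 c] is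
    uncontrolled at breakpoints, the interval is built up from open pieces and single points. *)
Lemma speed_measurable m (c : R -> 'rV[R]_m) : piecewise_smooth c ->
  measurable_fun `[0 : R, 1 : R]%classic (fun t => enorm (derive1 c t)).
Proof.
move=> pc; set f := fun t => _.
suff h : forall t : R, 0 <= t <= 1 -> measurable_fun `[0, t]%classic f.
  by apply: h; rewrite lexx ler01.
apply: real_induction.
- by rewrite set_itv1; exact: measurable_fun_set1.
- move=> t t01 hs; have [e [F [W [e0 oW CF h]]]] := smooth_right pc t01.
  have /andP[t0 t1] := t01.
  exists e => // s /andP[ts se] s1; apply: (measurable_fun_ext t0 ts).
    by apply: hs; rewrite t0 lexx.
  apply: (speed_measurable_oo oW (CF 1)) => r /andP[tr rs]; apply: h.
  by rewrite ltW //= (lt_trans rs).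
- move=> t t01 hs; have [e [F [W [e0 oW CF h]]]] := smooth_left pc t01.
  have /andP[t0 t1] := t01.
  have at_ : Num.max 0 (t - e) < t by rewrite gt_max t0 ltrBlDr ltrDl.
  have a0 : 0 <= Num.max 0 (t - e) by rewrite le_max lexx.
  apply: (measurable_fun_ext a0 at_); first by apply: hs; rewrite a0.
  apply: (speed_measurable_oo oW (CF 1)) => r /andP[tr rs]; apply: h.
  by rewrite (ltW rs) andbT (le_lt_trans _ tr) // le_max lexx orbT.
Qed.

Lemma curve_length_le m (g : R -> 'rV[R]_m) (O : set R) (C : R) : open O ->
  (forall t, 0 <= t <= 1 -> O t) -> (forall k, Ck k O g) -> 0 <= C ->
  (forall t, 0 <= t <= 1 -> enorm ('D_1 g t) <= C) ->
  (curve_length g <= C%:E)%E.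
Proof.
move=> oO hO Cg C0 hC; rewrite /curve_length.
have cst_int : mu.-integrable `[0, 1]%classic (EFin \o (cst C : R -> R)).
  apply: continuous_compact_integrable; first exact: segment_compact.
  by apply: continuous_subspaceT => x; exact: cvg_cst.
have g_int : mu.-integrable `[0, 1]%classic (EFin \o (fun t => enorm (derive1 g t))).
  apply: continuous_compact_integrable; first exact: segment_compact.
  apply: continuous_in_subspaceT => t; rewrite inE /= in_itv /= => /hO Ot.
  have -> : derive1 g = 'D_1 g by apply/funext => r; rewrite derive1E.
  have cD : {for t, continuous ('D_1 g)} := Ck_cont (Ck_D1 (Cg 1)) Ot.
  exact: (enorm_continuous cD).
apply: le_trans (le_integral _ g_int cst_int _) _.
- exact: measurable_itv.
- by move=> t; rewrite inE /= in_itv /= => t01; rewrite lee_fin derive1E; exact: hC.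
rewrite [X in (X <= _)%E](_ : _ = C%:E * mu `[0%R, 1%R]%classic)%E; last first.
  exact: (integral_cst mu (measurable_itv _) C%:E).
by rewrite lebesgue_measure_itv /= lte_fin ltr01 oppr0 adde0 mule1.
Qed.

Lemma geodist_le m (M : set 'rV[R]_m) (g : R -> 'rV[R]_m) (O : set R) (C : R) : open O ->
  (forall t, 0 <= t <= 1 -> O t) -> (forall k, Ck k O g) -> 0 <= C ->
  (forall t, 0 <= t <= 1 -> M (g t)) ->
  (forall t, 0 <= t <= 1 -> enorm ('D_1 g t) <= C) ->
  (geodist M (g 0%R) (g 1%R) <= C%:E)%E.
Proof.
move=> oO hO Cg C0 Mg hC; apply: le_trans (curve_length_le oO hO Cg C0 hC).
apply: ereal_inf_lbound; exists g => //; split => //.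
exists [:: 1]; first by split => //=; rewrite ltr01.
move=> [|i] //= _ t; rewrite /= in_itv /= => /hO Ot.
by exists O, g.
Qed.

End Curves.

Lemma mulmxr_continuous (R : realType) (T : topologicalType) n1 n2 (B : 'M[R]_(n1, n2))
  (X : T -> 'rV[R]_n1) (t : T) :
  {for t, continuous X} -> {for t, continuous (fun r => X r *m B)}.
Proof.
move=> cX; have cB : {for X t, continuous (fun x : 'rV[R]_n1 => x *m B)}.
  exact: (Ck_cont (Ck_mulmxr B openT (Ck_id 0 openT)) (I : setT (X t))).
exact: (@continuous_comp _ _ _ X (fun x : 'rV[R]_n1 => x *m B) t cX cB).
Qed.

Lemma is_derive_curve_mulmxr (R : realType) n1 n2 (B : 'M[R]_(n1, n2)) (X : R -> 'rV[R]_n1)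
  X' (t : R) : is_derive t 1 X X' -> is_derive t 1 (fun r => X r *m B) (X' *m B).
Proof.
move=> dX; apply: is_derive_rV => i; rewrite mxE.
rewrite (_ : (fun r : R => _) = fun r => \sum_j X r 0 j * B j i); last first.
  by apply/funext => r; rewrite mxE.
apply: is_derive_fS => j.
apply: (is_derive_eq (is_derive_fM (is_derive_coord j dX) (is_derive_fcst (B j i) t (1 : R)))).
by rewrite mulr0 add0r mulrC.
Qed.

(** * The chart radius against arc length *)

Section RadialDistance.
Context {R : realType} {m d : nat} {M : set 'rV[R]_m} (hM : embedded_submanifold d M).
Context {p : 'rV[R]_m} {s : R} {B : 'M[R]_(d, m)} {U : set 'rV[R]_m}
  {K : 'rV[R]_m -> 'rV[R]_d} (nb : normal_chart (M := M) p s B U K).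
Implicit Types (x w u v : 'rV[R]_d) (t e : R).
Notation mu := (@lebesgue_measure R).

Let V := [set x : 'rV[R]_d | enorm (x *m B) < s].
Let E x := Exp d M p (x *m B).
Let lp : local_param M V U E K := nb_lp nb.

Lemma nb_metric_dot x w : V x -> metric E x w w = enorm ('D_w E x) ^+ 2.
Proof. by move=> Vx; rewrite (metric_dot (lp_open lp) (lp_Ck lp)) // enorm_sq. Qed.

Lemma enorm_ball_convex u w t : V u -> V w -> 0 <= t <= 1 -> V (u + t *: (w - u)).
Proof.
move=> hu hw /andP[t0 t1]; have -> : u + t *: (w - u) = (1 - t) *: u + t *: w.
  by apply/rowP => i; rewrite !mxE; ring.
rewrite /V /= mulmxDl -!scalemxAl; apply: le_lt_trans (enormD _ _) _.
rewrite !enormZ ger0_norm ?subr_ge0 // (ger0_norm t0).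
have [->|t1'] := eqVneq t 1; first by rewrite subrr mul0r add0r mul1r.
have t1'' : 0 < 1 - t by rewrite subr_gt0 lt_neqAle t1'.
have h1 : (1 - t) * enorm (u *m B) < (1 - t) * s by rewrite ltr_pM2l.
have h2 : t * enorm (w *m B) <= t * s by rewrite ler_wpM2l // ltW.
by apply: lt_le_trans (ltr_leD h1 h2) _; rewrite -mulrDl subrK mul1r.
Qed.

Lemma nb_geodist_line u w (C : R) : V u -> V w -> 0 <= C ->
  (forall t, 0 <= t <= 1 -> metric E (u + t *: (w - u)) (w - u) (w - u) <= C ^+ 2) ->
  (geodist M (E u) (E w) <= C%:E)%E.
Proof.
move=> Vu Vw C0 hC; pose l t := u + t *: (w - u).
have lV t : 0 <= t <= 1 -> V (l t) by exact: enorm_ball_convex.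
pose O := setT `&` l @^-1` V.
have Cl k : Ck k [set: R] l by exact: (Ck_line k u (w - u) openT).
have oO : open O := open_preimage_on openT (lp_open lp) (fun t h => Ck_cont (Cl 0) h).
have OV t : O t -> V (l t) by case.
have CO k : Ck k O (E \o l).
  by apply: (Ck_comp_mx oO (lp_open lp) OV _ (lp_Ck lp k)); apply: Ck_sub (Cl k).
have := @geodist_le _ _ M (E \o l) O C oO _ CO C0.
rewrite /= /l scale0r addr0 scale1r [u + (w - u)]addrC subrK; apply.
- by move=> t /lV.
- by move=> t /lV Vt; have [] := lp_in lp Vt.
move=> t t01; have Vl := lV _ t01.
have [_ ->] : is_derive t 1 (E \o l) ('D_(w - u) E (l t)).
  by apply: is_derive_line; exact: Ck_derivable (lp_Ck lp 1) Vl.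
rewrite -ler_sqr ?nnegrE ?enorm_ge0 // -nb_metric_dot //; exact: hC.
Qed.

Lemma nb_speed_ray0 v t : V v -> 0 <= t <= 1 -> metric E (t *: v) v v = enorm (v *m B) ^+ 2.
Proof.
move=> Vv /andP[t0 t1]; have [->|t0'] := eqVneq t 0.
  by rewrite scale0r (nb_metric0 hM nb) enorm_sq.
by case: (nb_speed_ray hM nb Vv (t := t)); rewrite // lt_neqAle eq_sym t0' t0.
Qed.

Lemma nb_E0 : E 0 = p.
Proof.
have [e [c [e0 g c0 dc h]]] := nb_curve hM nb (nb_V0 nb).
by rewrite -c0 h ?lexx ?ler01 // scale0r.
Qed.

Lemma nb_radial_out v : V v -> (geodist M p (E v) <= (enorm (v *m B))%:E)%E.
Proof.
move=> Vv; rewrite -nb_E0; apply: nb_geodist_line => //; first exact: (nb_V0 nb).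
  exact: enorm_ge0.
by move=> t t01; rewrite add0r subr0 nb_speed_ray0.
Qed.

Lemma nb_radial_in v : V v -> (geodist M (E v) p <= (enorm (v *m B))%:E)%E.
Proof.
move=> Vv; rewrite -nb_E0; apply: nb_geodist_line => //; first exact: (nb_V0 nb).
  exact: enorm_ge0.
move=> t /andP[t0 t1]; have -> : v + t *: (0 - v) = (1 - t) *: v.
  by apply/rowP => i; rewrite !mxE; ring.
have t01 : 0 <= 1 - t <= 1 by rewrite subr_ge0 t1 gerBl.
have H := nb_coords hM nb; have Vt : V ((1 - t) *: v) by exact: (nc_star H).
by rewrite sub0r (nc_gNl H) // (nc_gNr H) // opprK nb_speed_ray0.
Qed.

Section Delta.
Context (delta : R) (delta0 : 0 < delta).

(* The smoothing [delta] makes the radius differentiable at the centre. *)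
Definition hd x := Num.sqrt (dotv (x *m B) (x *m B) + delta ^+ 2).

Lemma hd_gt0 x : 0 < dotv (x *m B) (x *m B) + delta ^+ 2.
Proof. by rewrite ltr_wpDl ?dotv_ge0 // exprn_gt0. Qed.

Lemma hd_pos x : 0 < hd x.
Proof. by rewrite /hd sqrtr_gt0; exact: hd_gt0. Qed.

Lemma hd_ge x : enorm (x *m B) <= hd x.
Proof. by rewrite ler_wsqrtr // lerDl sqr_ge0. Qed.

Lemma hd_le x : hd x <= enorm (x *m B) + delta.
Proof.
rewrite -ler_sqr ?nnegrE ?sqrtr_ge0 ?addr_ge0 ?enorm_ge0 ?(ltW delta0) //.
rewrite sqr_sqrtr ?(ltW (hd_gt0 x)) // sqrrD enorm_sq.
by have := mulr_ge0 (enorm_ge0 (x *m B)) (ltW delta0); lra.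
Qed.

Lemma hd_deriv (X : R -> 'rV[R]_d) X' t : is_derive t 1 X X' ->
  is_derive t 1 (fun r => hd (X r)) (dotv (X t *m B) (X' *m B) / hd (X t)).
Proof.
move=> dX.
have dXB := is_derive_curve_mulmxr B dX.
have dq := is_derive_fD (dotv_deriv dXB dXB) (is_derive_fcst (delta ^+ 2) t (1 : R)).
have := is_derive_compR dq (is_derive1_sqrt (hd_gt0 (X t))).
move=> h; apply: (is_derive_eq h); rewrite addr0 [LHS]mulrC -/(hd (X t)).
have h0 : hd (X t) != 0 by rewrite gt_eqF // hd_pos.
by field.
Qed.

Lemma hd_cont (T : topologicalType) (X : T -> 'rV[R]_d) (t : T) :
  {for t, continuous X} -> {for t, continuous (fun r => hd (X r))}.
Proof.
move=> cX; have cXB := mulmxr_continuous (B := B) cX.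
have c1 : {for t, continuous (fun r => dotv (X r *m B) (X r *m B) + delta ^+ 2)}.
  exact: (cvgD (dotv_continuous cXB) (cvg_cst (delta ^+ 2))).
exact: (continuous_comp c1 (@sqrt_continuous R _)).
Qed.

(** The Gauss lemma and the Cauchy-Schwarz inequality of the metric at [x]; the left-hand side is
    the derivative of [hd] in the direction [w]. *)
Lemma nb_speed_bound x w : V x -> dotv (x *m B) (w *m B) / hd x <= enorm ('D_w E x).
Proof.
move=> Vx; have H := nb_coords hM nb.
have h0 := hd_pos x.
rewrite ler_pdivrMr //; apply: le_trans (ler_norm _) _.
rewrite -ler_sqr ?nnegrE ?mulr_ge0 ?enorm_ge0 ?(ltW h0) //.
rewrite real_normK ?num_real // exprMn -nb_metric_dot // -(nb_gauss hM nb w Vx).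
apply: le_trans (nc_cauchy H x w Vx) _; rewrite mulrC ler_wpM2l //; first exact: (nc_ge0 H).
rewrite (nb_radial hM nb Vx) ler_sqr ?nnegrE ?enorm_ge0 ?(ltW h0) //; exact: hd_ge.
Qed.

(* By the Gauss lemma the radius grows at most as fast as arc length; [F] extends
   the piece of [c] that starts at [t] smoothly across [t]. *)
Lemma nb_right_step (c F : R -> 'rV[R]_m) (W : set R) (t e : R) x0 : open W ->
  (forall k, Ck k W F) -> 0 < e -> (forall r, t <= r < t + e -> W r /\ c r = F r) ->
  (forall r, t <= r < t + e -> M (c r)) -> V x0 -> c t = E x0 ->
  exists2 e1 : R, 0 < e1 & forall r, t < r < t + e1 -> exists x, [/\ V x, c r = E x &
    ((hd x - hd x0)%:E <= \int[mu]_(y in `]t, r[%classic) (enorm (derive1 c y))%:E)%E].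
Proof.
move=> oW CF e0 hF Mc Vx0 ctE.
have tte : t <= t < t + e by rewrite lexx ltrDl.
have [Wt ctF] := hF _ tte; have Mt := Mc _ tte.
have Ut : U (c t) by rewrite ctE; case: (lp_in lp Vx0).
have [U' [Psi [oU' U't sU CP PE]]] := lp_ext lp Mt Ut.
pose N := W `&` F @^-1` U'.
have oN : open N := open_preimage_on oW oU' (fun r h => Ck_cont (CF 0) h).
have Nt : N t by split => //; rewrite /= -ctF.
have /nbhs_ballP[e2 /= e20 he2] := open_nbhs_nbhs (conj oN Nt).
pose e1 := Num.min e e2; have e10 : 0 < e1 by rewrite lt_min e0.
have NI r : t <= r < t + e1 -> N r /\ t <= r < t + e.
  move=> /andP[tr]; rewrite -ltrBlDl lt_min => /andP[r1 r2]; split.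
    by apply: he2; rewrite /ball /= distrC ger0_norm // subr_ge0.
  by rewrite tr -ltrBlDl.
pose X := Psi \o F.
have CX k : Ck k N X.
  by apply: (Ck_comp_mx oN oU' _ _ (CP k)) => [r []//|]; apply: Ck_sub (CF k) => r [].
have XE r : t <= r < t + e1 -> [/\ V (X r), c r = E (X r) & c r = F r].
  move=> /NI [[Wr U'r] re]; have [_ cF] := hF _ re; have Mr := Mc _ re.
  have U'c : U' (c r) by rewrite cF.
  have XK : X r = K (c r) by rewrite /X /= -cF PE.
  by rewrite XK; split => //; [exact: (lp_inV lp Mr (sU _ U'c))|rewrite (lp_KV lp Mr (sU _ U'c))].
have Xt : X t = x0.
  have tte1 : t <= t < t + e1 by rewrite lexx ltrDl.
  have [V1 h1 _] := XE t tte1.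
  by rewrite -(lp_K lp V1) -h1 ctE (lp_K lp Vx0).
pose X' := 'D_1 X.
have dX r : N r -> is_derive r 1 X (X' r).
  by move=> Nr; apply: derivableP; exact: Ck_derivable (CX 1) Nr.
have DF r : t <= r < t + e1 -> 'D_1 F r = 'D_(X' r) E (X r).
  move=> tr; have [Nr re] := NI _ tr; have [Vr _ _] := XE _ tr.
  have h1 : is_derive r 1 F ('D_1 F r).
    by apply: derivableP; have [Wr _] := Nr; exact: Ck_derivable (CF 1) Wr.
  have h2 : is_derive r 1 (E \o X) ('D_(X' r) E (X r)).
    have [dXr _] := dX _ Nr.
    apply: (is_derive_comp dXr).
    exact: chart_diff (lp_open lp) (lp_Ck lp) _ Vr.
  have [tr1 rt1] := andP tr.
  apply: (is_derive_right_uniq (_ : 0 < t + e1 - r) h1 h2); first by rewrite subr_gt0.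
  move=> y /andP[ry]; rewrite addrC subrK => yt; have ty : t <= y < t + e1 by rewrite (le_trans tr1).
  by have [_ hc <-] := XE _ ty; rewrite hc.
exists e1 => // r /andP[tr re1].
have rI : t <= r < t + e1 by rewrite ltW.
have [Vr cr _] := XE _ rI; exists (X r); split => //.
have inI y : y \in `[t, r] -> t <= y < t + e1.
  by rewrite in_itv /= => /andP[-> yr]; exact: le_lt_trans re1.
pose h y := hd (X y); pose h' y := dotv (X y *m B) (X' y *m B) / hd (X y).
have dh y : t <= y < t + e1 -> is_derive y 1 h (h' y).
  by move=> /NI [Ny _]; apply: hd_deriv; exact: dX.
have ch' : {within `[t, r], continuous h'}.
  apply: continuous_in_subspaceT => y; rewrite inE => /inI /NI [Ny _].
  have cX : {for y, continuous X} := Ck_cont (CX 0) Ny.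
  have cX' : {for y, continuous X'} := Ck_cont (Ck_D1 (CX 1)) Ny.
  have c1 := dotv_continuous2 (mulmxr_continuous (B := B) cX) (mulmxr_continuous (B := B) cX').
  have c2 := hd_cont cX; have h0 : hd (X y) != 0 by rewrite gt_eqF // hd_pos.
  exact: (cvgM c1 (cvgV h0 c2)).
have cF : {within `[t, r], continuous (fun y => enorm ('D_1 F y))}.
  apply: continuous_in_subspaceT => y; rewrite inE => /inI /NI [[Wy _] _].
  have cD : {for y, continuous ('D_1 F)} := Ck_cont (Ck_D1 (CF 1)) Wy.
  exact: (enorm_continuous cD).
have ch y : t <= y < t + e1 -> {for y, continuous h}.
  by move=> /dh; exact: is_derive_continuous.
have LR : derivable_oo_LRcontinuous h t r.
  split.
  - by move=> y ty; have [] := dh y (inI _ (subset_itv_oo_cc ty)).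
  - by apply: cvg_at_right_filter; apply: ch; rewrite lexx ltrDl.
  - by apply: cvg_at_left_filter; exact: ch.
have hE : {in `]t, r[, derive1 h =1 h'}.
  by move=> y ty; have [_ <-] := dh y (inI _ (subset_itv_oo_cc ty)); rewrite derive1E.
have := continuous_FTC2 tr ch' LR hE.
rewrite /h Xt -EFinB => <-.
have ocF : forall y, t < y < r -> W y /\ c y = F y.
  move=> y /andP[ty yr]; have ty1 : t <= y < t + e1 by rewrite ltW //= (lt_trans yr).
  by have [[Wy _] _] := NI _ ty1; have [_ _ ->] := XE _ ty1.
have mF : measurable_fun `]t, r[%classic (fun y => enorm ('D_1 F y)).
  by have := speed_measurable_oo (c := F) oW (CF 1) (_ : forall y, t < y < r -> _);
   rewrite (_ : derive1 F = 'D_1 F); [apply => y /ocF []|apply/funext => z; rewrite derive1E].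
(* The value of [derive1 c] may be meaningless at [t] if that is a breakpoint; the open interval
   discards it. *)
have -> : (\int[mu]_(y in `]t, r[%classic) (enorm (derive1 c y))%:E =
   \int[mu]_(y in `[t, r]%classic) (enorm ('D_1 F y))%:E)%E.
  rewrite [RHS]integral_itv_bndoo; last by apply/measurable_EFinP.
  apply: eq_integral => y; rewrite inE /= in_itv /= => ty.
  by rewrite (derive1_near_eq oW (CF 1) ocF ty).
apply: le_integral.
- exact: measurable_itv.
- exact: continuous_compact_integrable (@segment_compact _ _ _) ch'.
- exact: continuous_compact_integrable (@segment_compact _ _ _) cF.
move=> y; rewrite inE => /inI ty; rewrite lee_fin DF //.
by apply: nb_speed_bound; have [] := XE _ ty.
Qed.

Lemma nb_bounded_compact (r0 : R) : compact [set x : 'rV[R]_d | enorm (x *m B) <= r0].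
Proof.
have cB (x : 'rV[R]_d) : {for x, continuous (fun z : 'rV[R]_d => enorm (z *m B))}.
  have cx : {for x, continuous (fun z : 'rV[R]_d => z)} := @cvg_id _ (nbhs x).
  exact: (enorm_continuous (mulmxr_continuous (B := B) cx)).
pose q : 'M[R]_d := \matrix_(i, j) dotv (delta_mx 0 i *m B) (delta_mx 0 j *m B).
have qE w : qform q w = dotv (w *m B) (w *m B).
  apply: (@qform_bilin _ _ (fun a b => dotv (a *m B) (b *m B))) => r u v z.
    by rewrite mulmxDl -scalemxAl dotv_lin.
  by rewrite mulmxDl -scalemxAl dotvC dotv_lin ![dotv _ (z *m B)]dotvC.
have [w w0|mm m0 hm] := @qform_min _ _ q.
  by rewrite qE dotv_gt0 //; apply: contra w0 => /eqP /(nb_inj nb) ->.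
apply: bounded_closed_compact.
  exists (r0 ^+ 2 / mm + 1); split; first exact: num_real.
  move=> y hy x /= xr; apply: le_trans (ltW hy).
  have [x1|x1] := leP `|x| 1.
    by rewrite (le_trans x1) // lerDr divr_ge0 ?sqr_ge0 // ltW.
  have h1 : `|x| <= `|x| ^+ 2 by rewrite expr2 ler_peMr // ltW.
  have h2 : `|x| ^+ 2 <= r0 ^+ 2 / mm.
    rewrite ler_pdivlMr // mulrC; apply: le_trans (hm x) _; rewrite qE -enorm_sq.
    by rewrite ler_sqr ?nnegrE ?enorm_ge0 // (le_trans _ xr) // enorm_ge0.
  by rewrite (le_trans h1) // (le_trans h2) // lerDl.
apply: (@closed_comp _ _ (fun x : 'rV[R]_d => enorm (x *m B)) [set t | t <= r0]).
  by move=> x _; exact: cB.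
exact: closed_le.
Qed.

(* The point reached cannot leave the chart: before any such time the curve
   stays in the image of a compact ball. *)
Lemma nb_curve_delta (c : R -> 'rV[R]_m) x0 (l : R) : piecewise_smooth c ->
  (forall t, 0 <= t <= 1 -> M (c t)) -> V x0 -> c 0 = E x0 ->
  (curve_length c <= l%:E)%E -> hd x0 + l < s ->
  exists x, [/\ V x, c 1 = E x & hd x <= hd x0 + l].
Proof.
move=> pc Mc Vx0 c0 cl hs.
pose f (t : R) : \bar R := (enorm (derive1 c t))%:E.
have f0 y : (0 <= f y)%E by rewrite lee_fin enorm_ge0.
have mf : measurable_fun `[0 : R, 1 : R]%classic f.
  by apply/measurable_EFinP; exact: speed_measurable.
pose I t := (\int[mu]_(y in `[0%R, t]%classic) f y)%E.
have I0 t : (0 <= I t)%E by apply: integral_ge0 => y _; exact: f0.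
have mfI (A : set R) : A `<=` `[0, 1]%classic -> measurable_fun A f.
  by move=> AI; apply: measurable_funS mf.
have Iadd t r : 0 <= t -> t < r -> r <= 1 ->
    (I t + \int[mu]_(y in `]t, r[%classic) f y <= I r)%E.
  move=> t0 tr r1.
  have sub : `[0, t]%classic `|` `]t, r[%classic `<=` `[0, r]%classic.
    move=> y [|]; rewrite /= !in_itv /= => /andP[y0 yt].
      by rewrite y0 (le_trans yt) // ltW.
    by rewrite (le_trans t0 (ltW y0)) ltW.
  have sub1 : `[0, r]%classic `<=` `[0 : R, 1 : R]%classic.
    by move=> y /=; rewrite !in_itv /= => /andP[-> /le_trans ->].
  have mU : measurable_fun (`[0, t]%classic `|` `]t, r[%classic) f.
    by apply: mfI; apply: subset_trans sub sub1.
  rewrite -ge0_integral_setU //=.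
    apply: ge0_subset_integral => //; first exact: measurableU.
    by apply: mfI.
  rewrite disj_set2E; apply/eqP/seteqP; split=> y //= [].
  by rewrite !in_itv /= => /andP[_ yt] /andP[/lt_le_trans /(_ yt)]; rewrite ltxx.
have Il t : 0 <= t <= 1 -> (I t <= l%:E)%E.
  move=> /andP[t0 t1]; apply: le_trans cl; apply: ge0_subset_integral => //.
  - by move=> y /=; rewrite !in_itv /= => /andP[-> /le_trans ->].
pose P t := exists x, [/\ V x, c t = E x & ((hd x)%:E <= (hd x0)%:E + I t)%E].
suff : P 1.
  move=> [x [Vx c1 hx]]; exists x; split => //; rewrite -lee_fin EFinD.
  by apply: le_trans hx _; rewrite leeD2l // Il // ler01 lexx.
apply: (@real_induction _ 0 1 P); last by rewrite ler01 lexx.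
- by exists x0; split => //; rewrite leeDl.
- move=> t /[dup] t01 /andP[t0 t1] hP; have [|x [Vx ct hx]] := hP t; first by rewrite t0 lexx.
  have [e [F [W [e0 oW CF h]]]] := smooth_right pc t01.
  pose e' := Num.min e (1 - t).
  have e'0 : 0 < e' by rewrite lt_min e0 subr_gt0.
  have inE' r : t <= r < t + e' -> t <= r < t + e /\ r <= 1.
    move=> /andP[tr]; rewrite -ltrBlDl lt_min => /andP[h1 h2]; split.
      by rewrite tr -ltrBlDl.
    by rewrite ltW // -(ltrD2r (- t)).
  have [||e1 e10 he1] := @nb_right_step c F W t e' x oW CF e'0 _ _ Vx ct.
  + by move=> r /inE' [/h].
  + by move=> r /[dup] /andP[tr _] /inE' [_ r1]; apply: Mc; rewrite (le_trans t0).
  exists e1 => // r tr r1; have [y [Vy cr hy]] := he1 r tr; exists y; split => //.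
  have /andP[tr0 _] := tr.
  apply: le_trans (leeD2l (hd x0)%:E (Iadd t r t0 tr0 r1)).
  rewrite addeA; apply: le_trans (leeD hx hy).
  by rewrite -EFinD lee_fin addrC subrK.
- move=> t /[dup] t01 /andP[t0 t1] hP; have [e [F [W [e0 oW CF h]]]] := smooth_left pc t01.
  have tte : t - e < t <= t by rewrite lexx gtrBl e0.
  have [Wt ctF] := h _ tte.
  have t01' : 0 <= t <= 1 by rewrite ltW.
  have [z zE] : exists z, ((hd x0)%:E + I t = z%:E)%E.
    exists (hd x0 + fine (I t)); rewrite EFinD fineK // ge0_fin_numE //.
    by apply: le_lt_trans (Il _ t01') _; exact: ltry.
  have zl : z <= hd x0 + l.
    by rewrite -lee_fin -zE EFinD leeD2l // Il.
  have zs : z < s := le_lt_trans zl hs.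
  pose e2 := Num.min e t; have e20 : 0 < e2 by rewrite lt_min e0.
  have hs2 r : t - e2 < r < t -> exists x, [/\ V x, c r = E x, hd x <= z & c r = F r].
    move=> /andP[]; rewrite ltrBlDr -ltrBlDl lt_min => /andP[h1 h2] rt.
    have r0 : 0 <= r by lra.
    have [|x [Vx cr hx]] := hP r; first by rewrite r0.
    exists x; split => //.
      rewrite -lee_fin -zE; apply: le_trans hx _; rewrite leeD2l //.
      apply: ge0_subset_integral => //.
      + by apply: mfI => y /=; rewrite !in_itv /= => /andP[-> /le_trans ->].
      + by move=> y /=; rewrite !in_itv /= => /andP[-> /le_trans ->] //; exact: ltW.
    by case: (h r); rewrite // ltW // andbT; lra.
  have Kz_V x : enorm (x *m B) <= z -> V x by move=> h1; exact: le_lt_trans h1 zs.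
  have cE : {within [set x : 'rV[R]_d | enorm (x *m B) <= z], continuous E}.
    apply: continuous_in_subspaceT => x; rewrite inE /= => /Kz_V Vx.
    exact: Ck_cont (lp_Ck lp 0) Vx.
  (* Before [t] the curve stays in the image of the compact ball of radius [z < s]; that image is
     closed, so it contains the limit [c t]. *)
  have clE := compact_closed (@norm_hausdorff _ _) (continuous_compact cE (@nb_bounded_compact z)).
  have cFt : {for t, continuous F} := Ck_cont (CF 0) Wt.
  have [x xz xE] : (E @` [set x : 'rV[R]_d | enorm (x *m B) <= z]) (F t).
    apply: (left_lim_closed clE e20 cFt) => r /hs2 [x [Vx cr hx <-]].
    by exists x => //=; exact: le_trans (hd_ge x) hx.
  have Vx := Kz_V _ xz.
  exists x; split => //; first by rewrite ctF.
  rewrite zE lee_fin.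
  have ctx : c t = E x by rewrite ctF.
  have Mt : M (c t) by exact: Mc.
  have Ut : U (c t) by rewrite ctx; case: (lp_in lp Vx).
  have [U' [Psi [oU' U't sU CP PE]]] := lp_ext lp Mt Ut.
  pose N := W `&` F @^-1` U'.
  have oN : open N := open_preimage_on oW oU' (fun r h => Ck_cont (CF 0) h).
  have Nt : N t by split => //; rewrite /= -ctF.
  have /nbhs_ballP[e3 /= e30 he3] := open_nbhs_nbhs (conj oN Nt).
  have cX : {for t, continuous (Psi \o F)}.
    apply: continuous_comp; first exact: cFt.
    by apply: Ck_cont (CP 0) _; rewrite -ctF.
  have XE r : c r = F r -> M (c r) -> N r -> (Psi \o F) r = K (c r).
    by move=> cF Mr [Wr U'r]; rewrite /= -cF PE // cF.
  (* The radius bound passes to the limit through a smooth extension of the chart map, which is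
     continuous along [F]. *)
  have -> : x = (Psi \o F) t by rewrite XE // ctx (lp_K lp Vx).
  have e4 : 0 < Num.min e2 e3 by rewrite lt_min e20.
  have clz : closed [set y : R | y <= z] by exact: closed_le.
  have hlim := left_lim_closed clz e4 (hd_cont cX).
  change ([set y | y <= z] (hd ((Psi \o F) t))).
  apply: hlim => r /andP[]; rewrite ltrBlDr -ltrBlDl lt_min => /andP[h1 h2] rt.
  have [|y [Vy cr hy crF]] := hs2 r; first by rewrite rt andbT; lra.
  have Nr : N r by apply: he3; rewrite /ball /= ger0_norm // subr_ge0 ltW.
  have Mr : M (c r) by rewrite cr; case: (lp_in lp Vy).
  change (hd ((Psi \o F) r) <= z).
  by rewrite (XE r crF Mr Nr) cr (lp_K lp Vy).
Qed.

End Delta.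
(** [nb_curve_delta] for [delta] tending to [0]; the chart point reached does not depend on [delta],
    since the chart is injective. *)
Lemma nb_curve_bound (c : R -> 'rV[R]_m) x0 (l : R) : piecewise_smooth c ->
  (forall t, 0 <= t <= 1 -> M (c t)) -> V x0 -> c 0 = E x0 ->
  (curve_length c <= l%:E)%E -> enorm (x0 *m B) + l < s ->
  exists x, [/\ V x, c 1 = E x & enorm (x *m B) <= enorm (x0 *m B) + l].
Proof.
move=> pc Mc Vx0 c0 cl hs.
have step (de : R) : 0 < de -> enorm (x0 *m B) + de + l < s ->
    exists x, [/\ V x, c 1 = E x & enorm (x *m B) <= enorm (x0 *m B) + de + l].
  move=> de0 hde; have hle := hd_le de0 x0.
  have [|x [Vx c1 hx]] := @nb_curve_delta de de0 c x0 l pc Mc Vx0 c0 cl.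
    by apply: le_lt_trans hde; rewrite lerD2r.
  exists x; split => //; apply: le_trans (hd_ge de x) _; apply: le_trans hx _.
  by rewrite lerD2r.
have [||x [Vx c1 _]] := step ((s - (enorm (x0 *m B) + l)) / 2).
- by rewrite divr_gt0 // subr_gt0.
- by lra.
exists x; split => //; apply/ler_addgt0Pr => de de0.
pose de' := Num.min de ((s - (enorm (x0 *m B) + l)) / 2).
have d'1 : de' <= de by rewrite ge_min lexx.
have d'2 : de' <= (s - (enorm (x0 *m B) + l)) / 2 by rewrite ge_min lexx orbT.
have [||y [Vy c1y hy]] := step de'.
- by rewrite lt_min de0 divr_gt0 // subr_gt0.
- by lra.
have -> : x = y by rewrite -(lp_K lp Vx) -c1 [c 1]c1y (lp_K lp Vy).
by lra.
Qed.

End RadialDistance.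

(** * Distances below the injectivity radius *)

Section LocalDistance.
Context {R : realType} {m d : nat} {M : set 'rV[R]_m} (hM : embedded_submanifold d M).
Context {b : R} (hb : forall p, M p -> good_radius (d := d) (M := M) p b).
Implicit Types (p q y z : 'rV[R]_m) (x w u v : 'rV[R]_d) (t e r rho : R).

Lemma geodist_ge0 p q : (0%:E <= geodist M p q)%E.
Proof.
by apply: le_ereal_inf_tmp => _ [c _ <-]; apply: integral_ge0 => t _; rewrite lee_fin enorm_ge0.
Qed.

Lemma geodist_lt_curve p q (l : R) : (geodist M p q < l%:E)%E ->
  exists2 c : R -> 'rV[R]_m, [/\ piecewise_smooth c, forall t, 0 <= t <= 1 -> M (c t),
    c 0 = p & c 1 = q] & exists2 l' : R, l' < l & (curve_length c <= l'%:E)%E.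
Proof.
move=> /ereal_inf_lt[_ [c [pc Mc c0 c1] <-] cl]; exists c.
  by split => // t t01; apply: Mc; rewrite in_itv.
have c0' : (0%:E <= curve_length c)%E.
  by apply: integral_ge0 => t _; rewrite lee_fin enorm_ge0.
have cf : curve_length c \is a fin_num by rewrite ge0_fin_numE // (lt_trans cl) // ltry.
by exists (fine (curve_length c)); [rewrite -lte_fin fineK|rewrite fineK].
Qed.

Section Chart.
Context {p : 'rV[R]_m} {B : 'M[R]_(d, m)} {U : set 'rV[R]_m} {K : 'rV[R]_m -> 'rV[R]_d}
  (nb : normal_chart (M := M) p b B U K).
Let V := [set x : 'rV[R]_d | enorm (x *m B) < b].
Let E x := Exp d M p (x *m B).
Let lp : local_param M V U E K := nb_lp nb.

(** The infimum in [geodist] need not be attained: a curve of length at most some [l' < l] is used,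
    and this gives the strict bound. *)
Lemma chart_reach (l r : R) x q : V x -> (geodist M (E x) q < l%:E)%E ->
  enorm (x *m B) + l <= b ->
  exists u, [/\ V u, q = E u & enorm (u *m B) < enorm (x *m B) + l].
Proof.
move=> Vx /geodist_lt_curve[c [pc Mc c0 c1] [l' ll cl]] h.
have hl : enorm (x *m B) + l' < b by apply: lt_le_trans h; rewrite ltrD2l.
have [u [Vu cu hu]] := nb_curve_bound hM nb pc Mc Vx c0 cl hl.
by exists u; split; rewrite -?c1 //; apply: le_lt_trans hu _; rewrite ltrD2l.
Qed.

Lemma chart_reach0 (l : R) q : (geodist M p q < l%:E)%E -> l <= b ->
  exists u, [/\ V u, q = E u & enorm (u *m B) < l].
Proof.
rewrite -(nb_E0 hM nb) => h lb.
have := chart_reach 0 (nb_V0 nb) h; rewrite mul0mx enorm0 add0r; exact.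
Qed.

(** The radial segment gives one inequality; a strictly smaller distance would lead by
    [chart_reach0] to a chart point of smaller norm with the same image, against injectivity. *)
Lemma chart_dist v : V v -> geodist M p (E v) = (enorm (v *m B))%:E.
Proof.
move=> Vv; apply/eqP; rewrite eq_le (nb_radial_out hM nb Vv) /= leNgt; apply/negP => h.
have [u [Vu uv]] := chart_reach0 h (ltW Vv).
by rewrite -(lp_K lp Vv) [E v]uv (lp_K lp Vu) ltxx.
Qed.

End Chart.

Lemma geodist_fin p q r : (geodist M p q <= r%:E)%E ->
  exists r', [/\ geodist M p q = r'%:E, 0 <= r' & r' <= r].
Proof.
move=> h; have f : geodist M p q \is a fin_num.
  by rewrite ge0_fin_numE ?geodist_ge0 // (le_lt_trans h) // ltry.
exists (fine (geodist M p q)); rewrite fineK //; split => //.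
  by rewrite fine_ge0 // geodist_ge0.
by rewrite -lee_fin fineK.
Qed.

(** No curves are concatenated: [a] has radius [d(p, a)] in the chart at [p], and a curve from [a]
    increases the radius at most by its length. *)
Lemma geodist_triangle p a q r1 r2 : M p -> (geodist M p a <= r1%:E)%E ->
  (geodist M a q <= r2%:E)%E -> r1 + r2 < b -> (geodist M p q <= (r1 + r2)%:E)%E.
Proof.
move=> Mp h1 h2 h12; have [B [U [K nb]]] := normal_chart_exists hM Mp (hb Mp).
have [r1' [e1 r1'0 r1'1]] := geodist_fin h1; have [r2' [e2 r2'0 r2'1]] := geodist_fin h2.
have r2b : r1' < b by lra.
have [|v [Vv av _]] := @chart_reach0 _ _ _ _ nb b a _ (lexx b); first by rewrite e1 lte_fin.
have vr : enorm (v *m B) = r1'.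
  by have := chart_dist nb Vv; rewrite -av e1 => -[].
apply/lee_addgt0Pr => e e0.
pose e' := Num.min e (b - (r1 + r2)).
have e'0 : 0 < e' by rewrite lt_min e0 subr_gt0.
have e'e : e' <= e by rewrite ge_min lexx.
have e'b : e' <= b - (r1 + r2) by rewrite ge_min lexx orbT.
have [||u [Vu qu hu]] := @chart_reach _ _ _ _ nb (r2 + e') 0 v q Vv.
- by rewrite -av e2 lte_fin; lra.
- by rewrite vr; lra.
by rewrite qu (chart_dist nb Vu) -EFinD lee_fin; lra.
Qed.

(** The radial segment run backwards is a curve from [q] to [p] no longer than the distance from [p]
    to [q]. *)
Lemma geodist_symle p q r : M p -> (geodist M p q <= r%:E)%E -> r < b ->
  (geodist M q p <= r%:E)%E.
Proof.
move=> Mp h rb; have [B [U [K nb]]] := normal_chart_exists hM Mp (hb Mp).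
have hrb : (geodist M p q < b%:E)%E by apply: le_lt_trans h _; rewrite lte_fin.
have [v [Vv qv vr]] := chart_reach0 nb hrb (lexx b).
rewrite qv; apply: le_trans (nb_radial_in hM nb Vv) _.
by rewrite -(chart_dist nb Vv) -qv.
Qed.

Lemma geodist_sym p q r : M p -> M q -> (geodist M p q <= r%:E)%E -> r < b ->
  geodist M q p = geodist M p q.
Proof.
move=> Mp Mq h rb; have [r1 [e1 r10 r1r]] := geodist_fin h.
have h1 : (geodist M p q <= r1%:E)%E by rewrite e1.
have r1b : r1 < b by exact: le_lt_trans rb.
have h2 := geodist_symle Mp h1 r1b.
have [r2 [e2 r20 r2r]] := geodist_fin h2.
have h3 : (geodist M q p <= r2%:E)%E by rewrite e2.
have := geodist_symle Mq h3 (le_lt_trans r2r r1b).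
by rewrite e1 e2 lee_fin => h4; congr _%:E; apply/eqP; rewrite eq_le r2r.
Qed.

Lemma geodist_diag p : M p -> geodist M p p = 0%:E.
Proof.
move=> Mp; have [B [U [K nb]]] := normal_chart_exists hM Mp (hb Mp).
by have := chart_dist nb (nb_V0 nb); rewrite (nb_E0 hM nb) mul0mx enorm0.
Qed.

Lemma convex_chord (f f1 f2 : R -> R) t :
  (forall r, 0 <= r <= 1 -> is_derive r 1 f (f1 r)) ->
  (forall r, 0 <= r <= 1 -> is_derive r 1 f1 (f2 r)) ->
  (forall r, 0 <= r <= 1 -> 0 <= f2 r) -> 0 <= t <= 1 ->
  f t <= (1 - t) * f 0 + t * f 1.
Proof.
move=> d1 d2 f20 /andP[t0 t1].
have [r /andP[r0 rt]|c1 /andP[c10 c1t] E1] := mvt_ab t0 (f := f) (df := f1).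
  by apply: d1; rewrite r0 (le_trans rt).
have [r /andP[r0 rt]|c2 /andP[tc2 c21] E2] := mvt_ab t1 (f := f) (df := f1).
  by apply: d1; rewrite rt (le_trans t0).
have c12 : c1 <= c2 by exact: le_trans c1t tc2.
have := derive_ge0_le c12 (f := f1) (df := f2).
have sub r : c1 <= r <= c2 -> 0 <= r <= 1.
  by move=> /andP[h1 h2]; rewrite (le_trans c10 h1) (le_trans h2 c21).
move=> /(_ (fun r h => d2 r (sub r h)) (fun r h => f20 r (sub r h))) h.
rewrite subr0 in E1.
have h1 : (1 - t) * (f t - f 0) <= t * (f 1 - f t).
  rewrite E1 E2 mulrCA [X in _ <= X]mulrCA [(1 - t) * t]mulrC.
  by rewrite ler_wpM2r // mulr_ge0 // subr_ge0.
lra.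
Qed.

(** * Convexity of the squared distance along geodesic segments *)

Section Segment.
Context {p : 'rV[R]_m} {B : 'M[R]_(d, m)} {U : set 'rV[R]_m} {K : 'rV[R]_m -> 'rV[R]_d}
  (nb : normal_chart (M := M) p b B U K).
Let V := [set x : 'rV[R]_d | enorm (x *m B) < b].
Let E x := Exp d M p (x *m B).
Let lp : local_param M V U E K := nb_lp nb.

Lemma segment_dist v t : V v -> 0 <= t <= 1 ->
  geodist M p (E (t *: v)) = (t * enorm (v *m B))%:E /\
  (geodist M (E v) (E (t *: v)) <= ((1 - t) * enorm (v *m B))%:E)%E.
Proof.
move=> Vv /[dup] t01 /andP[t0 t1]; have H := nb_coords hM nb.
have Vt : V (t *: v) by exact: (nc_star H).
split; first by rewrite (chart_dist nb Vt) -scalemxAl enormZ ger0_norm.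
apply: (nb_geodist_line nb) => //; first by rewrite mulr_ge0 ?subr_ge0 // enorm_ge0.
move=> r /andP[r0 r1].
have -> : v + r *: (t *: v - v) = (1 - r * (1 - t)) *: v.
  by apply/rowP => i; rewrite !mxE; ring.
have -> : t *: v - v = (t - 1) *: v by apply/rowP => i; rewrite !mxE; ring.
have rt1 : r * (1 - t) <= 1 by rewrite mulr_ile1 // ?subr_ge0 // gerBl.
have rt0 : 0 <= r * (1 - t) by rewrite mulr_ge0 // subr_ge0.
have rt01 : 0 <= 1 - r * (1 - t) <= 1 by rewrite subr_ge0 rt1 gerBl.
have Vr : V ((1 - r * (1 - t)) *: v) by exact: (nc_star H).
rewrite (nc_gZl H) // (nc_gZr H) // (nb_speed_ray0 hM nb Vv rt01).
by rewrite [leLHS](_ : _ = ((1 - t) * enorm (v *m B)) ^+ 2) //; ring.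
Qed.

(** The two routes from [q] through the ends of the segment have total length [d0 + d1 + |v|], so
    the shorter one is at most half of it. *)
Lemma segment_bound v t q d0 d1 rho : M q -> V v -> 0 <= t <= 1 ->
  (geodist M q p <= d0%:E)%E -> (geodist M q (E v) <= d1%:E)%E ->
  (d0 + d1 + enorm (v *m B)) / 2 <= rho -> rho < b ->
  (geodist M q (E (t *: v)) <= rho%:E)%E.
Proof.
move=> Mq Vv t01 h0 h1 hr rb; have [e0 e1] := segment_dist Vv t01.
have e0' : (geodist M p (E (t *: v)) <= (t * enorm (v *m B))%:E)%E by rewrite e0.
have [c|c] := leP (d0 + t * enorm (v *m B)) rho.
  apply: le_trans (geodist_triangle Mq h0 e0' _) _; rewrite ?lee_fin //; lra.
apply: le_trans (geodist_triangle Mq h1 e1 _) _; rewrite ?lee_fin; lra.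
Qed.

(** For [t < 1] the velocity is that of a ray in the chart, by comparison from the right; at
    [t = 1], beyond which the two curves are not compared, the value is a left limit. *)
Lemma segment_speed v e (c : R -> 'rV[R]_m) t : V v -> 0 < e ->
  geodesic_on d M (- e) (1 + e) c ->
  (forall r, 0 <= r <= 1 -> c r = E (r *: v)) -> 0 <= t <= 1 ->
  dotv ('D_1 c t) ('D_1 c t) = enorm (v *m B) ^+ 2.
Proof.
move=> Vv e0 [sc _ _] cE t01; have H := nb_coords hM nb.
have Cc k : Ck k `]- e, 1 + e[%classic c by apply: smooth_on_Ck sc; exact: open_itvoo.
have inI r : 0 <= r <= 1 -> `]- e, 1 + e[%classic r.
  by move=> /andP[r0 r1]; rewrite /= in_itv /=; apply/andP; split; lra.
have lt1 r : 0 <= r < 1 -> dotv ('D_1 c r) ('D_1 c r) = enorm (v *m B) ^+ 2.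
  move=> /andP[r0 r1]; have r01 : 0 <= r <= 1 by rewrite r0 ltW.
  have Vr : V (r *: v) by exact: (nc_star H).
  have h1 : is_derive r 1 c ('D_1 c r) by apply: derivableP; exact: Ck_derivable (Cc 1) (inI _ r01).
  have h2 : is_derive r 1 (fun y : R => E (y *: v)) ('D_v E (r *: v)).
    by apply: is_derive_ray; apply: derivableP; exact: Ck_derivable (lp_Ck lp 1) Vr.
  have -> : 'D_1 c r = 'D_v E (r *: v).
    apply: (is_derive_right_uniq (_ : 0 < 1 - r) h1 h2); first by rewrite subr_gt0.
    move=> y /andP[ry]; rewrite addrC subrK => y1.
    by rewrite cE // (le_trans r0 ry) ltW.
  by rewrite -enorm_sq -(nb_metric_dot nb) // (nb_speed_ray0 hM nb Vv r01).
have /andP[t0 t1] := t01; have [t1'|] := ltP t 1; first by rewrite lt1 // t0.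
move=> t1'; have -> : t = 1 by apply/eqP; rewrite eq_le t1.
have cD : {for (1 : R), continuous ('D_1 c)}.
  by apply: Ck_cont (Ck_D1 (Cc 1)) _; apply: inI; rewrite ler01 lexx.
have cl : closed [set enorm (v *m B) ^+ 2] by exact: closed_eq.
have := left_lim_closed cl ltr01 (dotv_continuous cD); apply => r /andP[r0 r1].
by rewrite /= lt1 // r1 andbT ltW // -(subrr 1).
Qed.

(** In the chart at [q] the squared distance along the segment is [|u|^2]. By the geodesic equation
    and [nc_hess] its second derivative is twice the form bounded below in [nb_hess], hence at least
    [2 cos k'] times the squared speed; [psi] subtracts the corresponding parabola. *)
Lemma segment_convex v q (k k' rho : R) : M q -> V v -> 0 <= k ->
  (kappa_u d M <= (k ^+ 2)%:E)%E -> rho < b -> k * rho < k' -> k' < pi / 2 ->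
  (forall t, 0 <= t <= 1 -> (geodist M q (E (t *: v)) <= rho%:E)%E) ->
  forall t, 0 <= t <= 1 -> fine (geodist M q (E (t *: v))) ^+ 2 <=
    (1 - t) * fine (geodist M q p) ^+ 2 + t * fine (geodist M q (E v)) ^+ 2
    - cos k' * enorm (v *m B) ^+ 2 * (t * (1 - t)).
Proof.
move=> Mq Vv k0 kk rb kr k'p hrho t t01.
have [Bq [Uq [Kq nbq]]] := normal_chart_exists hM Mq (hb Mq).
pose Eq u := Exp d M q (u *m Bq).
pose Vq := [set x : 'rV[R]_d | enorm (x *m Bq) < b].
have lpq : local_param M Vq Uq Eq Kq := nb_lp nbq.
have Hq := nb_coords hM nbq.
have [e [c [e0 g c0 dc cE]]] := nb_curve hM nb Vv.
have inI r : 0 <= r <= 1 -> r \in `]- e, 1 + e[.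
  by move=> /andP[r0 r1]; rewrite in_itv /=; apply/andP; split; lra.
pose u := Kq \o c.
have uP r : 0 <= r <= 1 -> [/\ Vq (u r), Uq (c r), c r = Eq (u r),
    fine (geodist M q (E (r *: v))) = enorm (u r *m Bq) & enorm (u r *m Bq) <= rho].
  move=> r01; have h := hrho r r01.
  have hrb : (geodist M q (E (r *: v)) < b%:E)%E by apply: le_lt_trans h _; rewrite lte_fin.
  have [x [Vx qx _]] := chart_reach0 nbq hrb (lexx b).
  have cx : c r = Eq x by rewrite cE.
  have [Mx Ux] := lp_in lpq Vx.
  have ux : u r = x by rewrite /u /= cx (lp_K lpq).
  rewrite ux qx (chart_dist nbq Vx); split => //; first by rewrite cx.
  by rewrite -lee_fin -(chart_dist nbq Vx) -qx.
have chart r : 0 <= r <= 1 -> exists N : set R, [/\ open N, N r,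
    forall y : R, N y -> M (c y) /\ Uq (c y) & (forall k, Ck k N u) /\
    is_derive r 1 ('D_1 u) (- Gamv Eq (u r) ('D_1 u r) ('D_1 u r))].
  move=> r01; have [_ Ur _ _ _] := uP r r01.
  have [N [oN Nr _ NMU [Cu ode]]] := geo_chart lpq g (inI _ r01) Ur.
  by exists N; split => //; split => //; exact: ode.
have dB (X : R -> 'rV[R]_d) X' r : is_derive r 1 X X' ->
    is_derive r 1 (fun z : R => X z *m Bq) (X' *m Bq) by exact: is_derive_curve_mulmxr.
pose L := cos k' * enorm (v *m B) ^+ 2.
pose psi r := dotv (u r *m Bq) (u r *m Bq) - L * (r * r).
pose psi1 r := 2 * dotv (u r *m Bq) ('D_1 u r *m Bq) - L * (2 * r).
pose psi2 r := 2 * (dotv ('D_1 u r *m Bq) ('D_1 u r *m Bq)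
  - dotv (u r *m Bq) (Gamv Eq (u r) ('D_1 u r) ('D_1 u r) *m Bq)) - L * 2.
have du r : 0 <= r <= 1 -> is_derive r 1 u ('D_1 u r).
  move=> /chart [N [oN Nr _ [Cu _]]]; apply: derivableP; exact: Ck_derivable (Cu 1) Nr.
have d1 r : 0 <= r <= 1 -> is_derive r 1 psi (psi1 r).
  move=> /du dur; have h1 := dotv_deriv (dB _ _ _ dur) (dB _ _ _ dur).
  have h2 := is_derive_fM (is_derive_idR r) (is_derive_idR r).
  have h3 := is_derive_fM (is_derive_fcst L r (1 : R)) h2.
  by apply: (is_derive_eq (is_derive_fB h1 h3)); rewrite /psi1; ring.
have d2 r : 0 <= r <= 1 -> is_derive r 1 psi1 (psi2 r).
  move=> r01; have dur := du r r01; have [N [_ _ _ [_ ode]]] := chart r r01.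
  have h1 := dotv_deriv (dB _ _ _ dur) (dB _ _ _ ode).
  have h1' := is_derive_fM (is_derive_fcst (2 : R) r (1 : R)) h1.
  have h2 := is_derive_fM (is_derive_fcst (2 : R) r (1 : R)) (is_derive_idR r).
  have h3 := is_derive_fM (is_derive_fcst L r (1 : R)) h2.
  apply: (is_derive_eq (is_derive_fB h1' h3)).
  by rewrite /psi2 mulNmx [dotv _ (- _)]dotvC dotvNl [dotv (_ *m _) (u r *m Bq)]dotvC; ring.
have p2 r : 0 <= r <= 1 -> 0 <= psi2 r.
  move=> r01; have [Vu Ur cu _ ur] := uP r r01; have [N [oN Nr NMU [Cu _]]] := chart r r01.
  rewrite /psi2 -!(nb_metric0 hM nbq) -(nc_hess Hq) // /L subr_ge0 [L in L <= _]mulrC ler_pM2l //.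
  have krho : k * enorm (u r *m Bq) < k' by apply: le_lt_trans kr; rewrite ler_wpM2l.
  have := nb_hess hM nbq Vu k0 kk krho k'p ('D_1 u r).
  rewrite (nb_metric_dot nbq) // enorm_sq.
  have [_ <-] := lp_curve_deriv lpq oN Nr NMU (Cu 1).
  by rewrite (segment_speed Vv e0 g cE r01).
have := convex_chord d1 d2 p2 t01.
have i0 : 0 <= (0 : R) <= (1 : R) by rewrite lexx ler01.
have i1 : 0 <= (1 : R) <= (1 : R) by rewrite lexx ler01.
have [_ _ _ -> _] := uP t t01; have [_ _ _ + _] := uP 0 i0; have [_ _ _ + _] := uP 1 i1.
have E0 : E 0 = p := nb_E0 hM nb.
rewrite scale1r scale0r E0 => -> ->.
by rewrite /psi -!enorm_sq -/L => h; lra.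
Qed.

End Segment.

End LocalDistance.

Lemma sum_continuous (R : realType) (T : topologicalType) n (P : pred 'I_n)
  (f : 'I_n -> T -> R) x : (forall j, P j -> {for x, continuous (f j)}) ->
  {for x, continuous (fun y => \sum_(j < n | P j) f j y)}.
Proof.
move=> cf; rewrite /prop_for /continuous_at; apply: cvg_big => //.
exact: add_continuous.
Qed.

(** * Minimizers of the weighted sum of squared distances *)

Section Karcher.
Context {R : realType} {m d : nat} {M : set 'rV[R]_m} (hM : embedded_submanifold d M).
Context {b eps k : R} (hb : forall p, M p -> good_radius (d := d) (M := M) p b)
  (eps0 : 0 <= eps) (epsb : 10 * eps < b) (k0 : 0 <= k)
  (kk : (kappa_u d M <= (k ^+ 2)%:E)%E) (keps : k * (10 * eps) < pi / 2).
Context {n : nat} {P : pred 'I_n} {w : 'I_n -> R} {q : 'I_n -> 'rV[R]_m} {p0 : 'rV[R]_m}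
  (Mp0 : M p0) (w0 : forall j, P j -> 0 < w j) (Mq : forall j, P j -> M (q j))
  (dq : forall j, P j -> (geodist M p0 (q j) <= (4 * eps)%:E)%E) (P0 : exists j, P j).
Implicit Types (y z : 'rV[R]_m) (x u v : 'rV[R]_d) (t : R).

Definition karcher_obj y : \bar R :=
  (\sum_(j < n | P j) (w j)%:E * geodist M y (q j) ^+ 2)%E.

(** [pi / 5 <= 16/25], and [1 - x^2 / 2] is about [0.795] at [x = 16/25]. *)
Lemma cos_pi5_ge : 3 / 4 <= cos (pi / 5 : R).
Proof.
have p0' : (0 : R) <= pi / 5 by rewrite divr_ge0 // pi_ge0.
apply: le_trans (cos_ge p0').
have h : (pi / 5 : R) <= 16 / 25 by have := @pi_le R; lra.
have : (pi / 5 : R) ^+ 2 <= (16 / 25) ^+ 2 by rewrite ler_sqr ?nnegrE // divr_ge0.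
lra.
Qed.

Lemma kappa_pos (rho : R) : k * rho < pi / 2 -> 0 <= rho ->
  exists k', [/\ k * rho < k', k' < pi / 2 & 0 < cos k'].
Proof.
move=> h r0; exists ((k * rho + pi / 2) / 2); have kr : 0 <= k * rho by rewrite mulr_ge0.
split; [lra|lra|]; apply: cos_gt0_pihalf; apply/andP; split; lra.
Qed.

Lemma krho (c : R) : 0 <= c <= 10 -> k * (c * eps) < pi / 2.
Proof.
move=> /andP[c0 c10]; apply: le_lt_trans keps; rewrite ler_wpM2l // ler_wpM2r //.
Qed.

Lemma cbound (c : R) : c <= 10 -> c * eps < b.
Proof. by move=> c10; apply: le_lt_trans epsb; rewrite ler_wpM2r. Qed.

(* If [d(y, q) > 4 eps] plain convexity suffices; otherwise [d(y, q) > eps] and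
   the whole segment is within [4 eps] of [q], where the convexity constant is
   at least [cos (pi / 5) >= 3 / 4]. *)
Lemma segment_closer (B : 'M[R]_(d, m)) U K v q' : normal_chart (M := M) p0 b B U K ->
  5 * eps < enorm (v *m B) <= 8 * eps -> M q' -> (geodist M p0 q' <= (4 * eps)%:E)%E ->
  (geodist M (Exp d M p0 ((4 * eps / enorm (v *m B)) *: v *m B)) q'
    < geodist M (Exp d M p0 (v *m B)) q')%E.
Proof.
move=> nb /andP[r5 r8] Mq' d4; set r := enorm (v *m B) in r5 r8 *.
have lp := nb_lp nb.
have c8b : 8 * eps < b by apply: cbound; lra.
have Vv : enorm (v *m B) < b by exact: le_lt_trans c8b.
have c10b : 10 * eps < b := epsb.
have rpos : 0 < r by apply: le_lt_trans r5; rewrite mulr_ge0.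
have e0 : 0 < eps by lra.
pose t0 := 4 * eps / r.
have t01 : 0 <= t0 <= 1.
  by rewrite /t0 divr_ge0 ?mulr_ge0 ?(ltW rpos) //= ler_pdivrMr // mul1r; lra.
have t0r : t0 * r = 4 * eps by rewrite /t0 divfK // gt_eqF.
have t0lt : t0 < 1 by rewrite /t0 ltr_pdivrMr // mul1r; lra.
set y' := Exp d M p0 (v *m B); rewrite -/t0; set z := Exp d M p0 _.
have My : M y' by have [] := lp_in lp Vv.
have [zd _] := segment_dist hM nb Vv t01.
have zd' : (geodist M p0 z <= (4 * eps)%:E)%E by rewrite zd -/r t0r.
have Mz : M z by apply: Exp_in.
have c4b : 4 * eps < b by apply: cbound; lra.
have zp0 := geodist_symle hM hb Mp0 zd' c4b.
have zq8 : (geodist M z q' <= (8 * eps)%:E)%E.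
  apply: le_trans (geodist_triangle hM hb Mz zp0 d4 _) _; rewrite ?lee_fin; lra.
have [|a8] := boolP (geodist M y' q' <= (8 * eps)%:E)%E; last first.
  by apply: le_lt_trans zq8 _; rewrite ltNge.
move=> a8; have [a [aE a0 aa]] := geodist_fin a8.
have qp0 := geodist_symle hM hb Mp0 d4 c4b.
have qy := geodist_symle hM hb My a8 c8b.
have h10 t : 0 <= t <= 1 -> (geodist M q' (Exp d M p0 (t *: v *m B)) <= (10 * eps)%:E)%E.
  move=> tt; apply: (segment_bound hM hb nb Mq' Vv tt qp0 qy); rewrite -/r; lra.
have qyE : geodist M q' y' = a%:E by rewrite -aE; apply: (geodist_sym hM hb My Mq' a8 c8b).
have [D0 [D0E D00 D04]] := geodist_fin qp0.
have eps10 : 0 <= 10 * eps by rewrite mulr_ge0.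
have [k' [kk1 kk2 kk3]] := kappa_pos keps eps10.
have cv := segment_convex hM hb nb Mq' Vv k0 kk epsb kk1 kk2 h10.
rewrite -/y' qyE D0E /= -/r in cv.
have zqE : geodist M z q' = geodist M q' z.
  by apply: (geodist_sym hM hb Mq' Mz (h10 t0 t01)).
have [Dz [DzE Dz0 Dz10]] := geodist_fin (h10 t0 t01).
rewrite zqE aE [geodist M q' z]DzE lte_fin -ltr_sqr ?nnegrE //.
have nn t : 0 <= t <= 1 -> 0 <= cos k' * r ^+ 2 * (t * (1 - t)).
  move=> /andP[t0' t1']; apply: mulr_ge0; first by rewrite mulr_ge0 ?sqr_ge0 // ltW.
  by rewrite mulr_ge0 // subr_ge0.
have D016 : D0 ^+ 2 <= (4 * eps) ^+ 2 by rewrite ler_sqr ?nnegrE // mulr_ge0 // ltW.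
have [a4|a4] := ltP (4 * eps) a.
  have a16 : (4 * eps) ^+ 2 < a ^+ 2 by rewrite ltr_sqr ?nnegrE // mulr_ge0 // ltW.
  have := cv t0 t01; rewrite DzE /= => h; have := nn t0 t01 => hn.
  have h1 : (1 - t0) * D0 ^+ 2 < (1 - t0) * a ^+ 2.
    by rewrite ltr_pM2l ?subr_gt0 //; exact: le_lt_trans a16.
  lra.
have a16 : a ^+ 2 <= (4 * eps) ^+ 2 by rewrite ler_sqr ?nnegrE // mulr_ge0 // ltW.
have h4 t : 0 <= t <= 1 -> (geodist M q' (Exp d M p0 (t *: v *m B)) <= (4 * eps)%:E)%E.
  move=> tt; have [Dt [DtE Dt0 _]] := geodist_fin (h10 t tt).
  rewrite DtE lee_fin -ler_sqr ?nnegrE ?mulr_ge0 ?(ltW e0) //.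
  have := cv t tt; rewrite DtE /= => h; have := nn t tt => hn; have /andP[tt0 tt1] := tt.
  have h1 : (1 - t) * D0 ^+ 2 <= (1 - t) * (4 * eps) ^+ 2 by rewrite ler_wpM2l // subr_ge0.
  have h2 : t * a ^+ 2 <= t * (4 * eps) ^+ 2 by rewrite ler_wpM2l.
  lra.
(* Radius [10 eps] is allowed up to angle [pi / 2], hence radius [4 eps] up to [pi / 5]. *)
have k4 : k * (4 * eps) < pi / 5.
  have -> : k * (4 * eps) = (k * (10 * eps)) * (2 / 5) by field.
  have -> : pi / 5 = pi / 2 * (2 / 5) :> R by field.
  by rewrite ltr_pM2r.
have p52 : pi / 5 < pi / 2 :> R by have := @pi_gt0 R; lra.
have cv4 := segment_convex hM hb nb Mq' Vv k0 kk c4b k4 p52 h4.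
have := cv4 t0 t01; rewrite -/y' qyE D0E DzE /= -/r => h.
(* From [5 eps < r <= 4 eps + a]. *)
have ae : eps < a.
  have h1 : (geodist M q' y' <= a%:E)%E by rewrite qyE.
  have := geodist_triangle hM hb Mp0 d4 h1 (_ : 4 * eps + a < b).
  rewrite (chart_dist hM nb Vv) lee_fin -/r => h2; have := h2 (_ : 4 * eps + a < b); lra.
have c34 := cos_pi5_ge.
have t00 : 0 < 1 - t0 by rewrite subr_gt0.
(* As [t0 r = 4 eps], the convexity gain is [cos (pi / 5)] times [4 eps r (1 - t0)], so the whole
   comparison carries the positive factor [1 - t0]. *)
have e1 : cos (pi / 5) * r ^+ 2 * (t0 * (1 - t0)) = cos (pi / 5) * (4 * eps * r) * (1 - t0).
  by rewrite -t0r; ring.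
have e2 : 3 / 4 * (4 * eps * r) <= cos (pi / 5) * (4 * eps * r).
  by rewrite ler_wpM2r // !mulr_ge0 // ltW.
have e3 : 3 * eps * (5 * eps) < 3 * eps * r by rewrite ltr_pM2l // mulr_gt0.
have e4 : eps ^+ 2 < a ^+ 2 by rewrite ltr_sqr ?nnegrE ?(ltW e0).
(* [(4 eps)^2 - eps^2 - 3 eps (5 eps) = 0], with strictness from [eps < a] and [5 eps < r]. *)
have e5 : D0 ^+ 2 - a ^+ 2 - cos (pi / 5) * (4 * eps * r) < 0.
  have : (4 * eps) ^+ 2 = 16 * eps ^+ 2 by ring.
  have : 3 * eps * (5 * eps) = 15 * eps ^+ 2 by ring.
  lra.
have e6 : (1 - t0) * (D0 ^+ 2 - a ^+ 2 - cos (pi / 5) * (4 * eps * r)) < 0.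
  by rewrite pmulr_rlt0.
move: h; rewrite e1 => h; lra.
Qed.

Lemma closer y : M y -> ((5 * eps)%:E < geodist M p0 y)%E ->
  exists z, [/\ M z, (geodist M p0 z <= (5 * eps)%:E)%E &
    forall j, P j -> (geodist M z (q j) < geodist M y (q j))%E].
Proof.
move=> My d5; have [B [U [K nb]]] := normal_chart_exists hM Mp0 (hb Mp0).
have lp := nb_lp nb.
have c8b : 8 * eps < b by apply: cbound; lra.
have [d8|d8] := boolP (geodist M p0 y <= (8 * eps)%:E)%E.
  have hyb : (geodist M p0 y < b%:E)%E by apply: le_lt_trans d8 _; rewrite lte_fin.
  have [v [Vv yE _]] := chart_reach0 hM nb hyb (lexx b).
  have vE := chart_dist hM nb Vv; rewrite -yE in vE.
  have r58 : 5 * eps < enorm (v *m B) <= 8 * eps by rewrite -lte_fin -lee_fin -vE d5.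
  have /andP[r5 r8] := r58.
  have rpos : 0 < enorm (v *m B) by apply: le_lt_trans r5; rewrite mulr_ge0.
  exists (Exp d M p0 ((4 * eps / enorm (v *m B)) *: v *m B)); split.
  - exact: Exp_in.
  - have t01 : 0 <= 4 * eps / enorm (v *m B) <= 1.
      by rewrite divr_ge0 ?mulr_ge0 ?(ltW rpos) //= ler_pdivrMr // mul1r; lra.
    have [-> _] := segment_dist hM nb Vv t01.
    by rewrite lee_fin divfK ?gt_eqF //; lra.
  - by move=> j Pj; rewrite yE; apply: (segment_closer nb r58 (Mq Pj) (dq Pj)).
exists p0; split => //; first by rewrite (geodist_diag hM hb Mp0) lee_fin mulr_ge0.
move=> j Pj; apply: le_lt_trans (dq Pj) _; rewrite ltNge; apply/negP => yq.
have c4b : 4 * eps < b by apply: cbound; lra.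
have qy := geodist_symle hM hb My yq c4b.
move: d8; rewrite (le_trans (geodist_triangle hM hb Mp0 (dq Pj) qy _)) ?lee_fin //; lra.
Qed.

(** Each [f j] lies strictly below another extended real, so the smaller sum is finite and
    strictness is not lost to [+oo] on both sides. *)
Lemma lt_esum (f g : 'I_n -> \bar R) : (forall j, P j -> (0 <= f j)%E) ->
  (forall j, P j -> (f j < g j)%E) ->
  (\sum_(j < n | P j) f j < \sum_(j < n | P j) g j)%E.
Proof.
move=> f0 fg; have [j0 Pj0] := P0.
rewrite (bigD1 j0) //= [ltRHS](bigD1 j0) //=; apply: lte_leD; last 2 first.
- exact: fg.
- by apply: lee_sum => j /andP[Pj _]; exact/ltW/fg.
rewrite ge0_fin_numE; last by apply: sume_ge0 => j /andP[Pj _]; exact: f0.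
apply: lte_sum_pinfty => j /andP[Pj _]; apply: lt_le_trans (fg _ Pj) _; exact: leey.
Qed.

Lemma karcher_lt y z : (forall j, P j -> (geodist M z (q j) < geodist M y (q j))%E) ->
  (karcher_obj z < karcher_obj y)%E.
Proof.
move=> h; apply: lt_esum => j Pj.
  by rewrite mule_ge0 ?lee_fin ?(ltW (w0 Pj)) // expe_ge0 // geodist_ge0.
have := h j Pj; have := geodist_ge0 (M := M) z (q j).
case: (geodist M z (q j)) => [a| |] //; case: (geodist M y (q j)) => [c| |] // a0.
  rewrite lte_fin => ac; rewrite -!EFin_expe -!EFinM lte_fin ltr_pM2l ?w0 //.
  by rewrite ltr_sqr ?nnegrE // ltW // (le_lt_trans _ ac).
move=> _; rewrite -EFin_expe -EFinM expe2 mulyy gt0_muley ?ltry // lte_fin; exact: w0.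
Qed.

Lemma karcher_near y : M y -> (forall z, M z -> (karcher_obj y <= karcher_obj z)%E) ->
  (geodist M p0 y <= (5 * eps)%:E)%E.
Proof.
move=> My ymin; rewrite leNgt; apply/negP => /(closer My)[z [Mz _ zy]].
by have := lt_le_trans (karcher_lt zy) (ymin z Mz); rewrite ltxx.
Qed.

Lemma near_dist y j : P j -> M y -> (geodist M p0 y <= (5 * eps)%:E)%E ->
  (geodist M (q j) y <= (9 * eps)%:E)%E /\ geodist M y (q j) = geodist M (q j) y.
Proof.
move=> Pj My d5; have c9b : 9 * eps < b by apply: cbound; lra.
have c4b : 4 * eps < b by apply: cbound; lra.
have qp0 := geodist_symle hM hb Mp0 (dq Pj) c4b.
have h : (geodist M (q j) y <= (9 * eps)%:E)%E.
  apply: le_trans (geodist_triangle hM hb (Mq Pj) qp0 d5 _) _; rewrite ?lee_fin; lra.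
split => //; exact: (geodist_sym hM hb (Mq Pj) My h c9b).
Qed.

(** A finite version of the objective, with distances measured from [q j], since convexity and
    continuity are proved in the charts centred there. *)
Definition karcher_real y : R :=
  \sum_(j < n | P j) w j * fine (geodist M (q j) y) ^+ 2.

Lemma karcher_objE y : M y -> (geodist M p0 y <= (5 * eps)%:E)%E ->
  karcher_obj y = (karcher_real y)%:E.
Proof.
move=> My d5; rewrite /karcher_obj /karcher_real -sumEFin; apply: eq_bigr => j Pj.
have [h ->] := near_dist Pj My d5; have [r [-> _ _]] := geodist_fin h.
by rewrite -EFin_expe -EFinM.
Qed.

(** Near [x] the distance from [q'] is the norm of the tangent vector in the chart at [q']; points
    within [b - 4 eps] of [p0], the set [W], stay in that chart by the triangle inequality. *)
Lemma dist_continuous (B : 'M[R]_(d, m)) U K x q' : normal_chart (M := M) p0 b B U K ->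
  M q' -> (geodist M p0 q' <= (4 * eps)%:E)%E -> enorm (x *m B) <= 5 * eps ->
  {for x, continuous (fun x => fine (geodist M q' (Exp d M p0 (x *m B))))}.
Proof.
move=> nb Mq' d4 x5; have lp := nb_lp nb.
have c4b : 4 * eps < b by apply: cbound; lra.
have qp0 := geodist_symle hM hb Mp0 d4 c4b.
have [Bq [Uq [Kq nbq]]] := normal_chart_exists hM Mq' (hb Mq'); have lpq := nb_lp nbq.
pose E u := Exp d M p0 (u *m B); pose Eq u := Exp d M q' (u *m Bq).
pose W := [set u : 'rV[R]_d | enorm (u *m B) < b - 4 * eps].
have oW : open W by exact: enorm_ball_open.
have c10b : 10 * eps < b := epsb.
have Wx : W x.
  have h : enorm (x *m B) < b - 4 * eps by lra.
  exact: h.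
have Wq u : W u -> [/\ M (E u), Uq (E u) &
    fine (geodist M q' (E u)) = enorm (Kq (E u) *m Bq)].
  move=> Wu; have wu : enorm (u *m B) < b - 4 * eps by [].
  have e0 : 0 <= eps := eps0.
  have Vu : enorm (u *m B) < b by lra.
  have h1 : (geodist M p0 (E u) <= (enorm (u *m B))%:E)%E by rewrite (chart_dist hM nb Vu).
  have h2 := geodist_triangle hM hb Mq' qp0 h1 (_ : 4 * eps + enorm (u *m B) < b).
  have h3 : 4 * eps + enorm (u *m B) < b by lra.
  have h4 : (geodist M q' (E u) < b%:E)%E by apply: le_lt_trans (h2 h3) _; rewrite lte_fin.
  have [x' [Vx' Ex' _]] := chart_reach0 hM nbq h4 (lexx b).
  have [Mx Ux] := lp_in lpq Vx'.
  by rewrite Ex' (lp_K lpq Vx') (chart_dist hM nbq Vx').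
have [ME UE _] := Wq x Wx.
have [U' [Psi [oU' U'x sU CP PE]]] := lp_ext lpq ME UE.
have Vx : enorm (x *m B) < b.
  by have e0 : 0 <= eps := eps0; lra.
have cE : {for x, continuous E} := Ck_cont (lp_Ck lp 0) Vx.
have cP : {for E x, continuous Psi} := Ck_cont (CP 0) U'x.
have cX : {for x, continuous (fun u => enorm (Psi (E u) *m Bq))}.
  exact: (enorm_continuous (mulmxr_continuous (B := Bq) (continuous_comp cE cP))).
have nW : nbhs x W by exact: open_nbhs_nbhs.
have nU' : \forall u \near x, U' (E u) by apply: cE; exact: open_nbhs_nbhs.
have XE u : W u -> U' (E u) -> enorm (Psi (E u) *m Bq) = fine (geodist M q' (E u)).
  by move=> Wu U'u; have [Mu _ ->] := Wq u Wu; rewrite PE.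
rewrite /prop_for /continuous_at -/(E x) -(XE x Wx U'x).
have nE : \forall u \near x,
    enorm (Psi (E u) *m Bq) = fine (geodist M q' (Exp d M p0 (u *m B))).
  by apply: (filterS _ (filterI nW nU')) => u [Wu U'u]; exact: XE.
exact: (cvg_trans (near_eq_cvg nE) cX).
Qed.

Lemma karcher_exists : exists y, M y /\ forall z, M z -> (karcher_obj y <= karcher_obj z)%E.
Proof.
have [B [U [K nb]]] := normal_chart_exists hM Mp0 (hb Mp0); have lp := nb_lp nb.
have c5b : 5 * eps < b by apply: cbound; lra.
have cC := nb_bounded_compact nb (r0 := 5 * eps).
pose G x := karcher_real (Exp d M p0 (x *m B)).
have cG : {within [set x : 'rV[R]_d | enorm (x *m B) <= 5 * eps], continuous G}.
  apply: continuous_in_subspaceT => x; rewrite inE /= => x5.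
  apply: sum_continuous => j Pj; have cj := dist_continuous nb (Mq Pj) (dq Pj) x5.
  exact: (cvgM (cvg_cst (w j)) (cvgM cj cj)).
have [|x1 x1C hmin] := EVT_min_rV _ cC cG.
  by exists 0; rewrite /= mul0mx enorm0 mulr_ge0.
move: x1C; rewrite inE /= => x15.
have VC x : enorm (x *m B) <= 5 * eps -> enorm (x *m B) < b by move=> h; exact: le_lt_trans h c5b.
have inC x : enorm (x *m B) <= 5 * eps -> M (Exp d M p0 (x *m B)) /\
    (geodist M p0 (Exp d M p0 (x *m B)) <= (5 * eps)%:E)%E.
  by move=> h; rewrite (chart_dist hM nb (VC _ h)); split => //; exact: Exp_in.
have [M1 d1] := inC _ x15.
have main z : M z -> (geodist M p0 z <= (5 * eps)%:E)%E ->
    (karcher_obj (Exp d M p0 (x1 *m B)) <= karcher_obj z)%E.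
  move=> Mz dz; have hzb : (geodist M p0 z < b%:E)%E by apply: le_lt_trans dz _; rewrite lte_fin.
  have [x [Vx zE _]] := chart_reach0 hM nb hzb (lexx b).
  have x5 : enorm (x *m B) <= 5 * eps by rewrite -lee_fin -(chart_dist hM nb Vx) -zE.
  by rewrite !karcher_objE // zE lee_fin; apply: hmin; rewrite inE.
exists (Exp d M p0 (x1 *m B)); split => // z Mz.
have [dz|] := boolP (geodist M p0 z <= (5 * eps)%:E)%E; first exact: main.
(* A point outside the ball is beaten by some point of the ball, so the minimum over the ball is
   global. *)
rewrite -ltNge => dz; have [z' [Mz' dz' hz']] := closer Mz dz.
by apply: le_trans (main z' Mz' dz') _; exact/ltW/karcher_lt.
Qed.

Lemma karcher_uniq y1 y2 : M y1 -> (forall z, M z -> (karcher_obj y1 <= karcher_obj z)%E) ->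
  M y2 -> (forall z, M z -> (karcher_obj y2 <= karcher_obj z)%E) -> y1 = y2.
Proof.
move=> My1 min1 My2 min2; apply: contrapT => y12.
have d1 := karcher_near My1 min1; have d2 := karcher_near My2 min2.
have c5b : 5 * eps < b by apply: cbound; lra.
have c9b : 9 * eps < b by apply: cbound; lra.
have d1' := geodist_symle hM hb Mp0 d1 c5b.
have c10b : 10 * eps < b := epsb.
have h12 : (geodist M y1 y2 <= (10 * eps)%:E)%E.
  apply: le_trans (geodist_triangle hM hb My1 d1' d2 _) _; rewrite ?lee_fin; lra.
have [B [U [K nb]]] := normal_chart_exists hM My1 (hb My1); have lp := nb_lp nb.
have h12b : (geodist M y1 y2 < b%:E)%E by apply: le_lt_trans h12 _; rewrite lte_fin.
have [v [Vv y2E _]] := chart_reach0 hM nb h12b (lexx b).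
have v10 : enorm (v *m B) <= 10 * eps by rewrite -lee_fin -(chart_dist hM nb Vv) -y2E.
have v0 : 0 < enorm (v *m B) ^+ 2.
  rewrite enorm_sq dotv_gt0 //; apply/eqP => /(nb_inj nb) vE; apply: y12.
  by rewrite y2E vE (nb_E0 hM nb).
have [B' [U' [K' nb']]] := normal_chart_exists hM Mp0 (hb Mp0).
have d2v : (geodist M p0 (Exp d M y1 (v *m B)) <= (5 * eps)%:E)%E by rewrite -y2E.
(* The segment is within half of [5 + 5 + 10], that is [10 eps], of [p0]; convexity then improves
   this to [5 eps], which puts it within [9 eps] of every data point. *)
have h10 t : 0 <= t <= 1 -> (geodist M p0 (Exp d M y1 (t *: v *m B)) <= (10 * eps)%:E)%E.
  move=> tt; apply: (segment_bound hM hb nb Mp0 Vv tt d1 d2v) => //; lra.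
have eps10 : 0 <= 10 * eps by rewrite mulr_ge0.
have [k' [kk1 kk2 kk3]] := kappa_pos keps eps10.
have cv := segment_convex hM hb nb Mp0 Vv k0 kk epsb kk1 kk2 h10.
have [r1 [r1E r10 r15]] := geodist_fin d1; have [r2 [r2E r20 r25]] := geodist_fin d2v.
rewrite r1E r2E /= in cv.
have h5 t : 0 <= t <= 1 -> (geodist M p0 (Exp d M y1 (t *: v *m B)) <= (5 * eps)%:E)%E.
  move=> tt; have [Dt [DtE Dt0 _]] := geodist_fin (h10 t tt).
  rewrite DtE lee_fin -ler_sqr ?nnegrE ?mulr_ge0 //.
  have := cv t tt; rewrite DtE /= => h; have /andP[tt0 tt1] := tt.
  have hn : 0 <= cos k' * enorm (v *m B) ^+ 2 * (t * (1 - t)).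
    apply: mulr_ge0; first by rewrite mulr_ge0 // ltW.
    by rewrite mulr_ge0 // subr_ge0.
  have s1 : r1 ^+ 2 <= (5 * eps) ^+ 2 by rewrite ler_sqr ?nnegrE ?mulr_ge0.
  have s2 : r2 ^+ 2 <= (5 * eps) ^+ 2 by rewrite ler_sqr ?nnegrE ?mulr_ge0.
  have h1 : (1 - t) * r1 ^+ 2 <= (1 - t) * (5 * eps) ^+ 2 by rewrite ler_wpM2l // subr_ge0.
  have h2 : t * r2 ^+ 2 <= t * (5 * eps) ^+ 2 by rewrite ler_wpM2l.
  lra.
have half01 : 0 <= (1 / 2 : R) <= (1 : R) by apply/andP; split; lra.
pose z := Exp d M y1 ((1 / 2) *: v *m B).
have Mz : M z by exact: Exp_in.
have dz : (geodist M p0 z <= (5 * eps)%:E)%E by exact: h5.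
have k9 : k * (9 * eps) < pi / 2 by apply: krho; apply/andP; split; lra.
have eps9 : 0 <= 9 * eps by rewrite mulr_ge0.
have [k9' [k91 k92 k93]] := kappa_pos k9 eps9.
have strict j : P j -> fine (geodist M (q j) z) ^+ 2 <
    1 / 2 * fine (geodist M (q j) y1) ^+ 2 + 1 / 2 * fine (geodist M (q j) y2) ^+ 2.
  move=> Pj.
  have h9 t : 0 <= t <= 1 -> (geodist M (q j) (Exp d M y1 (t *: v *m B)) <= (9 * eps)%:E)%E.
    move=> tt; have Mt : M (Exp d M y1 (t *: v *m B)) by exact: Exp_in.
    by have [] := near_dist Pj Mt (h5 t tt).
  have := segment_convex hM hb nb (Mq Pj) Vv k0 kk c9b k91 k92 h9 half01.
  rewrite -y2E -/z => h.
  have : 0 < cos k9' * enorm (v *m B) ^+ 2 by rewrite mulr_gt0.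
  lra.
have [j0 Pj0] := P0.
have Hz : karcher_real z < 1 / 2 * karcher_real y1 + 1 / 2 * karcher_real y2.
  rewrite /karcher_real !mulr_sumr -big_split /= -subr_gt0 -sumrB (bigD1 j0) //=.
  have pos j : P j -> 0 < 1 / 2 * (w j * fine (geodist M (q j) y1) ^+ 2) +
     1 / 2 * (w j * fine (geodist M (q j) y2) ^+ 2) - w j * fine (geodist M (q j) z) ^+ 2.
    move=> Pj; have := strict j Pj; rewrite -(ltr_pM2l (w0 Pj)); lra.
  by apply: ltr_wpDr; [apply: sumr_ge0 => j /andP[Pj _]; exact/ltW/pos|exact: pos].
have := min1 z Mz; have := min2 z Mz; rewrite !karcher_objE // !lee_fin; lra.
Qed.

Lemma karcher_set : exists y,
  [set p | M p /\ forall z, M z -> (karcher_obj p <= karcher_obj z)%E] = [set y].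
Proof.
have [y [My ymin]] := karcher_exists; exists y.
apply/seteqP; split=> [y' [My' y'min]|_ ->] //; exact: karcher_uniq.
Qed.

End Karcher.

(** * Estimates at the anchors *)

Section Anchors.
Context {R : realType} {m d : nat} {M : set 'rV[R]_m} (hM : embedded_submanifold d M).
Implicit Types (p q v : 'rV[R]_m) (s t l : R).

(** [tau] may equal the injectivity radius, which need not be a good radius itself; two given
    lengths below [tau] still fit under a smaller good one. *)
Lemma good_radius_between p (tau r1 r2 : R) : (tau%:E <= inj_at d M p)%E ->
  0 <= r1 < tau -> 0 <= r2 < tau ->
  exists s, [/\ r1 < s, r2 < s, s < tau & good_radius (d := d) (M := M) p s].
Proof.
move=> hinj /andP[r10 r1t] /andP[r20 r2t].
have mt : Num.max r1 r2 < tau by rewrite gt_max r1t.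
have h1 : r1 <= Num.max r1 r2 by rewrite le_max lexx.
have h2 : r2 <= Num.max r1 r2 by rewrite le_max lexx orbT.
exists ((Num.max r1 r2 + tau) / 2).
have st : (Num.max r1 r2 + tau) / 2 < tau by lra.
split; [lra|lra|exact: st|].
apply: good_radius_lt; first lra.
by apply: lt_le_trans hinj; rewrite lte_fin.
Qed.

Lemma Exp_tball_inj p (tau : R) v v' : (tau%:E <= inj_at d M p)%E ->
  tball M p tau v -> tball M p tau v' -> Exp d M p v = Exp d M p v' -> v = v'.
Proof.
move=> hinj [tv vt] [tv' vt'] E.
have [|||s [vs vs' _ [s0 _ [K [_ _ hK _]]]]] := @good_radius_between p tau (enorm v) (enorm v').
- by [].
- by rewrite enorm_ge0.
- by rewrite enorm_ge0.
have [_ <-] := hK v (conj tv vs); have [_ <-] := hK v' (conj tv' vs').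
by rewrite E.
Qed.

Lemma Log_Exp p (tau : R) v : (tau%:E <= inj_at d M p)%E -> tball M p tau v ->
  Log d M p tau (Exp d M p v) = v.
Proof.
move=> hinj tv; apply: pinvKV; last by rewrite inE.
by move=> v1 v2; rewrite !inE; exact: Exp_tball_inj.
Qed.

(** The chart segment between the two tangent vectors is mapped to a curve whose speed is at most
    four times the Euclidean one, by [nb_rauch] at each of its points. *)
Lemma anchor_dist p (tau l eps : R) v1 v2 : M p -> (tau%:E <= inj_at d M p)%E ->
  l <= 0 -> (l%:E <= kappa_l d M)%E -> - l * tau ^+ 2 <= pi ^+ 2 ->
  tball M p tau v1 -> tball M p tau v2 -> enorm (v2 - v1) <= eps ->
  (geodist M (Exp d M p v1) (Exp d M p v2) <= (4 * eps)%:E)%E.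
Proof.
move=> Mp hinj l0 ll lt [tv1 n1] [tv2 n2] he.
have eps0 : 0 <= eps by apply: le_trans he; exact: enorm_ge0.
have [|||s [vs vs' st gs]] := @good_radius_between p tau (enorm v1) (enorm v2).
- by [].
- by rewrite enorm_ge0.
- by rewrite enorm_ge0.
have [B [U [K nb]]] := normal_chart_exists hM Mp gs.
have [x1 E1] := (nb_T nb v1).1 tv1; have [x2 E2] := (nb_T nb v2).1 tv2.
rewrite E1 in vs; rewrite E2 in vs'; rewrite E1 E2 -mulmxBl in he.
rewrite E1 E2; apply: (nb_geodist_line nb vs vs'); first by rewrite mulr_ge0.
move=> t t01; have Vt := enorm_ball_convex vs vs' t01.
have lx : - l * enorm ((x1 + t *: (x2 - x1)) *m B) ^+ 2 < pi ^+ 2.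
  (* The bound must be strict: for [l < 0] strictness comes from a norm below [tau], for [l = 0]
     from [0 < pi]. *)
  have [->|l1] := eqVneq l 0; first by rewrite oppr0 mul0r exprn_gt0 // pi_gt0.
  have l2 : l < 0 by rewrite lt_neqAle l1.
  apply: lt_le_trans lt; rewrite ltr_pM2l ?oppr_gt0 //.
  have xs : enorm ((x1 + t *: (x2 - x1)) *m B) < tau by exact: lt_trans st.
  by rewrite ltr_sqr ?nnegrE ?enorm_ge0 // ltW // (le_lt_trans (enorm_ge0 _) xs).
apply: le_trans (nb_rauch hM nb Vt l0 ll lx (x2 - x1)) _.
rewrite (nb_metric0 hM nb) -enorm_sq exprMn -natrX ler_pM2l //.
by rewrite ler_sqr ?nnegrE ?enorm_ge0.
Qed.

End Anchors.

(** The value [-oo] is excluded because [tau * +oo] exceeds [pi]. *)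
Lemma kappa_l_bound (R : realType) m d (M : set 'rV[R]_m) (tau : R) : 0 < tau ->
  (tau%:E * sqrte `|kappa_l d M| <= pi%:E)%E ->
  exists l : R, [/\ l <= 0, (l%:E <= kappa_l d M)%E & - l * tau ^+ 2 <= pi ^+ 2].
Proof.
move=> tau0; have : (kappa_l d M <= 0)%E by rewrite /kappa_l ge_min lexx.
case: (kappa_l d M) => [l| |] //=; last by move=> _; rewrite gt0_muley ?lte_fin.
rewrite lee_fin => l0; rewrite ler0_norm // => h; exists l; split => //.
have {}h : tau * Num.sqrt (- l) <= pi by rewrite -lee_fin EFinM.
have t0 : 0 <= tau * Num.sqrt (- l) by rewrite mulr_ge0 ?sqrtr_ge0 // ltW.
have : (tau * Num.sqrt (- l)) ^+ 2 <= pi ^+ 2 by rewrite ler_sqr ?nnegrE ?pi_ge0.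
by rewrite exprMn sqr_sqrtr ?oppr_ge0 // mulrC.
Qed.

(** For [kappa_u = +oo] the upper bound is [pi * 0 = 0], which leaves no [e >= 0]. *)
Lemma kappa_u_bound (R : realType) m d (M : set 'rV[R]_m) (e : R) : 0 <= e ->
  (e%:E < pi%:E * (2%:E * sqrte (kappa_u d M))^-1)%E ->
  exists k : R, [/\ 0 <= k, (kappa_u d M <= (k ^+ 2)%:E)%E & k * e < pi / 2].
Proof.
move=> e0; have : (0 <= kappa_u d M)%E by rewrite /kappa_u le_max lexx.
case: (kappa_u d M) => [K| |] //=; last first.
  have -> : (2%:E * +oo = +oo :> \bar R)%E by rewrite gt0_muley // lte_fin.
  by move=> _; rewrite invey mule0 lte_fin ltNge e0.
rewrite lee_fin => K0 h; exists (Num.sqrt K); split; first exact: sqrtr_ge0.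
  by rewrite sqr_sqrtr.
have [->|K1] := eqVneq K 0; first by rewrite sqrtr0 mul0r divr_gt0 // pi_gt0.
have s0 : 0 < Num.sqrt K by rewrite sqrtr_gt0 lt_neqAle eq_sym K1.
have s2 : 0 < 2 * Num.sqrt K by rewrite mulr_gt0.
move: h; rewrite -EFinM inver gt_eqF // -EFinM lte_fin ltr_pdivlMr //.
move=> h; rewrite ltr_pdivlMr //; apply: le_lt_trans h.
by rewrite [leLHS](_ : _ = e * (2 * Num.sqrt K)) //; ring.
Qed.

Lemma inj_radius_between (R : realType) m d (M : set 'rV[R]_m) (e : R) :
  (e%:E < inj_radius d M)%E -> exists2 b : R, e < b & (b%:E < inj_radius d M)%E.
Proof.
case: (inj_radius d M) => [i| |] //; last by exists (e + 1); rewrite ?ltrDl ?ltry.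
by rewrite lte_fin => ei; exists ((e + i) / 2); rewrite ?lte_fin; lra.
Qed.

Theorem proposition4p6 (R : realType) (n m d r : nat)
  (Omega : set 'rV[R]_n) (hOmega : open Omega)
  (M : set 'rV[R]_m) (hM : embedded_submanifold d M)
  (f : 'rV[R]_n -> 'rV[R]_m) (hf : forall x, Omega x -> M (f x))
  (anchor : 'I_r -> 'rV[R]_m) (hanchor : forall j, M (anchor j))
  (Omegaj : 'I_r -> set 'rV[R]_n)
  (ghat : 'I_r -> 'rV[R]_n -> 'rV[R]_m)
  (phi : 'I_r -> 'rV[R]_m -> R)
  (sigma tau : 'I_r -> R) (epsilon : R)
  (hsigma : forall j, 0 < sigma j <= tau j)
  (htau_inj : forall j, ((tau j)%:E <= inj_at d M (anchor j))%E)
  (htau_curv : forall j, ((tau j)%:E * sqrte `|kappa_l d M| <= pi%:E)%E)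
  (A1 : f @` Omega `<=`
        \bigcup_(j in [set: 'I_r]) geoball d M (anchor j) (sigma j))
  (A2_dom : forall j,
    Omegaj j = Omega `&` f @^-1` geoball d M (anchor j) (sigma j))
  (A2_ran : forall j x, Omegaj j x -> tball M (anchor j) (tau j) (ghat j x))
  (A3_err : forall j x, Omegaj j x ->
    enorm (ghat j x - Log d M (anchor j) (tau j) (f x)) <= epsilon)
  (A3_eps : (epsilon%:E < 10^-1%:E *
    Order.min (inj_radius d M) (pi%:E * (2%:E * sqrte (kappa_u d M))^-1))%E)
  (A4 : subordinate_partition_of_unity M (f @` Omega)
    (fun j => geoball d M (anchor j) (tau j)) phi) :
  forall x, Omega x ->
    ((exists j, mtsm_weight d M anchor Omegaj ghat phi x j != 0) ->
     exists y, is_MTSM d M anchor Omegaj ghat phi x y) /\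
    (forall y, is_MTSM d M anchor Omegaj ghat phi x y ->
     (geodist M (f x) y <= (5 * epsilon)%:E)%E).
Proof.
move=> x Ox; set p0 := f x.
have Mp0 : M p0 by exact: hf.
have covered j : Omegaj j x -> exists v1, [/\ tball M (anchor j) (tau j) v1,
    p0 = Exp d M (anchor j) v1 & enorm (ghat j x - v1) <= epsilon].
  move=> Ojx; have /andP[s0 st] := hsigma j.
  have [v [tv vs] vE] : geoball d M (anchor j) (sigma j) (f x).
    by move: Ojx; rewrite A2_dom => -[].
  have tv' : tball M (anchor j) (tau j) v by split => //; exact: lt_le_trans st.
  exists v; split => //; have := A3_err _ _ Ojx.
  by rewrite -vE Log_Exp.
(* Some anchor covers [f x]; the error bound there forces [epsilon >= 0]. *)
have [j1 _ gj1] : (\bigcup_(j in [set: 'I_r]) geoball d M (anchor j) (sigma j)) (f x).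
  by apply: A1; exists x.
have O1 : Omegaj j1 x by rewrite A2_dom.
have eps0 : 0 <= epsilon.
  by have [v1 [_ _ h]] := covered _ O1; apply: le_trans h; exact: enorm_ge0.
have eps10 : 0 <= 10 * epsilon by rewrite mulr_ge0.
have : ((10 * epsilon)%:E < Order.min (inj_radius d M)
    (pi%:E * (2%:E * sqrte (kappa_u d M))^-1))%E.
  move: A3_eps; rewrite muleC lte_pdivlMr // muleC -EFinM; exact.
rewrite lt_min => /andP[hinj hku].
have [k [k0 kk keps]] := kappa_u_bound eps10 hku.
have [b epsb binj] := inj_radius_between hinj.
have hb p : M p -> good_radius (d := d) (M := M) p b.
  move=> Mp; apply: good_radius_lt; first exact: le_lt_trans epsb.
  by apply: lt_le_trans binj _; apply: ereal_inf_lbound; exists p.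
pose w j := mtsm_weight d M anchor Omegaj ghat phi x j.
pose q j := fhat d M anchor ghat j x.
have Mq j : M (q j) by exact: Exp_in.
have wO j : w j != 0 -> Omegaj j x.
  by rewrite /w /mtsm_weight; case: ifP => [/set_mem|_] //; rewrite eqxx.
have w0 j : w j != 0 -> 0 < w j.
  move=> wj; rewrite lt_neqAle eq_sym wj /= /w /mtsm_weight; case: ifP => // _.
  by case: A4 => h _ _; have /andP[] := h j (q j) (Mq j).
have dq j : w j != 0 -> (geodist M p0 (q j) <= (4 * epsilon)%:E)%E.
  move=> /wO Oj; have [v1 [tv1 -> he]] := covered _ Oj; have /andP[s0 st] := hsigma j.
  have tau0 : 0 < tau j by exact: lt_le_trans st.
  have [l [l0 ll lt]] := kappa_l_bound tau0 (htau_curv j).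
  by apply: (anchor_dist hM (hanchor j) (htau_inj j) l0 ll lt tv1 _ he); exact: A2_ran.
split=> [P0|y].
  exact: (karcher_set hM hb eps0 epsb k0 kk keps Mp0 w0 (fun j _ => Mq j) dq P0).
rewrite /is_MTSM => yE.
have [My ymin] : [set p | M p /\ forall q, M q ->
     (mtsm_objective d M anchor Omegaj ghat phi x p <=
      mtsm_objective d M anchor Omegaj ghat phi x q)%E] y by rewrite yE.
have [P0|nP] := pselect (exists j, w j != 0).
  exact: (karcher_near hM hb eps0 epsb k0 kk keps Mp0 w0 (fun j _ => Mq j) dq P0 My ymin).
(* All weights vanish: the objective is identically zero, so [f x] is a minimizer too, and
   uniqueness identifies it with [y]. *)
have obj0 p : mtsm_objective d M anchor Omegaj ghat phi x p = 0%E.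
  by rewrite /mtsm_objective big1 // => j wj; case: nP; exists j.
have : [set y] p0 by rewrite -yE; split => // p Mp; rewrite !obj0.
by move=> <-; rewrite (geodist_diag hM hb Mp0) lee_fin mulr_ge0.
Qed.
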